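(* Suppose that for every $F\in\mathcal F_0$ there exists $\ell_0=\ell_0(F)$ such that for every $\ell\ge\ell_0$ the following holds: for every real $\alpha>0$, if $\mathrm{ex}(n,F^\ell)=O(n^{1+\alpha})$ then $\mathrm{ex}(n,\mathrm{sub}(F^\ell))=O(n^{1+\alpha/2})$. Then for every rational number $r\in[1,2]$ there exists a graph $F$ with $\mathrm{ex}(n,F)=\Theta(n^r)$.
   Context: $\mathrm{ex}(n,F)$ is the maximum number of edges in an $n$-vertex graph with no subgraph isomorphic to $F$. A rooted graph is a pair $(F,R)$ with $R\subsetneq V(F)$. For $\ell\in\mathbb N$, the blow-up $F^\ell$ is obtained from $\ell$ vertex-disjoint copies of $F$ by identifying, for each $v\in R$, the $\ell$ copies of $v$. $\mathrm{sub}(F)$ is the $1$-subdivision of $F$ (each edge replaced by a path of length two through a new vertex), rooted on the same $R$. For a connected bipartite $F$ with bipartition $(A,B)$, $F(1)$ is obtained by adding new vertices $r_1,r_2$, joining $r_2$ to all of $A$, $r_1$ to all of $B$, and $r_1$ to $r_2$; it is rooted on $R\cup\{r_1,r_2\}$, and $F_*(1)$ is obtained from $F(1)$ by deleting all edges with both endpoints in $R\cup\{r_1,r_2\}$. $\mathcal F_0$ is the smallest family of rooted graphs that contains every star $K_{1,k}$ ($k\ge1$) rooted on its leaves and is closed under $F\mapsto\mathrm{sub}(F)$ and $F\mapsto F_*(1)$. *)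

(* Defs.v *)
From Stdlib Require Import Reals.
From mathcomp Require Import all_boot.
Set Implicit Arguments. Unset Strict Implicit. Unset Printing Implicit Defensive.

(** * Finite simple graphs.
    A graph is a finite vertex type with a raw relation [gE]; the simple graph
    it denotes has an edge {u,v} iff u <> v and (gE u v or gE v u). *)
Record graph := Graph { gV : finType; gE : rel gV }.

Definition gadj (G : graph) : rel (gV G) :=
  fun u v => (u != v) && (gE u v || gE v u).

(** Rooted graph (F,R).  (Properness R <> V(F) holds for every member of F_0
    and is not needed as a field.) *)
Record rootedGraph := RGraph { rg : graph; rR : {set gV rg} }.
Coercion rg : rootedGraph >-> graph.

Definition host_adj n (E : {set 'I_n * 'I_n}) : rel 'I_n :=
  fun i j => (i != j) && (((i, j) \in E) || ((j, i) \in E)).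

Definition nedges n (E : {set 'I_n * 'I_n}) : nat :=
  #|[set p : 'I_n * 'I_n | (p.1 < p.2)%N && host_adj E p.1 p.2]|.

Definition contains n (E : {set 'I_n * 'I_n}) (F : graph) : bool :=
  [exists f : {ffun gV F -> 'I_n},
     injectiveb f && [forall u, forall v, gadj u v ==> host_adj E (f u) (f v)]].

Definition ex (n : nat) (F : graph) : nat :=
  \max_(E : {set 'I_n * 'I_n} | ~~ contains E F) nedges E.

Definition star_graph (k : nat) : graph :=
  @Graph (option 'I_k) (fun u v => (u == None) && (v != None)).
Definition star (k : nat) : rootedGraph :=
  @RGraph (star_graph k) [set x | x != None].

Section Blowup.
Variables (F : rootedGraph) (l : nat).
Definition bu_V : finType :=
  ({x : gV F | x \in rR F} + ({x : gV F | x \notin rR F} * 'I_l))%type.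
Definition bu_proj (x : bu_V) : gV F :=
  match x with inl r => val r | inr p => val p.1 end.
Definition bu_copy (x : bu_V) : option 'I_l :=
  match x with inl _ => None | inr p => Some p.2 end.
Definition bu_E : rel bu_V := fun x y =>
  gadj (bu_proj x) (bu_proj y) &&
  match bu_copy x, bu_copy y with Some i, Some j => i == j | _, _ => true end.
Definition blowup : rootedGraph :=
  @RGraph (@Graph bu_V bu_E) [set x : bu_V | if x is inl _ then true else false].
End Blowup.

Section Subdivision.
Variable F : rootedGraph.
Definition is_edge (e : {set gV F}) : bool :=
  [exists u, exists v, (e == [set u; v]) && gadj u v].
Definition sd_V : finType := (gV F + {e : {set gV F} | is_edge e})%type.
Definition sd_E : rel sd_V := fun x y =>
  match x, y with inl u, inr e => u \in val e | _, _ => false end.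
Definition rsub : rootedGraph :=
  @RGraph (@Graph sd_V sd_E)
    [set x : sd_V | if x is inl v then v \in rR F else false].
End Subdivision.

(** F connected, and c a proper 2-colouring (bipartition A = c^-1 true, B = c^-1 false). *)
Definition connected (G : graph) : Prop := forall u v : gV G, connect (@gadj G) u v.
Definition bipartition (G : graph) (c : gV G -> bool) : Prop :=
  forall u v, gadj u v -> c u != c v.

(** F(1): new vertices r1 = inr true, r2 = inr false; r2 ~ A, r1 ~ B, r1 ~ r2;
    rooted on R ∪ {r1,r2}. *)
Section F1.
Variables (F : rootedGraph) (c : gV F -> bool).
Definition f1_V : finType := (gV F + bool)%type.
Definition f1_E : rel f1_V := fun x y =>
  match x, y with
  | inl u, inl v => gadj u v
  | inr true, inl v => ~~ c v
  | inr false, inl v => c v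
  | inr true, inr false => true
  | _, _ => false
  end.
Definition F1 : rootedGraph :=
  @RGraph (@Graph f1_V f1_E) [set x : f1_V | if x is inl v then v \in rR F else true].
End F1.

Definition del_root_edges (F : rootedGraph) : rootedGraph :=
  @RGraph (@Graph (gV F) (fun u v => gadj u v && ~~ ((u \in rR F) && (v \in rR F))))
          (rR F).

Definition Fstar1 (F : rootedGraph) (c : gV F -> bool) : rootedGraph := del_root_edges (F1 c).

Inductive inF0 : rootedGraph -> Prop :=
| F0_star k : (0 < k)%N -> inF0 (star k)
| F0_sub F : inF0 F -> inF0 (rsub F)
| F0_star1 (F : rootedGraph) (c : gV F -> bool) :
    inF0 F -> connected F -> bipartition c -> inF0 (Fstar1 c).

Definition bigO (f g : nat -> R) : Prop :=
  exists (C : R) (n0 : nat), forall n : nat, (n0 <= n)%N -> Rle (f n) (Rmult C (g n)).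
Definition bigTheta (f g : nat -> R) : Prop := bigO f g /\ bigO g f.

(* Main.v *)
Require Import Defs.
From Stdlib Require Import Reals Lra.
From mathcomp Require Import all_boot all_order all_algebra all_field.
From mathcomp Require Import boolp zify.
From mathcomp Require ring.
Set Implicit Arguments. Unset Strict Implicit. Unset Printing Implicit Defensive.

(** Write [rho = q / (2q - p)], so that [p / q = 2 - 1 / rho]; the case [rho = oo] is the
    triangle.  Every rational [rho >= 1] is the density (edges per nonroot vertex) of a
    balanced member of [F_0]: integers come from stars, [F |-> F_*(1)] maps [rho] to
    [rho + 1], subdivision maps [rho] to [2 rho / (1 + rho)], and undoing these steps
    decreases numerator plus denominator.

    Upper bounds follow the same recursion, by the hypothesis for subdivisions and the
    Erdős–Simonovits reduction for [F_*(1)].  For the latter, pass to a bipartite subgraph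
    of maximal density; by Cauchy–Schwarz some edge [xy] has so many edges between [N(x)]
    and [N(y)] that subsets of size the minimum degree already contain the smaller graph.

    Lower bounds are those of Bukh and Conlon: over [F_q], join [x, y] in [F_q^a] when [b]
    random polynomials of large degree vanish at [(x, y)].  The copies of a balanced rooted
    graph with given roots form a definable set over the algebraic closure, so each of
    their coordinates takes boundedly many values or all but boundedly many (quantifier
    elimination).  In the second case the coefficients together with [s] values of that
    coordinate would form a definable set of dimension exceeding the number [N] of
    coefficients, unless the coefficients are confined to [O(q^(N - s))] choices: by
    Cramer's rule [s] copies are rationally parametrised by at most [N] quantities, so any
    [N + 1] of these coordinates are algebraically dependent.  Hence for some choice of
    polynomials all root sets have boundedly many copies. *)

(** * Definable sets over an algebraically closed field *)

(** Throughout, [a] and [b] encode the density [a / b]: a host has q^a vertices and edge probability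
    about q^(-b), hence about n^(2 - b/a) edges. The constants coming from quantifier elimination
    must be fixed before q, so all the fields F_q are taken inside one closure, as F_(2^j); the gaps
    between the resulting orders (2^a)^j cost only a constant factor.

    The degrees in the Erdős-Simonovits step have no upper bound. Weighting closed walks of length
    four by inverse degrees replaces a passage to an almost regular subgraph.

    Blow-ups pass through both operations by an inclusion: the blow-up of sub(F) or F_*(1) embeds in
    the subdivision, or the (1)-extension, of the blow-up, and upper bounds pass to subgraphs. For
    subdivisions this requires that no edge joins two roots. For F_*(1) each colour class must
    contain a nonroot, or a new root would become isolated and connectedness, required for the next
    step, would be lost. Stars violate this condition, which is why integral densities are base
    cases. *)

Section Definable.
Import GRing.Theory.
Local Open Scope ring_scope.
Variable K : closedFieldType.

Lemma roots_seq (p : {poly K}) : p != 0 ->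
  exists2 L : seq K, (size L < size p)%N & forall x, root p x -> x \in L.
Proof.
move=> p0; have [L Lp] := closed_field_poly_normal p.
exists L.
  rewrite Lp size_scale ?lead_coef_eq0 // size_prod_XsubC //.
by move=> x; rewrite Lp rootZ ?lead_coef_eq0 // root_prod_XsubC.
Qed.

Lemma closedField_fresh (L : seq K) : exists x, x \notin L.
Proof.
have p0 : \prod_(z <- L) ('X - z%:P) != 0 :> {poly K}.
  by rewrite monic_neq0 // monic_prod_XsubC.
have [x] := closed_nonrootP _ p0.
by rewrite root_prod_XsubC; exists x.
Qed.

(** An equation between terms is polynomial in the variable [i], of degree bounded by the syntax
    alone: it is an identity or has boundedly many roots. Connectives concatenate the exceptional
    lists, so [D] is uniform in [s]. *)
Lemma qf_generic_truth (f : GRing.formula K) (i : nat) :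
  GRing.qf_form f -> GRing.rformula f ->
  exists (g : GRing.formula K) (D : nat), forall s : seq K,
    exists2 L : seq K, (size L <= D)%N &
      forall x, x \notin L -> GRing.holds (set_nth 0 s i x) f <-> GRing.holds s g.
Proof.
elim: f => //=.
- by move=> b _ _; exists (GRing.Bool b), 0%N => s; exists [::].
- move=> t1 t2 _ /andP[r1 r2].
  (* Off the roots of a nonzero difference the equation fails, so its generic truth value is that of
     the identity in [i]. *)
  exists (GRing.Forall i (GRing.Equal t1 t2)).
  exists (size (ClosedFieldQE.abstrX i t1) + size (ClosedFieldQE.abstrX i t2))%N => s.
  pose P t := ClosedFieldQE.eval_poly s (ClosedFieldQE.abstrX i t).
  have szP t : (size (P t) <= size (ClosedFieldQE.abstrX i t))%N.
    rewrite /P; elim: (ClosedFieldQE.abstrX i t) => [|c u IH] /=.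
      by rewrite size_poly0.
    apply: leq_trans (size_polyD _ _) _; rewrite geq_max.
    apply/andP; split.
      by case: eqP (size_mulX (p := ClosedFieldQE.eval_poly s u)) => [->|_ ->//];
         rewrite mul0r size_poly0.
    by apply: leq_trans (size_polyC_leq1 _) _.
  have [p0|p0] := eqVneq (P t1 - P t2) 0.
    have E y : GRing.eval (set_nth 0 s i y) t1 = GRing.eval (set_nth 0 s i y) t2.
      rewrite -!ClosedFieldQE.abstrXP //.
      by move/eqP: p0; rewrite subr_eq0 => /eqP; rewrite /P => ->.
    by exists [::].
  have [L szL HL] := roots_seq p0; exists L.
    apply: leq_trans (ltnW szL) _; apply: leq_trans (size_polyD _ _) _.
    rewrite size_polyN geq_max (leq_trans (szP t1)) ?leq_addr //.
    by rewrite (leq_trans (szP t2)) ?leq_addl.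
  move=> x xL; split.
    rewrite -!ClosedFieldQE.abstrXP // => e; case/negP: xL; apply: HL.
    by rewrite rootE hornerD hornerN subr_eq0; apply/eqP.
  move=> H; have [y] := closed_nonrootP _ p0.
  rewrite rootE hornerD hornerN subr_eq0 /P !ClosedFieldQE.abstrXP // => /eqP.
  by move: (H y).
- move=> f1 IH1 f2 IH2 /andP[q1 q2] /andP[r1 r2].
  have [g1 [D1 H1]] := IH1 q1 r1; have [g2 [D2 H2]] := IH2 q2 r2.
  exists (GRing.And g1 g2), (D1 + D2)%N => s.
  have [L1 s1 h1] := H1 s; have [L2 s2 h2] := H2 s.
  exists (L1 ++ L2); first by rewrite size_cat leq_add.
  by move=> x; rewrite mem_cat negb_or => /andP[/h1 e1 /h2 e2] /=; rewrite e1 e2.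
- move=> f1 IH1 f2 IH2 /andP[q1 q2] /andP[r1 r2].
  have [g1 [D1 H1]] := IH1 q1 r1; have [g2 [D2 H2]] := IH2 q2 r2.
  exists (GRing.Or g1 g2), (D1 + D2)%N => s.
  have [L1 s1 h1] := H1 s; have [L2 s2 h2] := H2 s.
  exists (L1 ++ L2); first by rewrite size_cat leq_add.
  by move=> x; rewrite mem_cat negb_or => /andP[/h1 e1 /h2 e2] /=; rewrite e1 e2.
- move=> f1 IH1 f2 IH2 /andP[q1 q2] /andP[r1 r2].
  have [g1 [D1 H1]] := IH1 q1 r1; have [g2 [D2 H2]] := IH2 q2 r2.
  exists (GRing.Implies g1 g2), (D1 + D2)%N => s.
  have [L1 s1 h1] := H1 s; have [L2 s2 h2] := H2 s.
  exists (L1 ++ L2); first by rewrite size_cat leq_add.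
  by move=> x; rewrite mem_cat negb_or => /andP[/h1 e1 /h2 e2] /=; rewrite e1 e2.
- move=> f1 IH1 q1 r1.
  have [g1 [D1 H1]] := IH1 q1 r1.
  exists (GRing.Not g1), D1 => s.
  have [L1 s1 h1] := H1 s.
  by exists L1 => // x /h1 e1 /=; rewrite e1.
Qed.

Lemma generic_truth (f : GRing.formula K) (i : nat) :
  exists (g : GRing.formula K) (D : nat), forall s : seq K,
    exists2 L : seq K, (size L <= D)%N &
      forall x, x \notin L -> GRing.holds (set_nth 0 s i x) f <-> GRing.holds s g.
Proof.
have rf := GRing.to_rform_rformula f.
pose qe := GRing.quantifier_elim (@ClosedFieldQE.ex_elim K).
have /andP[qf rq] := GRing.quantifier_elim_wf (@ClosedFieldQE.wf_ex_elim K) rf.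
have qeP s : GRing.holds s (qe (GRing.to_rform f)) <-> GRing.holds s f.
  have h1 := GRing.qf_evalP s qf.
  have h2 := GRing.quantifier_elim_rformP (@ClosedFieldQE.wf_ex_elim K)
    (ClosedFieldQE.holds_ex_elim (@GRing.solve_monicpoly K)) s rf.
  by rewrite -(GRing.to_rformP s f) (rwP h1) (rwP h2).
have [g [D H]] := qf_generic_truth i qf rq.
by exists g, D => s; have [L sL HL] := H s; exists L => // x /HL <-; rewrite qeP.
Qed.

Variable J : finType.
Implicit Types (e : {ffun J -> K}) (P Q : {ffun J -> K} -> Prop).

Definition upd e (j : J) (x : K) : {ffun J -> K} :=
  [ffun i => if i == j then x else e i].

Definition env_of (s : seq K) : {ffun J -> K} := [ffun j => s`_(enum_rank j)].

Lemma env_of_surj e : exists s, env_of s = e.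
Proof.
exists [seq e j | j <- enum J]; apply/ffunP=> j; rewrite ffunE.
by rewrite (nth_map j) ?nth_enum_rank // -cardE ltn_ord.
Qed.

Lemma env_of_set_nth s j x : env_of (set_nth 0 s (enum_rank j) x) = upd (env_of s) j x.
Proof.
apply/ffunP=> i; rewrite !ffunE nth_set_nth /= (inj_eq val_inj) (inj_eq enum_rank_inj).
by [].
Qed.

(** Quantifying over all [s] forces the truth of [f] to depend only on the positions that encode
    [J]. *)
Definition definable P :=
  exists f : GRing.formula K, forall s, GRing.holds s f <-> P (env_of s).

Definition term_fun (h : {ffun J -> K} -> K) :=
  exists t : GRing.term K, forall s, GRing.eval s t = h (env_of s).

Lemma term_var j : term_fun (fun e => e j).
Proof. by exists (GRing.Var _ (enum_rank j)) => s; rewrite ffunE. Qed.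

Lemma term_const c : term_fun (fun=> c).
Proof. by exists (GRing.Const c). Qed.

Lemma term_mul h1 h2 : term_fun h1 -> term_fun h2 -> term_fun (fun e => h1 e * h2 e).
Proof. by move=> [t1 H1] [t2 H2]; exists (GRing.Mul t1 t2) => s /=; rewrite H1 H2. Qed.

Lemma term_exp h n : term_fun h -> term_fun (fun e => h e ^+ n).
Proof. by move=> [t1 H1]; exists (GRing.Exp t1 n) => s /=; rewrite H1. Qed.

Lemma term_sum (I : Type) (r : seq I) (h : I -> {ffun J -> K} -> K) :
  (forall i, term_fun (h i)) -> term_fun (fun e => \sum_(i <- r) h i e).
Proof.
move=> H; elim: r => [|i r [t Ht]].
  by exists (GRing.Const 0) => s; rewrite big_nil.
by have [u Hu] := H i; exists (GRing.Add u t) => s /=; rewrite Hu Ht big_cons.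
Qed.

Lemma term_prod (I : Type) (r : seq I) (h : I -> {ffun J -> K} -> K) :
  (forall i, term_fun (h i)) -> term_fun (fun e => \prod_(i <- r) h i e).
Proof.
move=> H; elim: r => [|i r [t Ht]].
  by exists (GRing.Const 1) => s; rewrite big_nil.
by have [u Hu] := H i; exists (GRing.Mul u t) => s /=; rewrite Hu Ht big_cons.
Qed.

Lemma definable_iff P Q : (forall e, P e <-> Q e) -> definable P -> definable Q.
Proof. by move=> H [f Hf]; exists f => s; rewrite Hf H. Qed.

Lemma definable_eq h1 h2 : term_fun h1 -> term_fun h2 -> definable (fun e => h1 e = h2 e).
Proof. by move=> [t1 H1] [t2 H2]; exists (GRing.Equal t1 t2) => s /=; rewrite H1 H2. Qed.

Lemma definable_and P Q : definable P -> definable Q -> definable (fun e => P e /\ Q e).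
Proof. by move=> [f Hf] [g Hg]; exists (GRing.And f g) => s /=; rewrite Hf Hg. Qed.

Lemma definable_or P Q : definable P -> definable Q -> definable (fun e => P e \/ Q e).
Proof. by move=> [f Hf] [g Hg]; exists (GRing.Or f g) => s /=; rewrite Hf Hg. Qed.

Lemma definable_not P : definable P -> definable (fun e => ~ P e).
Proof. by move=> [f Hf]; exists (GRing.Not f) => s /=; rewrite Hf. Qed.

Lemma definable_bool (b : bool) : definable (fun=> b).
Proof. by exists (GRing.Bool b). Qed.

Lemma definable_imply (b : bool) P : definable P -> definable (fun e => b -> P e).
Proof.
case: b => H; first by apply: definable_iff H => e; split=> [? //|]; apply.
by apply: (@definable_iff (fun=> true)) (definable_bool _).
Qed.

Lemma definable_all (I : finType) (P : I -> {ffun J -> K} -> Prop) :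
  (forall i, definable (P i)) -> definable (fun e => forall i, P i e).
Proof.
move=> H; suff HH (r : seq I) : definable (fun e => forall i, i \in r -> P i e).
  apply: definable_iff (HH (enum I)) => e.
  by split=> [h i|h i _]; first apply: h; rewrite ?mem_enum.
elim: r => [|i r IH].
  by apply: (@definable_iff (fun=> true)) (definable_bool _).
apply: definable_iff (definable_and (H i) IH) => e; split.
  by move=> [h1 h2] j; rewrite inE => /predU1P[->//|/h2].
by move=> h; split=> [|j jr]; apply: h; rewrite inE ?eqxx // jr orbT.
Qed.

Lemma definable_ex (I : finType) (P : I -> {ffun J -> K} -> Prop) :
  (forall i, definable (P i)) -> definable (fun e => exists i, P i e).
Proof.
move=> H; apply: definable_iff
  (definable_not (definable_all (fun i => definable_not (H i)))) => e.
split=> [h|[i Pi] h]; last exact: (h i).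
by apply: contrapT => h'; apply: h => i Pi; apply: h'; exists i.
Qed.

Lemma definable_upd P j : definable P -> definable (fun e => exists x, P (upd e j x)).
Proof.
move=> [f Hf]; exists (GRing.Exists (enum_rank j) f) => s /=.
by split=> -[x Hx]; exists x; move: Hx; rewrite Hf env_of_set_nth.
Qed.

Lemma definable_generic P j : definable P ->
  exists (Q : {ffun J -> K} -> Prop) (D : nat), definable Q /\
    forall e, exists2 L : seq K, (size L <= D)%N &
      forall x, x \notin L -> P (upd e j x) <-> Q e.
Proof.
move=> [f Hf]; have [g [D H]] := generic_truth f (enum_rank j).
(* [g] may read positions outside [J]. Its truth is still determined by [e]: two sequences encoding
   [e] share a nonexceptional [x], at which both agree with [P]. *)
pose Q e := exists s, env_of s = e /\ GRing.holds s g.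
have QE s : GRing.holds s g <-> Q (env_of s).
  split=> [h|[s' [es h]]]; first by exists s.
  have [L _ HL] := H s; have [L' _ HL'] := H s'.
  have [x] := closedField_fresh (L ++ L'); rewrite mem_cat negb_or => /andP[xL xL'].
  by apply/(HL x xL)/Hf; rewrite env_of_set_nth -es -env_of_set_nth -Hf; apply/HL'.
exists Q, D; split; first by exists g.
move=> e; have [s <-] := env_of_surj e; have [L sL HL] := H s; exists L => // x xL.
by rewrite -env_of_set_nth -Hf -QE; apply: HL.
Qed.

End Definable.

(** * Counting points of definable sets *)

Lemma count_le_sum_count (T : Type) (I : finType) (P : pred T) (Q : I -> pred T) (s : seq T) :
  (forall x, P x -> exists i, Q i x) -> (count P s <= \sum_i count (Q i) s)%N.
Proof.
move=> H; elim: s => [|x s IH] //=.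
rewrite big_split /= leq_add //.
case Px : (P x) => //; have [i Qi] := H x Px.
by rewrite (bigD1 i) //= Qi.
Qed.

Lemma size_fibers (T U : eqType) (f : T -> U) (S : seq T) (A : seq U) :
  uniq A -> (forall y, y \in S -> f y \in A) ->
  size S = (\sum_(x <- A) size [seq y <- S | f y == x])%N.
Proof.
move=> uA; elim: S => [|y S IH] H /=; first by rewrite big1.
rewrite IH => [|z zS]; last by apply: H; rewrite inE zS orbT.
have fA : f y \in A by apply: H; rewrite inE eqxx.
rewrite (bigD1_seq (f y)) //= [RHS](bigD1_seq (f y)) //= eqxx /= addSn.
by congr (_ + _).+1; apply: eq_bigr => x; rewrite eq_sym => /negPf->.
Qed.

Section DefinableCount.
Variable (K : closedFieldType) (J : finType).
Implicit Types (e : {ffun J -> K}) (Q : {ffun J -> K} -> Prop).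

Definition infinitely_many (P : K -> Prop) :=
  forall L : seq K, exists2 x, x \notin L & P x.

(** A substitute for dimension: the fibre of [Q] over [e] in the directions [l] branches infinitely
    often at every true flag, so the number of true flags is a lower bound for its dimension. *)
Fixpoint flagged Q (l : seq (J * bool)) e : Prop :=
  match l with
  | [::] => Q e
  | (j, true) :: l' => infinitely_many (fun x => flagged Q l' (upd e j x))
  | (j, false) :: l' => exists x, flagged Q l' (upd e j x)
  end.

(** A generically true condition has cofinitely many witnesses, a generically false one at most [D].
    Hence more than [D] witnesses mean infinitely many, and this quantifier stays first-order. *)
Lemma infinitely_many_generic Q j : definable Q ->
  exists D, definable (fun e => infinitely_many (fun x => Q (upd e j x))) /\
    forall e (s : seq K), uniq s -> (D < size s)%N ->
      (forall x, x \in s -> Q (upd e j x)) -> infinitely_many (fun x => Q (upd e j x)).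
Proof.
move=> dQ; have [Q' [D [dQ' H]]] := definable_generic j dQ.
have HQ e : Q' e <-> infinitely_many (fun x => Q (upd e j x)).
  have [L _ HL] := H e; split=> [Qe M|/(_ L)[x xL]]; last by rewrite HL.
  have [x] := closedField_fresh (L ++ M); rewrite mem_cat negb_or => /andP[xL xM].
  by exists x => //; apply/HL.
exists D; split; first exact: definable_iff HQ dQ'.
move=> e s us sD Hs; apply/HQ; have [L sL HL] := H e.
have /hasP[x xs xL] : has (fun x => x \notin L) s.
  apply/negPn/negP; rewrite -all_predC => /allP sub.
  have : (size s <= size L)%N by apply: uniq_leq_size => // x /sub /=; rewrite negbK.
  by lia.
by apply/(HL x xL); apply: Hs.
Qed.

Lemma definable_flagged Q l : definable Q -> definable (flagged Q l).
Proof.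
move=> dQ; elim: l => [//|[j []] l IH] /=; last exact: definable_upd.
by have [D []] := infinitely_many_generic j IH.
Qed.

(** The bound on grid points in dimension below [n]; only the empty set has dimension below 0. *)
Definition count_bound (C n q : nat) : nat := if n is m.+1 then C * q ^ m else 0.

(** Slice along the first variable. If no slice has [n] flags and no pattern with [n - 1] flags
    occurs in infinitely many slices, then boundedly many slices have [n - 1] flags, and the others
    are smaller by a factor of the grid size. Parameters [e] and grids [A] share one constant. *)
Lemma definable_Schwartz_Zippel Q (l : seq J) n : definable Q -> exists C : nat,
  forall (A : seq K) e (S : seq {ffun J -> K}), uniq A -> (0 < size A)%N -> uniq S ->
    (forall e', e' \in S ->
       [/\ Q e', forall j, j \notin l -> e' j = e j & forall j, j \in l -> e' j \in A]) ->
    (count_bound C n (size A) < size S)%N ->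
    exists bs : seq bool, [/\ size bs = size l, count id bs = n & flagged Q (zip l bs) e].
Proof.
move=> dQ; elim: l n => [|v l IH] n.
  exists 1%N => A e S uA A0 uS H sS.
  have eS e' : e' \in S -> e' = e.
    by move=> /H[_ h _]; apply/ffunP=> j; apply: h.
  have S1 : (size S <= 1)%N.
    by have := @uniq_leq_size _ S [:: e] uS; apply=> e' /eS->; rewrite inE.
  case: n sS => [|n] sS; last first.
    have A1 : (0 < size A ^ n)%N by rewrite expn_gt0 A0.
    by move: sS; rewrite /= mul1n; lia.
  exists [::]; split=> //=.
  by case: S uS H sS S1 eS => //= e' S _ H _ _ eS; rewrite -(eS e') ?inE ?eqxx //;
     have [] := H e' (mem_head _ _).
case: n => [|m].
  have [C H0] := IH 0%N; exists 0%N => A e S uA A0 uS H sS.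
  case: S uS H sS => // e' S uS H _.
  have [Qe' h1 h2] := H e' (mem_head _ _).
  have [] := H0 A (upd e v (e' v)) [:: e'] uA A0 isT _ isT.
    move=> e''; rewrite inE => /eqP->; split=> // j.
      move=> jl; rewrite ffunE; case: eqP => [->//|/eqP jv].
      by apply: h1; rewrite inE negb_or jv.
    by move=> jl; apply: h2; rewrite inE jl orbT.
  by move=> bs [sb cb fb]; exists (false :: bs); split=> //=; [rewrite sb|exists (e' v)].
have [C1 H1] := IH m; have [C0 H0] := IH m.+1.
have HD (bs : (size l).-tuple bool) : exists D, forall e (s : seq K), uniq s -> (D < size s)%N ->
    (forall x, x \in s -> flagged Q (zip l bs) (upd e v x)) ->
    infinitely_many (fun x => flagged Q (zip l bs) (upd e v x)).
  have [D [_ HD]] := infinitely_many_generic v (definable_flagged (zip l bs) dQ).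
  by exists D.
have [D {}HD] := choice HD.
(* More than [G] slices with [m] flags would give some pattern more than its own threshold [D bs],
   hence infinitely many slices. *)
pose G := (\sum_(bs : (size l).-tuple bool) D bs)%N.
exists (G * C0 + C1)%N => A e S uA A0 uS H sS.
pose good k x := `[< exists bs : (size l).-tuple bool,
  count id bs = k /\ flagged Q (zip l bs) (upd e v x) >].
have [/hasP[x xA /asboolP[bs [cb fb]]]|/hasPn ng] := boolP (has (good m.+1) A).
  by exists (false :: bs); split=> //=; [rewrite size_tuple|exists x].
have [Gm|Gm] := ltnP G (count (good m) A).
  have : (G < \sum_(bs : (size l).-tuple bool)
      count (fun x => (count id bs == m) && `[< flagged Q (zip l bs) (upd e v x) >]) A)%N.
    apply: leq_trans Gm _; apply: count_le_sum_count => x /asboolP[bs [cb fb]].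
    by exists bs; rewrite cb eqxx; apply/asboolP.
  move=> HG; have /existsP[bs Hbs] : [exists bs : (size l).-tuple bool, (D bs <
      count (fun x => (count id bs == m) && `[< flagged Q (zip l bs) (upd e v x) >]) A)%N].
    apply: contraT => /existsPn hh.
    by move: HG; rewrite ltnNge leq_sum // => bs _; rewrite leqNgt hh.
  have cb : count id bs = m.
    apply/eqP; apply/negPn/negP => /negPf E; move: Hbs.
    by rewrite (eq_count (a2 := pred0)) ?count_pred0 // => x; rewrite E.
  exists (true :: bs); split=> /=; rewrite ?size_tuple ?cb //.
  apply: (HD bs e [seq x <- A | `[< flagged Q (zip l bs) (upd e v x) >]]).
  - exact: filter_uniq.
  - rewrite size_filter; apply: leq_trans Hbs _; apply: sub_count => x /=.
    by case/andP.
  - by move=> x; rewrite mem_filter => /andP[/asboolP].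
exfalso; move: sS; apply/negP; rewrite -leqNgt /=.
pose Sx (x : K) := [seq e' : {ffun J -> K} <- S | e' v == x].
have HS x : x \in A -> forall e', e' \in Sx x ->
    [/\ Q e', forall j, j \notin l -> e' j = upd e v x j & forall j, j \in l -> e' j \in A].
  move=> xA e'; rewrite mem_filter => /andP[/eqP ev /H[Qe h1 h2]]; split=> // j jl.
    rewrite ffunE; case: eqP => [->//|/eqP jv].
    by apply: h1; rewrite inE negb_or jv.
  by apply: h2; rewrite inE jl orbT.
have b0 x : x \in A -> (size (Sx x) <= C0 * size A ^ m)%N.
  move=> xA; rewrite leqNgt; apply/negP => hs.
  have [bs [sb cb fb]] := H0 A (upd e v x) (Sx x) uA A0 (filter_uniq _ uS) (HS x xA) hs.
  case/negP: (ng x xA); apply/asboolP.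
  by exists (tcast sb (in_tuple bs)); rewrite val_tcast.
have b1 x : x \in A -> ~~ good m x -> (size (Sx x) <= count_bound C1 m (size A))%N.
  move=> xA gx; rewrite leqNgt; apply/negP => hs.
  have [bs [sb cb fb]] := H1 A (upd e v x) (Sx x) uA A0 (filter_uniq _ uS) (HS x xA) hs.
  case/negP: gx; apply/asboolP.
  by exists (tcast sb (in_tuple bs)); rewrite val_tcast.
rewrite (@size_fibers _ _ (fun e' : {ffun J -> K} => e' v) S A uA); last first.
  by move=> e' /H[_ _]; apply; rewrite inE eqxx.
(* At most [G] good slices contribute [C0 * q ^ m] points each, and at most [q] others
   [C1 * q ^ (m - 1)] each, or none if [m = 0]. *)
rewrite (bigID (good m)) /= mulnDl leq_add //.
  apply: (@leq_trans (\sum_(x <- A | good m x) C0 * size A ^ m)).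
    by rewrite big_seq_cond [X in (_ <= X)%N]big_seq_cond; apply: leq_sum => x /andP[xA _];
      apply: b0.
  by rewrite big_const_seq iter_addn_0 mulnC -mulnA leq_mul2r Gm orbT.
apply: (@leq_trans (\sum_(x <- A) count_bound C1 m (size A))).
  rewrite [X in (_ <= X)%N](bigID (good m)) /=.
  apply: leq_trans (leq_addl _ _).
  by rewrite big_seq_cond [X in (_ <= X)%N]big_seq_cond; apply: leq_sum => x /andP[xA]; apply: b1.
rewrite big_const_seq count_predT iter_addn_0.
have E : (count_bound C1 m (size A) * size A <= C1 * size A ^ m)%N.
  by case: (m) => [|k] //=; rewrite expnSr mulnA.
exact: E.
Qed.

End DefinableCount.

(** * Polynomial functions and algebraic relations *)

Section PolynomialFunctions.
Import GRing.Theory.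
Local Open Scope ring_scope.

Lemma linear_dependency (K : fieldType) (X Y : finType) (M : X -> Y -> K)
    (A : {set X}) (B : {set Y}) : (#|B| < #|A|)%N ->
  exists c : {ffun X -> K}, [/\ exists x, c x != 0, forall x, x \notin A -> c x = 0
    & forall y, y \in B -> \sum_x c x * M x y = 0].
Proof.
move=> ltBA; pose N := \matrix_(i < #|A|, j < #|B|) M (enum_val i) (enum_val j).
have : kermx N != 0.
  rewrite -mxrank_eq0 mxrank_ker subn_eq0 -ltnNge.
  by apply: leq_ltn_trans (rank_leq_col _) ltBA.
case/rowV0Pn => v /sub_kermxP vN v0.
have [i vi] : exists i, v 0 i != 0 by apply/rV0Pn.
have xA := enum_valP i.
exists [ffun x => if x \in A then v 0 (enum_rank_in xA x) else 0]; split.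
- by exists (enum_val i); rewrite ffunE xA enum_valK_in.
- by move=> x /negPf xnA; rewrite ffunE xnA.
move=> y yB; move/rowP/(_ (enum_rank_in yB y)): vN; rewrite !mxE => vN.
rewrite (bigID (mem A)) /= [X in _ + X]big1 ?addr0; last first.
  by move=> x /negPf xnA; rewrite ffunE xnA mul0r.
rewrite big_enum_val /= -[RHS]vN; apply: eq_bigr => k _.
by rewrite ffunE enum_valP enum_valK_in !mxE enum_rankK_in.
Qed.

Variable K : closedFieldType.

Definition mono (J : finType) (y : {ffun J -> K}) E (m : {ffun J -> 'I_E}) : K :=
  \prod_j y j ^+ m j.

Definition supported (J : finType) E (T : {set J}) (m : {ffun J -> 'I_E.+1}) :=
  [forall j, (j \notin T) ==> (m j == ord0)].

Lemma supportedP (J : finType) E (T : {set J}) (m : {ffun J -> 'I_E.+1}) :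
  reflect (forall j, j \notin T -> m j = ord0) (supported T m).
Proof.
apply: (iffP forallP) => H j; first by move=> jT; have := H j; rewrite jT => /eqP.
by apply/implyP=> /H ->.
Qed.

Lemma card_supported (J : finType) E (T : {set J}) :
  #|[set m : {ffun J -> 'I_E.+1} | supported T m]| = (E.+1 ^ #|T|)%N.
Proof.
rewrite -[in RHS](card_ord E.+1) -(card_pffun_on ord0 T predT).
apply: eq_card => m; rewrite inE; apply/supportedP/pffun_onP.
  move=> H; split=> // ; apply/supportP=> j jT; exact: H.
by case=> /supportP H _ j; apply: H.
Qed.

(** * Algebraic independence of the flagged coordinates *)

Section Independence.
Variable J : finType.
Implicit Types (e : {ffun J -> K}) (Q : {ffun J -> K} -> Prop).

Definition set_exp E (m : {ffun J -> 'I_E}) v k : {ffun J -> 'I_E} :=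
  [ffun j => if j == v then k else m j].

(** Substituting for [v] keeps the type of coefficient tables: the new coefficients sit at the
    exponents with [m v = 0]. This lets the induction on variables run within one type. *)
Lemma sum_mono_specialize E (c : {ffun J -> 'I_E.+1} -> K) v e' :
  \sum_(m : {ffun J -> 'I_E.+1}) (if m v == ord0 then \sum_k c (set_exp m v k) * e' v ^+ k else 0)
    * mono e' m
  = \sum_m c m * mono e' m.
Proof.
rewrite (bigID (fun m : {ffun J -> 'I_E.+1} => m v == ord0)) /= [X in _ + X]big1 ?addr0; last first.
  by move=> m /negPf->; rewrite mul0r.
rewrite (eq_bigr (fun m => \sum_k c (set_exp m v k) * mono e' (set_exp m v k))); last first.
  move=> m mv; rewrite mv mulr_suml; apply: eq_bigr => k _; rewrite -mulrA; congr (_ * _).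
  rewrite /mono (bigD1 v) //= (eqP mv) expr0 mul1r [RHS](bigD1 v) //= ffunE eqxx.
  by congr (_ * _); apply: eq_bigr => j /negPf jv; rewrite ffunE jv.
rewrite pair_big_dep /=.
rewrite (reindex (fun m : {ffun J -> 'I_E.+1} => (set_exp m v ord0, m v))) /=.
  apply: eq_big => [m|m _]; first by rewrite ffunE eqxx.
  have -> // : set_exp (set_exp m v ord0) v (m v) = m.
  by apply/ffunP=> j; rewrite !ffunE; case: eqP => [->|].
exists (fun p => set_exp p.1 v p.2) => [m _|[m k]] /=.
  by apply/ffunP=> j; rewrite !ffunE; case: eqP => [->|].
rewrite inE /= andbT => /eqP mv; congr (_, _); last by rewrite ffunE eqxx.
by apply/ffunP=> j; rewrite !ffunE; case: eqP => [->|].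
Qed.

(** At a true flag the specialised coefficients vanish, by induction, for infinitely many values of
    the variable, hence identically. At a false flag the variable occurs in no monomial and may be
    fixed. *)
Lemma flagged_independent Q (l : seq J) bs e E (c : {ffun {ffun J -> 'I_E.+1} -> K}) :
  uniq l -> size bs = size l -> flagged Q (zip l bs) e ->
  (forall m, c m != 0 -> supported [set j | (j, true) \in zip l bs] m) ->
  (forall e', Q e' -> (forall j, j \notin l -> e' j = e j) -> \sum_m c m * mono e' m = 0) ->
  forall m, c m = 0.
Proof.
elim: l bs e c => [|v l IH] [|b bs] e c //=.
  move=> _ _ Qe supp H m.
  have all0 m' : c m' != 0 -> m' = [ffun=> ord0].
    move=> /supp /supportedP h; apply/ffunP=> j; rewrite ffunE; apply: h.
    by rewrite inE in_nil.
  apply/eqP; apply: contraT => cm; have Em := all0 m cm.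
  have := H e Qe (fun _ _ => erefl); rewrite (bigD1 m) //= big1 ?addr0; last first.
    move=> m' m'm; have [->|/all0 e'] := eqVneq (c m') 0; first by rewrite mul0r.
    by rewrite e' -Em eqxx in m'm.
  have -> : mono e m = 1 by rewrite /mono big1 // => j _; rewrite Em ffunE expr0.
  by rewrite mulr1 => c0; rewrite c0 eqxx in cm.
case/andP=> vl ul [sb]; case: b => /= [inf|[x fx]] supp H; last first.
  apply: (IH bs (upd e v x)) => // [m /supp/supportedP h|e' Qe' he'].
    apply/supportedP=> j; rewrite inE => jn; apply: h.
    by rewrite inE in_cons negb_or jn andbT; apply/eqP=> -[].
  apply: H => // j; rewrite inE negb_or => /andP[jv jl].
  by rewrite he' // ffunE (negPf jv).
have key (m : {ffun J -> 'I_E.+1}) : m v == ord0 -> forall k, c (set_exp m v k) = 0.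
  (* [p] gathers the monomials that differ from [m] only in the exponent of [v]; every value in the
     infinite set is a root of it. *)
  move=> mv; pose p := \poly_(i < E.+1) c (set_exp m v (inord i)).
  suff p0 : p = 0.
    move=> k; have := coef0 K k; rewrite -p0 coef_poly ltn_ord.
    by rewrite inord_val.
  apply/eqP; apply: contraT => pn0; have [L _ HL] := roots_seq pn0.
  have [x xL fx] := inf L; case/negP: xL; apply: HL; apply/rootP.
  pose cx : {ffun {ffun J -> 'I_E.+1} -> K} :=
    [ffun m : {ffun J -> 'I_E.+1} => if m v == ord0 then \sum_k c (set_exp m v k) * x ^+ k else 0].
  have -> : p.[x] = cx m.
    rewrite ffunE mv horner_poly; apply: eq_bigr => k _; by rewrite inord_val.
  apply: (IH bs (upd e v x)) => // [m'|e' Qe' he'].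
    rewrite ffunE; case: ifP => [/eqP m'v|_]; last by rewrite eqxx.
    move=> sn0; have [k ck] : exists k, c (set_exp m' v k) != 0.
      apply/existsP; apply: contraT => /existsPn h; case/eqP: sn0.
      by apply: big1 => k _; move: (h k); rewrite negbK => /eqP->; rewrite mul0r.
    move/supp/supportedP: ck => h; apply/supportedP=> j; rewrite inE => jn.
    have [->//|/negPf jv] := eqVneq j v.
    have := h j; rewrite ffunE jv inE in_cons negb_or jn andbT; apply.
    by apply/eqP=> -[] /eqP; rewrite jv.
  have e'v : e' v = x by rewrite he' // ffunE eqxx.
  rewrite -[RHS](H e' Qe'); last first.
    move=> j; rewrite inE negb_or => /andP[jv jl].
    by rewrite he' // ffunE (negPf jv).
  by rewrite -[RHS](sum_mono_specialize _ v); apply: eq_bigr => m' _; rewrite ffunE e'v.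
move=> m; have := key (set_exp m v ord0); rewrite ffunE eqxx => /(_ isT (m v)) <-.
by congr (c _); apply/ffunP=> j; rewrite !ffunE; case: eqP => [->|].
Qed.

End Independence.

(** * Polynomial functions of bounded degree in each variable *)

Section Polyf.
Variables (V : finType) (Act : {set V}).
Implicit Types (y : {ffun V -> K}) (h : {ffun V -> K} -> K).

(** [E] bounds the exponent of each variable separately: such bounds add under products, and the
    monomials number [E.+1 ^ #|Act|]. *)
Definition polyf (E : nat) h :=
  exists2 c : {ffun {ffun V -> 'I_E.+1} -> K},
    (forall m, c m != 0 -> supported Act m) & forall y, h y = \sum_m c m * mono y m.

Lemma polyf_ext E h1 h2 : (forall y, h1 y = h2 y) -> polyf E h1 -> polyf E h2.
Proof. by move=> H [c c1 c2]; exists c => // y; rewrite -H. Qed.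

Lemma polyf_mono E (m : V -> nat) : (forall j, m j <= E)%N ->
  (forall j, j \notin Act -> m j = 0%N) -> polyf E (fun y => \prod_j y j ^+ m j).
Proof.
move=> mE m0; pose m1 : {ffun V -> 'I_E.+1} := [ffun j => inord (m j)].
have m1E j : m1 j = m j :> nat by rewrite ffunE inordK // ltnS.
exists [ffun m' => (m' == m1)%:R] => [m'|y].
  rewrite ffunE; case: (m' =P m1) => [-> _|]; last by rewrite eqxx.
  by apply/supportedP=> j jA; apply: val_inj; rewrite /= m1E m0.
rewrite (bigD1 m1) //= [X in _ + X]big1 ?addr0; last first.
  by move=> m' /negPf mm; rewrite ffunE mm mul0r.
by rewrite ffunE eqxx mul1r; apply: eq_bigr => j _; rewrite m1E.
Qed.

Lemma polyf_scale E a h : polyf E h -> polyf E (fun y => a * h y).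
Proof.
case=> c c1 c2; exists [ffun m => a * c m] => [m|y].
  by rewrite ffunE mulf_eq0 negb_or => /andP[_ /c1].
by rewrite c2 mulr_sumr; apply: eq_bigr => m _; rewrite ffunE mulrA.
Qed.

Lemma polyf0 E : polyf E (fun=> 0).
Proof.
exists [ffun=> 0] => [m|y]; first by rewrite ffunE eqxx.
by rewrite big1 // => m _; rewrite ffunE mul0r.
Qed.

Lemma polyf_add E h1 h2 : polyf E h1 -> polyf E h2 -> polyf E (fun y => h1 y + h2 y).
Proof.
move=> [c c1 c2] [d d1 d2]; exists [ffun m => c m + d m] => [m|y].
  rewrite ffunE; have [->|/c1//] := eqVneq (c m) 0.
  by rewrite add0r; apply: d1.
by rewrite c2 d2 -big_split; apply: eq_bigr => m _; rewrite ffunE mulrDl.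
Qed.

Lemma polyf_sum E (I : Type) (r : seq I) (P : pred I) (h : I -> {ffun V -> K} -> K) :
  (forall i, P i -> polyf E (h i)) -> polyf E (fun y => \sum_(i <- r | P i) h i y).
Proof.
move=> H; elim: r => [|i r IH].
  by apply: polyf_ext (polyf0 E) => y; rewrite big_nil.
case Pi : (P i); last by apply: polyf_ext IH => y; rewrite big_cons Pi.
by apply: polyf_ext (polyf_add (H i Pi) IH) => y; rewrite big_cons Pi.
Qed.

Lemma polyf_mul E1 E2 h1 h2 : polyf E1 h1 -> polyf E2 h2 ->
  polyf (E1 + E2) (fun y => h1 y * h2 y).
Proof.
move=> [c c1 c2] [d d1 d2].
apply: (@polyf_ext _ (fun y => \sum_m \sum_n
   (c m * d n) * \prod_j y j ^+ (m j + n j))).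
  move=> y; rewrite c2 d2 big_distrlr; apply: eq_bigr => m _; apply: eq_bigr => n _ /=.
  rewrite mulrACA; congr (_ * _); rewrite /mono -big_split.
  by apply: eq_bigr => j _; rewrite exprD.
apply: polyf_sum => m _; apply: polyf_sum => n _.
have [->|cd] := eqVneq (c m * d n) 0.
  by apply: polyf_ext (polyf0 _) => y; rewrite mul0r.
move: cd; rewrite mulf_eq0 negb_or => /andP[/c1/supportedP m1 /d1/supportedP n1].
apply: polyf_scale; apply: polyf_mono => j.
  by rewrite leq_add // -ltnS ltn_ord.
by move=> jA; rewrite m1 // n1.
Qed.

Lemma polyf_const E a : polyf E (fun=> a).
Proof.
apply: (@polyf_ext _ (fun y => a * \prod_j y j ^+ 0)).
  by move=> y; rewrite big1 ?mulr1.
exact/polyf_scale/(@polyf_mono E (fun=> 0%N)).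
Qed.

Lemma polyf_le E E' h : (E <= E')%N -> polyf E h -> polyf E' h.
Proof.
move=> le Eh; rewrite -(subnKC le).
by apply: polyf_ext (polyf_mul Eh (polyf_const _ 1)) => y; rewrite mulr1.
Qed.

Lemma polyf_var E j : (0 < E)%N -> j \in Act -> polyf E (fun y => y j).
Proof.
move=> E0 jA; apply: (@polyf_ext _ (fun y => \prod_i y i ^+ (i == j))).
  move=> y; rewrite (bigD1 j) //= eqxx expr1 big1 ?mulr1 // => i /negPf->.
  by rewrite expr0.
apply: polyf_mono => i; first by case: eqP.
by case: eqP => [->|//]; rewrite jA.
Qed.

Lemma polyf_prod (I : Type) (r : seq I) (P : pred I) (E : I -> nat)
    (h : I -> {ffun V -> K} -> K) :
  (forall i, P i -> polyf (E i) (h i)) ->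
  polyf (\sum_(i <- r | P i) E i) (fun y => \prod_(i <- r | P i) h i y).
Proof.
move=> H; elim: r => [|i r IH].
  by rewrite big_nil; apply: polyf_ext (polyf_const _ 1) => y; rewrite big_nil.
case Pi : (P i); last by rewrite big_cons Pi; apply: polyf_ext IH => y; rewrite big_cons Pi.
by rewrite big_cons Pi; apply: polyf_ext (polyf_mul (H i Pi) IH) => y; rewrite big_cons Pi.
Qed.

Lemma polyf_exp E n h : polyf E h -> polyf (n * E) (fun y => h y ^+ n).
Proof.
move=> H; elim: n => [|n IH]; first by apply: polyf_ext (polyf_const _ 1).
by rewrite mulSn; apply: polyf_ext (polyf_mul H IH) => y; rewrite exprS.
Qed.

Lemma polyf_det E n (M : {ffun V -> K} -> 'M[K]_n) :
  (forall i j, polyf E (fun y => M y i j)) -> polyf (n * E) (fun y => \det (M y)).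
Proof.
move=> H; apply: polyf_sum => s _; apply: polyf_scale.
rewrite -[n in (n * E)%N]card_ord -sum_nat_const.
by apply: polyf_prod => i _; apply: H.
Qed.

Lemma polyf_adj E n (M : {ffun V -> K} -> 'M[K]_n) i j :
  (forall i j, polyf E (fun y => M y i j)) -> polyf (n * E) (fun y => (\adj (M y)) i j).
Proof.
move=> H; apply: (@polyf_ext _ (fun y => (-1) ^+ (j + i) * \det (row' j (col' i (M y))))).
  by move=> y; rewrite mxE.
apply: polyf_scale; apply: (@polyf_le (n.-1 * E)); first by rewrite leq_mul2r leq_pred orbT.
by apply: polyf_det => i' j'; apply: polyf_ext (H (lift j i') (lift i j')) => y; rewrite !mxE.
Qed.

End Polyf.

(* Each piece [i] of [Y] is the image of at most [N] variables under a rational map, and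
   there are more monomials of bounded degree in [N + 1] coordinates than their
   pullbacks can span. *)
Lemma algebraic_relation (J V I : finType) (Act : I -> {set V}) (N d : nat) (T : {set J})
    (Dl : I -> {ffun V -> K} -> K) (G : I -> J -> {ffun V -> K} -> K)
    (Y : {ffun J -> K} -> Prop) :
  #|T| = N.+1 -> (forall i, #|Act i| <= N)%N ->
  (forall i, polyf (Act i) d (Dl i)) -> (forall i j, polyf (Act i) d (G i j)) ->
  (forall e, Y e -> exists i y, Dl i y != 0 /\ forall j, j \in T -> Dl i y * e j = G i j y) ->
  exists E (c : {ffun {ffun J -> 'I_E.+1} -> K}),
    [/\ exists m, c m != 0, forall m, c m != 0 -> supported T m
      & forall e, Y e -> \sum_m c m * mono e m = 0].
Proof.
(* Pullbacks have exponents up to [E' = (N + 1) * E * d] in at most [N] variables, so their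
   monomials over all pieces number at most [E * (E + 1) ^ N], fewer than the [(E + 1) ^ (N + 1)]
   monomials in [T]. *)
move=> cT cA pD pG HY; pose E := (#|I| * (N.+1 * d).+1 ^ N)%N.
pose E' := (\sum_(j in T) E * d)%N.
have pH (p : {ffun J -> 'I_E.+1} * I) : exists c : {ffun {ffun V -> 'I_E'.+1} -> K},
    (forall m, c m != 0 -> supported (Act p.2) m) /\ forall y,
    \prod_(j in T) (Dl p.2 y ^+ (E - p.1 j) * G p.2 j y ^+ p.1 j) = \sum_m c m * mono y m.
  case: p => m i /=.
  suff [c c1 c2] : polyf (Act i) E' (fun y =>
      \prod_(j in T) (Dl i y ^+ (E - m j) * G i j y ^+ m j)) by exists c.
  apply: polyf_prod => j _.
  apply: (@polyf_le _ _ ((E - m j) * d + m j * d)).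
    by rewrite -mulnDl subnK // -ltnS ltn_ord.
  by apply: polyf_mul; apply: polyf_exp.
have [M HM] := choice pH.
pose A := [set m : {ffun J -> 'I_E.+1} | supported T m].
pose B := [set p : I * {ffun V -> 'I_E'.+1} | supported (Act p.1) p.2].
have BA : (#|B| < #|A|)%N.
  rewrite card_supported cT.
  have E'E : (E'.+1 <= E.+1 * (N.+1 * d).+1)%N.
    by rewrite /E' sum_nat_const cT mulnCA; rewrite mulSn mulnS; lia.
  have cB : (#|B| <= #|I| * E'.+1 ^ N)%N.
    rewrite -sum1_card (eq_bigl (fun p => supported (Act p.1) p.2)); last first.
      by move=> p; rewrite inE.
    rewrite -(pair_big_dep xpredT (fun i m => supported (Act i) m) (fun _ _ => 1%N)) /=.
    rewrite -sum_nat_const; apply: leq_sum => i _.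
    have := card_supported E' (Act i); rewrite -sum1_card => eA.
    rewrite (eq_bigl (mem [set m : {ffun V -> 'I_E'.+1} | supported (Act i) m])).
      by rewrite eA leq_pexp2l.
    by move=> m; rewrite !inE.
  apply: leq_ltn_trans cB _; rewrite expnS.
  apply: (@leq_ltn_trans (E * E.+1 ^ N)); last by rewrite ltn_pmul2r ?expn_gt0.
  rewrite {1}/E -mulnA leq_mul2l; apply/orP; right.
  rewrite mulnC -expnMn; case: (N) E'E => [//|n] E'E.
  by rewrite leq_exp2r.
have [c [c1 c2 c3]] := linear_dependency (fun m p => M (m, p.1) p.2) BA.
exists E, c; split=> // [m cm|e Ye].
  by apply: contraR cm => sm; rewrite c2 // inE.
have [i [y [Dy Gy]]] := HY e Ye.
(* Multiplying by this nonzero power clears all denominators and turns each monomial in [e] into its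
   pullback; [c] was chosen to cancel these. *)
have : Dl i y ^+ (\sum_(j in T) E) * (\sum_m c m * mono e m) = 0.
  rewrite mulr_sumr (eq_bigr (fun m => \sum_n c m * (M (m, i) n * mono y n))).
    rewrite exchange_big /= big1 // => n _.
    have [sn|sn] := boolP (supported (Act i) n).
      rewrite (eq_bigr (fun m => mono y n * (c m * M (m, i) n))); last first.
        by move=> m _; rewrite mulrA mulrC.
      rewrite -mulr_sumr; have := c3 (i, n); rewrite inE /= => -> //.
      by rewrite mulr0.
    apply: big1 => m _; have [h1 _] := HM (m, i).
    suff -> : M (m, i) n = 0 by rewrite mul0r mulr0.
    by apply/eqP; apply: contraR sn => /h1.
  move=> m _; rewrite -mulr_sumr mulrCA; have [cm|cm] := eqVneq (c m) 0.
    by rewrite cm !mul0r.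
  have mT : supported T m by apply: contraR cm => sm; rewrite c2 // inE.
  congr (_ * _); have [_ <-] := HM (m, i).
  have -> : mono e m = \prod_(j in T) e j ^+ m j.
    rewrite /mono (bigID (mem T)) /= [X in _ * X]big1 ?mulr1 //.
    by move=> j jT; move/supportedP: mT => -> //; rewrite expr0.
  rewrite -prodrXr -big_split; apply: eq_bigr => j jT /=.
  rewrite -Gy // exprMn mulrA -exprD subnK //.
  by rewrite -ltnS ltn_ord.
move/eqP; rewrite mulf_eq0 expf_eq0 (negPf Dy) andbF => /eqP //.
Qed.

End PolynomialFunctions.

(** * Copies of a rooted graph in an algebraic graph *)

Section Interpolation.
Import GRing.Theory.
Local Open Scope ring_scope.

(** Lagrange interpolation: a product of at most [d - 1] affine factors separates each point from
    the others, so the evaluation matrix has full rank and contains an invertible minor. *)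
Lemma interpolation_minor (K : closedFieldType) (X : finType) d r (z : 'I_r -> {ffun X -> K}) :
  injective z -> (r <= d)%N ->
  exists2 g : {ffun 'I_r -> {ffun X -> 'I_d}}, injective g &
    \det (\matrix_(k, l) mono (z k) (g l)) != 0.
Proof.
case: r z => [|r] z injz; first move=> _.
  (* For [d = 0] there may be no monomial to serve as a default, so the empty function is built by
     elimination. *)
  exists [ffun k : 'I_0 => match k with Ordinal m lt => False_rect _ (Bool.diff_false_true lt) end].
    by case.
  by rewrite det_mx00 oner_eq0.
case: d => [//|d]; rewrite ltnS => rd.
pose Mon := {ffun X -> 'I_d.+1}.
pose M := \matrix_(i < #|{: Mon}|, k < r.+1) mono (z k) (enum_val i : Mon).
have fac (p : 'I_r.+1 * 'I_r.+1) : exists h : {ffun X -> K} -> K, polyf setT 1 h /\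
    (p.1 != p.2 -> h (z p.1) = 1 /\ h (z p.2) = 0).
  case: p => k l /=; have [<-|kl] := eqVneq k l; first by exists (fun=> 1); split=> //;
    apply: polyf_const.
  have [t zt|h] := pickP [pred t | z k t != z l t]; last first.
    case/eqP: kl; apply: injz; apply/ffunP=> t; apply/eqP.
    by move/negbFE: (h t).
  exists (fun y => (z k t - z l t)^-1 * (y t + - z l t)); split.
    apply/polyf_scale/polyf_add; last exact: polyf_const.
    by apply: polyf_var; rewrite ?inE.
  by rewrite subrr mulr0 mulVf // subr_eq0.
have [h Hh] := choice fac.
have HB k : exists c : {ffun Mon -> K},
    forall l, \sum_m c m * mono (z l) m = (k == l)%:R.
  have [] : polyf [set: X] d (fun y => \prod_(l | l != k) h (k, l) y).
    apply: (@polyf_le _ _ _ (\sum_(l : 'I_r.+1 | l != k) 1)).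
      by rewrite sum1_card cardC1 card_ord.
    by apply: polyf_prod => l _; have [] := Hh (k, l).
  move=> c _ Hc; exists c => l; rewrite -Hc; have [<-|kl] := eqVneq k l.
    rewrite big1 // => l' l'k; have [_] := Hh (k, l').
    by rewrite eq_sym l'k => /(_ isT)[].
  rewrite (bigD1 l) ?[l == k]eq_sym //=; have [_] := Hh (k, l).
  by move=> /(_ kl)[_ ->]; rewrite mul0r.
have [c Hc] := choice HB.
have fM : row_full M.
  apply/row_fullP; exists (\matrix_(k < r.+1, i < #|{: Mon}|) c k (enum_val i : Mon)).
  apply/matrixP=> k l; rewrite !mxE -Hc [RHS](reindex_onto enum_val enum_rank) /=; last first.
    by move=> m _; rewrite enum_rankK.
  by apply: eq_big => [i|i _]; rewrite ?enum_valK ?eqxx // !mxE.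
have [f injf uf] : exists2 f, injective f & rowsub f M \in unitmx.
  by exists (fullrankfun fM); [exact: fullrankfun_inj | exact: fullrowsub_unit].
exists [ffun l => enum_val (f l) : Mon].
  by move=> k l; rewrite !ffunE => /enum_val_inj/injf.
move: uf; rewrite unitmxE unitfE -det_tr.
by congr (\det _ != 0); apply/matrixP=> k l; rewrite !mxE ffunE.
Qed.

End Interpolation.

(** * Edges in a union of copies with common roots *)

Section UnionOfCopies.
Variables (V PI I : finType) (adj : rel V) (R : {set V}) (a b : nat).

Definition touching (S : {set V}) : {set V * V} :=
  [set p | adj p.1 p.2 && ((p.1 \in S) || (p.2 \in S))].

(** [touching] counts ordered pairs, whence the 2: every set of nonroots meets at least [a / b]
    edges per vertex. *)
Definition balanced :=
  forall S : {set V}, S \subset ~: R -> 2 * a * #|S| <= b * #|touching S|.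

Variable Q : I -> V -> PI.
Hypotheses (bal : balanced) (injQ : forall i, injective (Q i)).
Hypothesis agreeQ : forall i j r, r \in R -> Q i r = Q j r.

Definition new_vertices i : {set PI} := Q i @: (~: R).
Definition new_edges i : {set PI * PI} := (fun p => (Q i p.1, Q i p.2)) @: touching (~: R).

(** Add the copies one by one. The points that a copy contributes come from a set [S] of nonroots,
    and no edge touching [S] was present before, so balancedness of [S] pays for them. *)
Lemma union_of_copies :
  2 * a * #|\bigcup_i new_vertices i| <= b * #|\bigcup_i new_edges i|.
Proof.
elim: (index_enum I) => [|i s IH]; first by rewrite !big_nil cards0 muln0.
rewrite !big_cons; set W := \bigcup_(j <- s) _ in IH *; set Z := \bigcup_(j <- s) _ in IH *.
pose S := [set v in ~: R | Q i v \notin W].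
have SR : S \subset ~: R by apply/subsetP=> v; rewrite inE => /andP[].
have cW : #|new_vertices i :|: W| = #|S| + #|W|.
  have -> : new_vertices i :|: W = (Q i @: S) :|: W.
    apply/setP=> x; rewrite !inE; have [//|xW] := boolP (x \in W); rewrite ?orbT // !orbF.
    apply/imsetP/imsetP=> -[v vR xv]; exists v => //.
      by rewrite inE vR -xv.
    by move: vR; rewrite inE => /andP[].
  rewrite cardsU (_ : _ :&: _ = set0) ?cards0 ?subn0 ?card_imset //.
  apply/setP=> x; rewrite !inE; apply/negP=> /andP[/imsetP[v]].
  by rewrite inE => /andP[_ vW] -> ; rewrite (negPf vW).
have memZ p : p \in Z -> forall v, v \in S -> (p.1 != Q i v) && (p.2 != Q i v).
  rewrite /Z => pZ v vS.
  have [j js] : exists j, j \in s /\ p \in new_edges j.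
    elim: (s) pZ => [|j s' IH']; first by rewrite big_nil inE.
    rewrite big_cons inE => /orP[pj|/IH'[k [ks pk]]].
      by exists j; rewrite inE eqxx.
    by exists k; rewrite inE ks orbT.
  case: js => js /imsetP[[v1 v2] _ -> /=].
  have nW w : Q j w != Q i v.
    apply/eqP=> E; have [wR|wR] := boolP (w \in R).
      move: E; rewrite (agreeQ j i wR) => /injQ wv.
      by move: vS; rewrite -wv !inE wR.
    move: vS; rewrite inE => /andP[_ /negP]; apply; rewrite -E /W.
    elim: (s) js => [//|k s' IH']; rewrite inE big_cons inE => /predU1P[->|/IH' ->].
      by rewrite imset_f // inE.
    by rewrite orbT.
  by rewrite !nW.
have cZ : #|touching S| + #|Z| <= #|new_edges i :|: Z|.
  pose f (p : V * V) := (Q i p.1, Q i p.2).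
  have injf : injective f by move=> [x1 x2] [y1 y2] [/injQ -> /injQ ->].
  rewrite -(card_imset (mem (touching S)) injf).
  have -> : #|f @: touching S| + #|Z| = #|(f @: touching S) :|: Z|.
    rewrite cardsU (_ : _ :&: _ = set0) ?cards0 ?subn0 //.
    apply/setP=> x; rewrite !inE; apply/negP=> /andP[/imsetP[[v1 v2]]].
    rewrite inE /= => /andP[_ /orP[] vS] -> /memZ /(_ _ vS) /=; rewrite eqxx ?andbF //.
  apply/subset_leq_card/setSU/imsetS/subsetP=> p; rewrite !inE => /andP[-> /=].
  by case/orP=> /andP[-> _]; rewrite ?orbT.
rewrite cW mulnDr; apply: leq_trans (leq_add (bal SR) IH) _.
by rewrite -mulnDr leq_mul2l cZ orbT.
Qed.

End UnionOfCopies.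

Lemma definable_block (K : closedFieldType) (J : finType) (Q : {ffun J -> K} -> Prop) (l : seq J) :
  definable Q -> definable (fun e => exists2 e' : {ffun J -> K}, forall j, j \notin l -> e' j = e j
    & Q e').
Proof.
move=> dQ; elim: l => [|v l IH].
  apply: definable_iff dQ => e; split=> [Qe|[e' h]]; first by exists e.
  by have -> : e' = e by apply/ffunP=> j; apply: h.
apply: definable_iff (definable_upd v IH) => e; split.
  move=> [x [e' h Qe]]; exists e' => // j; rewrite inE negb_or => /andP[jv jl].
  by rewrite h // ffunE (negPf jv).
move=> [e' h Qe]; exists (e' v), e' => // j jl; rewrite ffunE; case: eqP => [->//|/eqP jv].
by apply: h; rewrite inE negb_or jv.
Qed.

(** * Copies as points of a definable set *)

Section AlgebraicCopies.
Import GRing.Theory.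
Local Open Scope ring_scope.
Variables (K : closedFieldType) (V : finType) (adj : rel V) (R : {set V}).
Variables (a b d s : nat).

Notation pt := {ffun 'I_a -> K}.
Notation Mon := {ffun bool * 'I_a -> 'I_d}.
Notation CI := ('I_b * Mon)%type.

Definition pt_pair (x y : pt) : {ffun bool * 'I_a -> K} :=
  [ffun t => if t.1 then x t.2 else y t.2].

Definition alg_eval (c : {ffun CI -> K}) i (x y : pt) : K :=
  \sum_m c (i, m) * mono (pt_pair x y) m.

Definition alg_edge c (x y : pt) : bool := [forall i, alg_eval c i x y == 0].

(** The equations are not symmetric in their two points, so an edge may be realised in either
    orientation. *)
Definition alg_copy c (P : {ffun V -> pt}) : bool :=
  injectiveb P && [forall v, forall w,
    adj v w ==> alg_edge c (P v) (P w) || alg_edge c (P w) (P v)].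

Definition rooted_at (u P : {ffun V -> pt}) : bool := [forall v in R, P v == u v].

Definition copy_coord c u v i (x : K) : Prop :=
  exists P, [/\ alg_copy c P, rooted_at u P & P v i = x].

(** The variables are the coefficients, [s] sampled values of one coordinate, and the points of the
    roots (flag [true]) and of a copy (flag [false]). *)
Notation J := ((CI + 'I_s) + (bool * V * 'I_a))%type.
Implicit Types e : {ffun J -> K}.

Definition env_coef e : {ffun CI -> K} := [ffun k => e (inl (inl k))].
Definition env_val e (j : 'I_s) : K := e (inl (inr j)).
Definition env_pts (be : bool) e : {ffun V -> pt} := [ffun v => [ffun i => e (inr (be, v, i))]].
Definition mk_env (c : {ffun CI -> K}) (al : 'I_s -> K) (u P : {ffun V -> pt}) : {ffun J -> K} :=
  [ffun j => match j with
    | inl (inl k) => c k | inl (inr j) => al j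
    | inr (true, v, i) => u v i | inr (false, v, i) => P v i end].

Lemma definable_alg_edge v w :
  definable (fun e => alg_edge (env_coef e) (env_pts false e v) (env_pts false e w)).
Proof.
apply: (@definable_iff _ _ (fun e => forall i,
   alg_eval (env_coef e) i (env_pts false e v) (env_pts false e w) = 0)).
  by move=> e; split=> [h|/forallP h i]; [apply/forallP=> i; apply/eqP; apply: h|apply/eqP].
apply: definable_all => i; apply: definable_eq (term_const _ _).
apply: term_sum => m; apply: term_mul.
  have [t Ht] := term_var K (inl (inl (i, m)) : J).
  by exists t => z; rewrite Ht !ffunE.
apply: term_prod => -[be k]; apply: term_exp.
have [t Ht] := term_var K (inr (false, if be then v else w, k) : J).
by exists t => z; rewrite Ht !ffunE /=; case: be {Ht}; rewrite ?ffunE.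
Qed.

Lemma definable_alg_copy : definable (fun e =>
  alg_copy (env_coef e) (env_pts false e) /\ rooted_at (env_pts true e) (env_pts false e)).
Proof.
apply: definable_and.
  apply: (@definable_iff _ _ (fun e =>
    (forall p : V * V, p.1 != p.2 -> exists i, ~ (e (inr (false, p.1, i)) = e (inr (false, p.2,
      i)))) /\
    (forall p : V * V, adj p.1 p.2 ->
       alg_edge (env_coef e) (env_pts false e p.1) (env_pts false e p.2) \/
       alg_edge (env_coef e) (env_pts false e p.2) (env_pts false e p.1)))).
    move=> e; split.
      move=> [h1 h2]; apply/andP; split.
        apply/injectiveP => v w vw; apply/eqP; apply: contraT => vwn.
        have [i []] := h1 (v, w) vwn; move/ffunP/(_ i): vw; by rewrite !ffunE.
      apply/forallP=> v; apply/forallP=> w; apply/implyP=> vw; apply/orP.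
      exact: (h2 (v, w) vw).
    move=> /andP[/injectiveP h1 /forallP h2]; split=> -[v w] /= vw.
      apply: contrapT => h; case/negP: vw; apply/eqP/h1/ffunP=> i.
      by rewrite !ffunE; apply: contrapT => hi; apply: h; exists i.
    by apply/orP; move/forallP/(_ w)/implyP: (h2 v); apply.
  apply: definable_and; apply: definable_all => -[v w] /=; apply: definable_imply.
    by apply: definable_ex => i; apply/definable_not/definable_eq; apply: term_var.
  by apply: definable_or; apply: definable_alg_edge.
apply: (@definable_iff _ _ (fun e => forall v, v \in R -> forall i,
   e (inr (false, v, i)) = e (inr (true, v, i)))).
  move=> e; split=> [h|/forall_inP h v vR i].
    by apply/forall_inP=> v vR; apply/eqP/ffunP=> i; rewrite !ffunE h.
  by move/eqP/ffunP/(_ i): (h v vR); rewrite !ffunE.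
apply: definable_all => v; apply: definable_imply; apply: definable_all => i.
by apply: definable_eq; apply: term_var.
Qed.

Definition pvars : seq J := [seq inr (false, p.1, p.2) | p : V * 'I_a].

Lemma definable_copy_coord v i j :
  definable (fun e => copy_coord (env_coef e) (env_pts true e) v i (env_val e j)).
Proof.
have D2 : definable (fun e => e (inr (false, v, i)) = e (inl (inr j))).
  by apply: definable_eq; apply: term_var.
apply: definable_iff (definable_block pvars (definable_and definable_alg_copy D2)) => e.
have nl k : (inl k : J) \notin pvars by apply/mapP=> -[].
have nt p k : (inr (true, p, k) : J) \notin pvars by apply/mapP=> -[].
split=> [[e' h [[h1 h2] h3]]|[P [h1 h2 h3]]].
  have ec : env_coef e' = env_coef e by apply/ffunP=> k; rewrite !ffunE h.
  have eu : env_pts true e' = env_pts true e.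
    by apply/ffunP=> w; apply/ffunP=> k; rewrite !ffunE h.
  exists (env_pts false e'); rewrite -ec -eu; split=> //.
  by rewrite !ffunE h3 h.
pose e' := mk_env (env_coef e) (env_val e) (env_pts true e) P.
have ec : env_coef e' = env_coef e by apply/ffunP=> k; rewrite !ffunE.
have eu : env_pts true e' = env_pts true e.
  by apply/ffunP=> w; apply/ffunP=> k; rewrite !ffunE.
have eP : env_pts false e' = P.
  by apply/ffunP=> w; apply/ffunP=> k; rewrite !ffunE.
exists e'; last by rewrite ec eu eP !ffunE.
move=> [[k|k]|[[[] w] k]] jl; rewrite !ffunE //.
by case/negP: jl; apply/mapP; exists (w, k); rewrite ?mem_enum.
Qed.

(** Genericity is applied to a sample variable, one of which exists because [s > 0]. Coefficients
    and roots are parameters, so [D] is uniform in them. *)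
Lemma copy_coord_dichotomy : (0 < s)%N -> exists D, forall c u v i,
  exists2 L : seq K, (size L <= D)%N &
    (forall x, x \notin L -> copy_coord c u v i x) \/
    (forall x, x \notin L -> ~ copy_coord c u v i x).
Proof.
move=> s0; pose j0 := Ordinal s0.
have H (p : V * 'I_a) : exists D, forall c u, exists2 L : seq K, (size L <= D)%N &
    (forall x, x \notin L -> copy_coord c u p.1 p.2 x) \/
    (forall x, x \notin L -> ~ copy_coord c u p.1 p.2 x).
  have [Q [D [_ HD]]] := definable_generic (inl (inr j0)) (definable_copy_coord p.1 p.2 j0).
  exists D => c u; pose e := mk_env c (fun=> 0) u u.
  have [L sL HL] := HD e; exists L => //.
  have E x : x \notin L -> copy_coord c u p.1 p.2 x <-> Q e.
    move/HL; have -> : env_coef (upd e (inl (inr j0)) x) = c.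
      by apply/ffunP=> k; rewrite !ffunE.
    have -> : env_pts true (upd e (inl (inr j0)) x) = u.
      by apply/ffunP=> w; apply/ffunP=> k; rewrite !ffunE.
    by rewrite /env_val ffunE eqxx.
  by have [q|q] := EM (Q e); [left|right] => x xL; rewrite E.
have [D HD] := choice H; exists (\sum_p D p)%N => c u v i.
have [L sL HL] := HD (v, i) c u; exists L => //.
by apply: leq_trans sL _; rewrite (bigD1 (v, i)) //= leq_addr.
Qed.

End AlgebraicCopies.

(** * Rational parametrisation of several copies by Cramer's rule *)

Section Parametrisation.
Import GRing.Theory.
Local Open Scope ring_scope.
Variables (K : closedFieldType) (V : finType) (adj : rel V) (R : {set V}).
Variables (a b d s : nat).

Notation pt := {ffun 'I_a -> K}.
Notation Mon := {ffun bool * 'I_a -> 'I_d}.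
Notation CI := ('I_b * Mon)%type.
Notation J := ((CI + 'I_s) + (bool * V * 'I_a))%type.
Notation SV := ('I_s * V)%type.
Notation PI := (SV + V)%type.
Notation Var := (SV * 'I_a + CI)%type.
Variables (u : {ffun V -> pt}) (v0 : V) (i0 : 'I_a).

(* [s] copies with common roots [u] are described by their distinct nonroot points and
   by the coefficients outside a nonsingular minor; Cramer's rule gives the others.
   Here [rep] chooses a representative of each point, [zs] lists the pairs of points at
   which the equations hold and [gs] the columns of the minor. *)
Section Piece.
Variables (rep : {ffun SV -> SV}) (r : nat).
Variables (zs : {ffun 'I_r -> PI * PI}) (gs : {ffun 'I_r -> Mon}).
Implicit Types y : {ffun Var -> K}.

Definition rep_points : {set SV} := rep @: [set w | w.2 \notin R].
Definition free_vars : {set Var} :=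
  [set x | match x with inl (w, i) => w \in rep_points | inr (i, m) => m \notin codom gs end].

Definition pt_of y (p : PI) : pt :=
  [ffun i => match p with
     inl w => if w \in rep_points then y (inl (w, i)) else 0 | inr v => u v i end].
Definition node y k := pt_pair (pt_of y (zs k).1) (pt_of y (zs k).2).
Definition minor_mx y : 'M[K]_r := \matrix_(k, l) mono (node y k) (gs l).
Definition free_coef y (x : CI) : K := if x.2 \in codom gs then 0 else y (inr x).
Definition cramer_rhs i y : 'cV[K]_r :=
  \col_k - \sum_m free_coef y (i, m) * mono (node y k) m.
Definition denom y : K := \det (minor_mx y).
Definition numer (j : J) y : K :=
  match j with
  | inl (inl (i, m)) =>
      if [pick l | gs l == m] is Some l then (\adj (minor_mx y) *m cramer_rhs i y) l 0
      else denom y * y (inr (i, m))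
  | inl (inr j) =>
      if rep (j, v0) \in rep_points then denom y * y (inl (rep (j, v0), i0)) else 0
  | inr _ => 0
  end.

Definition mono_deg := (#|{: bool * 'I_a}| * d)%N.

Lemma polyf_node k (m : Mon) : polyf free_vars mono_deg (fun y => mono (node y k) m).
Proof.
apply: (@polyf_le _ _ _ (\sum_(t : bool * 'I_a) m t * 1)).
  rewrite /mono_deg -sum_nat_const; apply: leq_sum => t _.
  by rewrite muln1 ltnW // ltn_ord.
apply: polyf_prod => -[be i] _; apply: polyf_exp.
have H p : polyf free_vars 1 (fun y => pt_of y p i).
  case: p => [w|v]; last by apply: polyf_ext (polyf_const _ _ (u v i)) => y; rewrite ffunE.
  have [wW|wW] := boolP (w \in rep_points).
    apply: (@polyf_ext _ _ _ _ (fun y => y (inl (w, i)))).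
      by move=> y; rewrite ffunE wW.
    by apply: polyf_var => //; rewrite inE.
  by apply: polyf_ext (@polyf0 _ _ _ _) => y; rewrite ffunE (negPf wW).
by apply: polyf_ext (H (if be then (zs k).1 else (zs k).2)) => y; rewrite [RHS]ffunE; case: be.
Qed.

Lemma polyf_denom : polyf free_vars (r * mono_deg) denom.
Proof.
by apply: polyf_det => k l; apply: polyf_ext (polyf_node k (gs l)) => y; rewrite mxE.
Qed.

Lemma polyf_free x : x.2 \notin codom gs -> polyf free_vars 1 (fun y => y (inr x)).
Proof. by case: x => i m mg; apply: polyf_var => //; rewrite inE. Qed.

Lemma polyf_numer j : polyf free_vars (r * mono_deg + (1 + mono_deg)) (numer j).
Proof.
rewrite /numer; case: j => [[[i m]|j]|p]; last exact: polyf0.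
  case: pickP => [l _|ng].
    apply: (@polyf_ext _ _ _ _
      (fun y => \sum_k \adj (minor_mx y) l k * cramer_rhs i y k 0)).
      by move=> y; rewrite mxE.
    apply: polyf_sum => k _; apply: polyf_mul.
      by apply: polyf_adj => k' l'; apply: polyf_ext (polyf_node k' (gs l')) => y; rewrite mxE.
    apply: (@polyf_ext _ _ _ _ (fun y =>
        -1 * \sum_m free_coef y (i, m) * mono (node y k) m)).
      by move=> y; rewrite mxE mulN1r.
    apply/polyf_scale/polyf_sum => m' _; apply: polyf_mul; last exact: polyf_node.
    have [mg|mg] := boolP (m' \in codom gs).
      by apply: polyf_ext (@polyf0 _ _ _ _) => y; rewrite /free_coef mg.
    by apply: polyf_ext (@polyf_free (i, m') mg) => y; rewrite /free_coef (negPf mg).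
  apply: polyf_mul polyf_denom _; apply: (@polyf_le _ _ _ 1); first by rewrite leq_addr.
  apply: polyf_free; apply/negP=> /codomP[l E].
  by move: (ng l); rewrite -E eqxx.
have [rW|_] := boolP (rep (j, v0) \in rep_points); last exact: polyf0.
apply: polyf_mul polyf_denom _; apply: (@polyf_le _ _ _ 1); first by rewrite leq_addr.
by apply: polyf_var => //; rewrite inE.
Qed.

Lemma card_free_vars : injective gs ->
  (#|free_vars| + b * r <= a * #|rep_points| + b * #|{: Mon}|)%N.
Proof.
move=> injg; pose C := [set m in codom gs].
have cC : #|C| = r by rewrite cardsE card_codom // card_ord.
have sub : free_vars \subset (inl @: setX rep_points [set: 'I_a]) :|:
   (inr @: setX [set: 'I_b] (~: C)).
  apply/subsetP=> -[[w i]|[i m]]; rewrite !inE => h; apply/orP; [left|right].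
    by rewrite imset_f // !inE h.
  by rewrite imset_f // !inE h.
have h1 := leq_trans (subset_leq_card sub) (leq_card_setU _ _).
have i1 : injective (@inl (SV * 'I_a)%type CI) by move=> x y [].
have i2 : injective (@inr (SV * 'I_a)%type CI) by move=> x y [].
move: h1; rewrite (card_imset _ i1) (card_imset _ i2) !cardsX !cardsT !card_ord => h1.
have := cardsC C; rewrite cC => <-.
rewrite mulnDr addnCA addnC leq_add2l mulnC; exact: h1.
Qed.

End Piece.

Hypotheses (adj_sym : symmetric adj) (bal : balanced adj R a b) (v0R : v0 \notin R).
Notation r0 := (s * #|{: V * V}|)%N.
Hypothesis r0d : (r0 <= d)%N.

(** Each distinct nonroot point costs [a] parameters, and each of the [r] pairs in [Z] saves [b]
    coefficients. Balancedness gives [a * #|W| <= b * r], so no more parameters remain than there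
    are coefficients. *)
Lemma parametrise_copies (c : {ffun CI -> K}) (al : 'I_s -> K) :
  (forall j, copy_coord adj R c u v0 i0 (al j)) ->
  exists (rep : {ffun SV -> SV}) (r : 'I_r0.+1) (zs : {ffun 'I_r -> PI * PI})
    (gs : {ffun 'I_r -> Mon}) (y : {ffun Var -> K}),
  [/\ (#|free_vars rep gs| <= #|{: CI}|)%N, denom rep zs gs y != 0,
    forall k, denom rep zs gs y * c k = numer rep zs gs (inl (inl k)) y
    & forall j, denom rep zs gs y * al j = numer rep zs gs (inl (inr j)) y].
Proof.
move=> /choice[P HP].
pose Pt (w : SV) : pt := P w.1 w.2.
have Pinj j : injective (P j) by have [/andP[/injectiveP]] := HP j.
have Pu j v : v \in R -> P j v = u v.
  by have [_ /forall_inP h _] := HP j; move=> /h /eqP.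
pose rep : {ffun SV -> SV} := [ffun w => odflt w [pick w' | (w'.2 \notin R) && (Pt w' == Pt w)]].
have repP w : w.2 \notin R -> (rep w).2 \notin R /\ Pt (rep w) = Pt w.
  move=> wR; rewrite ffunE; case: pickP => [w' /andP[w'R /eqP //]|/(_ w)].
  by rewrite wR eqxx.
have repE w w' : w.2 \notin R -> Pt w = Pt w' -> rep w = rep w'.
  move=> wR E; rewrite !ffunE -E; case: pickP => // /(_ w).
  by rewrite wR eqxx.
pose W := rep_points rep.
pose ix j v : PI := if v \in R then inr v else inl (rep (j, v)).
pose vl (p : PI) : pt := match p with inl w => Pt w | inr v => u v end.
have vlix j v : vl (ix j v) = P j v.
  rewrite /ix; case: ifP => [vR|/negbT vR] /=; first by rewrite Pu.
  by have [_ ->] := repP (j, v) vR.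
have ixinj j : injective (ix j).
  by move=> v w E; apply: (Pinj j); rewrite -!vlix E.
have good p : (exists j v, p = ix j v) ->
    match p with inl w => w \in W | inr v => v \in R end.
  move=> [j [v ->]]; rewrite /ix; case: ifP => // /negbT vR.
  by rewrite imset_f // inE.
(* Different indices name different points; this makes the interpolation nodes distinct. *)
have vlinj j v j' v' : vl (ix j v) = vl (ix j' v') -> ix j v = ix j' v'.
  rewrite !vlix /ix; case: ifP => [vR|/negbT vR]; case: ifP => [v'R|/negbT v'R].
  - by rewrite Pu // -(Pu j') // => /Pinj->.
  - by rewrite Pu // -(Pu j') // => /Pinj vv; rewrite -vv vR in v'R.
  - by rewrite (Pu j') // -(Pu j) // => /Pinj vv; rewrite vv v'R in vR.
  - by move=> E; congr inl; apply: repE.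
pose Zs := \bigcup_j new_edges adj R ix j.
have ZsP p : p \in Zs -> exists j v w, [/\ adj v w, p = (ix j v, ix j w)
    & (p.2, p.1) \in Zs].
  case/bigcupP=> j _ /imsetP[[v w]]; rewrite inE /= => /andP[vw t] ->.
  exists j, v, w; split=> //; apply/bigcupP; exists j => //.
  by apply/imsetP; exists (w, v) => //; rewrite inE /= adj_sym vw orbC.
(* One orientation of each edge satisfies the equations, so at least half of [Zs] survives; the loss
   cancels the 2 in [balanced]. *)
pose Z := [set p in Zs | alg_edge c (vl p.1) (vl p.2)].
have ZsZ : (#|Zs| <= 2 * #|Z|)%N.
  have inj : injective (fun p : PI * PI => (p.2, p.1)) by move=> [? ?] [? ?] [-> ->].
  have sub : Zs \subset Z :|: (fun p => (p.2, p.1)) @: Z.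
    apply/subsetP=> p pZ; have [j [v [w [vw E pZ']]]] := ZsP p pZ.
    have [/andP[_ /forallP h] _ _] := HP j.
    move/forallP/(_ w)/implyP/(_ vw): (h v); rewrite -!vlix inE => /orP[e|e].
      by rewrite inE pZ E e.
    apply/orP; right; apply/imsetP; exists (p.2, p.1); last by case: (p).
    by rewrite inE pZ' E.
  apply: leq_trans (subset_leq_card sub) _; apply: leq_trans (leq_card_setU _ _) _.
  by rewrite card_imset // mul2n addnn.
have cW : (#|W| <= #|\bigcup_j new_vertices R ix j|)%N.
  have inj : injective (@inl SV V) by move=> x y [].
  rewrite -(card_imset _ inj); apply: subset_leq_card; apply/subsetP=> x /imsetP[w].
  move=> /imsetP[[j v]]; rewrite inE /= => vR -> ->; apply/bigcupP; exists j => //.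
  by apply/imsetP; exists v; rewrite ?inE // /ix (negPf vR).
have aWbZ : (a * #|W| <= b * #|Z|)%N.
  have agr i j v : v \in R -> ix i v = ix j v by rewrite /ix => ->.
  have H := union_of_copies bal ixinj agr; rewrite -/Zs in H.
  have : (2 * a * #|W| <= b * (2 * #|Z|))%N.
    apply: leq_trans (leq_trans _ H) _; first by rewrite leq_mul2l cW orbT.
    by rewrite leq_mul2l ZsZ orbT.
  by nia.
have Zr0 : (#|Z| < r0.+1)%N.
  rewrite ltnS; apply: (@leq_trans #|Zs|).
    by apply/subset_leq_card/subsetP=> p; rewrite inE => /andP[].
  apply: (@leq_trans (\sum_(j < s) #|{: V * V}|)); last first.
    by rewrite sum_nat_const card_ord.
  rewrite /Zs; elim: (index_enum _) => [|j t IH]; first by rewrite !big_nil cards0.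
  rewrite !big_cons; apply: leq_trans (leq_card_setU _ _) _; apply: leq_add => //.
  by apply: leq_trans (leq_imset_card _ _) _; apply: max_card.
pose r := Ordinal Zr0.
pose zs : {ffun 'I_r -> PI * PI} := [ffun k => enum_val (k : 'I_#|Z|)].
pose y : {ffun Var -> K} := [ffun x => match x with inl (w, i) => Pt w i | inr k => c k end].
have ptE p : (exists j v, p = ix j v) -> pt_of rep y p = vl p.
  move=> /good gp; apply/ffunP=> i; rewrite !ffunE; case: p gp => [w|v] //= gp.
  by rewrite gp ffunE.
have zsZ k : zs k \in Z by rewrite ffunE; apply: enum_valP.
have nodeE k : node rep zs y k = pt_pair (vl (zs k).1) (vl (zs k).2).
  have := zsZ k; rewrite inE => /andP[/ZsP[j [v [w [_ E _]]]] _].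
  by rewrite /node !ptE // E; [exists j, w|exists j, v].
have nodeinj : injective (node rep zs y).
  move=> k l; rewrite !nodeE => E.
  have := zsZ k; rewrite inE => /andP[/ZsP[j [v [w [_ Ek _]]]] _].
  have := zsZ l; rewrite inE => /andP[/ZsP[j' [v' [w' [_ El _]]]] _].
  have e1 : vl (zs k).1 = vl (zs l).1.
    by apply/ffunP=> i; move/ffunP/(_ (true, i)): E; rewrite !ffunE.
  have e2 : vl (zs k).2 = vl (zs l).2.
    by apply/ffunP=> i; move/ffunP/(_ (false, i)): E; rewrite !ffunE.
  have : zs k = zs l.
    by move: e1 e2; rewrite Ek El /= => /vlinj -> /vlinj ->.
  by rewrite !ffunE => /enum_val_inj.
have rd : (r <= d)%N by apply: leq_trans r0d; rewrite -ltnS.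
have [gs injg dg] := interpolation_minor nodeinj rd.
exists rep, r, zs, gs, y.
have cfv : (#|free_vars rep gs| <= #|{: CI}|)%N.
  have -> : #|{: CI}| = (b * #|{: Mon}|)%N by rewrite card_prod card_ord.
  rewrite -(leq_add2r (b * r)); apply: leq_trans (card_free_vars rep injg) _.
  by rewrite addnC leq_add2l.
have cram i : minor_mx rep zs gs y *m (\col_l c (i, gs l)) = cramer_rhs rep zs gs i y.
  apply/colP=> k; rewrite !mxE.
  have := zsZ k; rewrite inE => /andP[_ /forallP/(_ i)/eqP].
  rewrite /alg_eval -nodeE (bigID (fun m => m \in codom gs)) /= => E.
  rewrite (bigID (fun m => m \in codom gs)) /= [X in - (X + _)]big1 ?add0r; last first.
    by move=> m mg; rewrite /free_coef mg mul0r.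
  rewrite (eq_bigr (fun m => c (i, m) * mono (node rep zs y k) m)); last first.
    by move=> m /negPf mg; rewrite /free_coef /= mg ffunE.
  apply/eqP; rewrite -addr_eq0 -[X in _ == X]E; apply/eqP; congr (_ + _).
  rewrite (eq_bigr (fun l => c (i, gs l) * mono (node rep zs y k) (gs l))); last first.
    by move=> l _; rewrite !mxE mulrC.
  rewrite -(big_map gs xpredT (fun m => c (i, m) * mono (node rep zs y k) m)) /=.
  rewrite big_uniq /=; last by rewrite map_inj_uniq // index_enum_uniq.
  apply: eq_bigl => m; apply/mapP/codomP=> -[l]; first by exists l.
  by exists l; rewrite ?mem_index_enum.
split=> //.
- move=> [i m] /=; case: pickP => [l /eqP E|ng].
    rewrite -cram mulmxA mul_adj_mx mul_scalar_mx !mxE E //.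
  by congr (_ * _); rewrite ffunE.
move=> j /=; rewrite imset_f ?inE //; congr (_ * _); rewrite ffunE.
by have [_ ->] := repP (j, v0) v0R; have [_ _ <-] := HP j.
Qed.

End Parametrisation.

Lemma card_flag_true (J : finType) (l : seq J) bs : uniq l -> size bs = size l ->
  #|[set j | (j, true) \in zip l bs]| = count id bs.
Proof.
elim: l bs => [|v l IH] [|b bs] //=.
  by move=> _ _; apply/eqP; rewrite cards_eq0; apply/eqP/setP=> j; rewrite !inE.
move=> /andP[vl ul] [sb]; rewrite -(IH bs ul sb).
have vT : v \notin [set j | (j, true) \in zip l bs].
  rewrite inE; apply: contra vl => /(map_f fst).
  by rewrite -/(unzip1 _) unzip1_zip // sb.
case: b => /=; last by apply: eq_card => j; rewrite !inE xpair_eqE andbF.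
have -> : [set j | (j, true) \in (v, true) :: zip l bs] = v |: [set j | (j, true) \in zip l bs].
  by apply/setP=> j; rewrite !inE xpair_eqE andbT.
by rewrite cardsU1 vT.
Qed.

(** * Counting coefficients together with sampled coordinates *)

Section CountCopyCoords.
Import GRing.Theory.
Local Open Scope ring_scope.
Variables (K : closedFieldType) (V : finType) (adj : rel V) (R : {set V}).
Variables (a b d s : nat).

Notation pt := {ffun 'I_a -> K}.
Notation Mon := {ffun bool * 'I_a -> 'I_d}.
Notation CI := ('I_b * Mon)%type.
Notation J := ((CI + 'I_s) + (bool * V * 'I_a))%type.
Notation SV := ('I_s * V)%type.
Notation PI := (SV + V)%type.
Notation Var := (SV * 'I_a + CI)%type.
Notation r0 := (s * #|{: V * V}|)%N.
Hypotheses (adj_sym : symmetric adj) (bal : balanced adj R a b) (r0d : (r0 <= d)%N).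

(** The choices of representatives, pairs and columns form a finite type, so the parametrisations
    split into finitely many pieces, as [algebraic_relation] demands. *)
Lemma copy_coords_relation (u : {ffun V -> pt}) (v0 : V) (i0 : 'I_a) (T : {set J}) :
  v0 \notin R -> (forall j, j \in T -> exists k, j = inl k) -> #|T| = #|{: CI}|.+1 ->
  exists E (c : {ffun {ffun J -> 'I_E.+1} -> K}),
    [/\ exists m, c m != 0, forall m, c m != 0 -> supported T m
      & forall e, (forall j, copy_coord adj R (env_coef e) u v0 i0 (env_val e j)) ->
          \sum_m c m * mono e m = 0].
Proof.
move=> v0R Tl cT.
pose I : finType := ({ffun SV -> SV} *
  {r : 'I_r0.+1 & {ffun 'I_r -> PI * PI} * {ffun 'I_r -> Mon}})%type.
pose fv (i : I) := free_vars R b i.1 (tagged i.2).2.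
pose ok (i : I) := (#|fv i| <= #|{: CI}|)%N.
(* A piece with too many free variables gets denominator 0 and so describes no point. *)
pose Dl (i : I) (y : {ffun Var -> K}) := if ok i then denom R u i.1 (tagged i.2).1 (tagged i.2).2 y
  else 0.
pose G (i : I) (j : J) (y : {ffun Var -> K}) :=
  if ok i then numer R u v0 i0 i.1 (tagged i.2).1 (tagged i.2).2 j y else 0.
pose Act i := if ok i then fv i else set0.
pose dd := (r0 * mono_deg a d + (1 + mono_deg a d))%N.
pose Y (e : {ffun J -> K}) :=
  forall j, copy_coord adj R (env_coef e) u v0 i0 (env_val e j).
refine (@algebraic_relation K J Var I Act #|{: CI}| dd T Dl G Y _ _ _ _ _) => //.
- by move=> i; rewrite /Act /ok; case: ifP => //; rewrite cards0.
- move=> i; rewrite /Dl /Act; case: (ok i); last exact: polyf0.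
  case: i => rep [r [zs gs]] /=; refine (polyf_le _ (polyf_denom R b u rep zs gs)).
  apply: leq_trans (leq_addr _ _); rewrite leq_mul2r; apply/orP; right.
  by rewrite -ltnS ltn_ord.
- move=> i j; rewrite /G /Act; case: (ok i); last exact: polyf0.
  case: i => rep [r [zs gs]] /=; refine (polyf_le _ (polyf_numer R u v0 i0 rep zs gs j)).
  rewrite leq_add2r leq_mul2r; apply/orP; right.
  by rewrite -ltnS ltn_ord.
move=> e He.
have [rep [r [zs [gs [y [h1 h2 h3 h4]]]]]] := parametrise_copies adj_sym bal v0R r0d He.
pose i : I := (rep, Tagged (fun r : 'I_r0.+1 => ({ffun 'I_r -> PI * PI} * {ffun 'I_r -> Mon})%type)
  (zs, gs)).
have oki : ok i by [].
exists i, y; rewrite /Dl /G oki; split=> // j /Tl[[k|k] ->].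
  by rewrite -h3 ffunE.
exact: h4.
Qed.

(** A larger family would have one more independent flagged coordinate than there are coefficients,
    contradicting the algebraic relation. The roots [u] are parameters of the formula, so [C] serves
    all of them. *)
Lemma count_copy_coords : exists C, forall (u : {ffun V -> pt}) v0 i0 (A : seq K)
    (S : seq ({ffun CI -> K} * {ffun 'I_s -> K})),
  v0 \notin R -> uniq A -> (0 < size A)%N -> uniq S ->
  (forall p, p \in S -> [/\ forall k, p.1 k \in A, forall j, p.2 j \in A
     & forall j, copy_coord adj R p.1 u v0 i0 (p.2 j)]) ->
  (size S <= C * size A ^ #|{: CI}|)%N.
Proof.
have H (p : V * 'I_a) : exists C, forall (u : {ffun V -> pt}) (A : seq K)
    (S : seq ({ffun CI -> K} * {ffun 'I_s -> K})),
  p.1 \notin R -> uniq A -> (0 < size A)%N -> uniq S ->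
  (forall q, q \in S -> [/\ forall k, q.1 k \in A, forall j, q.2 j \in A
     & forall j, copy_coord adj R q.1 u p.1 p.2 (q.2 j)]) ->
  (size S <= C * size A ^ #|{: CI}|)%N.
  case: p => v0 i0 /=.
  pose Q (e : {ffun J -> K}) :=
    forall j, copy_coord adj R (env_coef e) (env_pts true e) v0 i0 (env_val e j).
  have dQ : definable Q by apply: definable_all => j; apply: definable_copy_coord.
  pose l : seq J := [seq inl k | k : CI + 'I_s].
  have ul : uniq l by rewrite map_inj_uniq ?enum_uniq // => x y [].
  have lP (j : J) : (j \in l) = if j is inl _ then true else false.
    case: j => k; first by rewrite map_f // mem_enum.
    by apply/negbTE/mapP=> -[].
  have [C HC] := definable_Schwartz_Zippel l #|{: CI}|.+1 dQ.
  exists C => u A S v0R uA A0 uS HS; rewrite leqNgt; apply/negP=> sS.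
  pose e0 := mk_env (V := V) [ffun=> 0] (fun _ : 'I_s => 0) u u : {ffun J -> K}.
  pose f (p : {ffun CI -> K} * {ffun 'I_s -> K}) : {ffun J -> K} := mk_env p.1 p.2 u u.
  have finj : injective f.
    move=> [c1 a1] [c2 a2] /ffunP E; congr (_, _); apply/ffunP=> k.
      by have := E (inl (inl k)); rewrite !ffunE.
    by have := E (inl (inr k)); rewrite !ffunE.
  have [] := HC A e0 [seq f p | p <- S] uA A0.
  - by rewrite map_inj_uniq.
  - move=> e' /mapP[p /HS[h1 h2 h3] ->]; split.
    + move=> j; rewrite /env_val ffunE.
      have -> : env_coef (f p) = p.1 by apply/ffunP=> k; rewrite !ffunE.
      have -> : env_pts true (f p) = u by apply/ffunP=> v; apply/ffunP=> k; rewrite !ffunE.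
      exact: h3.
    + by move=> j; rewrite lP; case: j => // -[[[] v] k] _; rewrite !ffunE.
    + by move=> j; rewrite lP; case: j => // -[k|k] _; rewrite ffunE.
  - by rewrite size_map.
  move=> bs [sb cb fl].
  pose T := [set j | (j, true) \in zip l bs].
  have cT : #|T| = #|{: CI}|.+1 by rewrite /T card_flag_true.
  have Tl j : j \in T -> exists k, j = inl k.
    rewrite inE => /(map_f fst); rewrite -/(unzip1 _) unzip1_zip ?sb //= lP.
    by case: j => // k _; exists k.
  have [E [c [[m cm] c1 c2]]] := copy_coords_relation u i0 v0R Tl cT.
  case/eqP: cm; apply: (flagged_independent ul sb fl c1) => e' Qe' he'.
  apply: c2; suff <- : env_pts true e' = u by [].
  by apply/ffunP=> v; apply/ffunP=> k; rewrite !ffunE he' ?lP // ffunE.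
have [C HC] := choice H; exists (\sum_p C p)%N => u v0 i0 A S v0R uA A0 uS HS.
apply: leq_trans (HC (v0, i0) u A S v0R uA A0 uS HS) _.
by rewrite leq_mul2r (bigD1 (v0, i0)) //= leq_addr orbT.
Qed.

End CountCopyCoords.

(** * Random polynomials over finite fields of characteristic two *)

Section FiniteSubfields.
Import GRing.Theory.
Local Open Scope ring_scope.

Lemma closedField_char2 : exists K : closedFieldType, 2 \in [pchar K].
Proof.
have [K [f _]] := countable_algebraic_closure 'F_2.
by exists K; rewrite (fmorph_pchar f); apply: pchar_Fp.
Qed.

(** These are the roots of X^q - X, which are simple because the derivative is -1, and closed under
    sums by Frobenius. *)
Lemma finite_subfield (K : closedFieldType) (j : nat) : 2 \in [pchar K] -> (0 < j)%N ->
  exists A : seq K, [/\ uniq A, size A = (2 ^ j)%N, 0 \in A & 1 \in A] /\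
    [/\ {in A &, forall x y, x + y \in A}, {in A &, forall x y, x * y \in A}
      & {in A, forall x, - x \in A}].
Proof.
move=> c2 j0; pose q := (2 ^ j)%N; pose p : {poly K} := 'X^q - 'X.
have q1 : (1 < q)%N by rewrite -(expn0 2) ltn_exp2l.
have q0 : q%:R = 0 :> K by rewrite natrX (pcharf0 c2) expr0n; case: (j) j0.
have szp : size p = q.+1.
  by rewrite size_polyDl size_polyXn // size_polyN size_polyX ltnS.
have mp : p \is monic.
  rewrite monicE lead_coefDl ?lead_coefXn //.
  by rewrite size_polyXn size_polyN size_polyX ltnS.
have [A] := closed_field_poly_normal p; rewrite (monicP mp) scale1r => Ap.
have sep : separable_poly p.
  rewrite unlock derivB derivXn derivX -mulr_natr.
  have -> : q%:R = 0 :> {poly K} by rewrite -polyC_natr q0.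
  by rewrite mulr0 sub0r -scaleN1r coprimepZr ?coprimep1 // oppr_eq0 oner_eq0.
have memA x : (x \in A) = (x ^+ q == x).
  by rewrite -root_prod_XsubC -Ap rootE hornerD hornerN hornerXn hornerX subr_eq0.
exists A; split; first split.
- by rewrite -separable_prod_XsubC -Ap.
- by apply: succn_inj; rewrite -/q -szp Ap size_prod_XsubC.
- by rewrite memA expr0n; case: (q) q1.
- by rewrite memA expr1n.
split=> [x y|x y|x]; rewrite !memA.
- by move=> /eqP xq /eqP yq; rewrite exprDn_pchar ?xq ?yq // pnatX pnatE // c2.
- by move=> /eqP xq /eqP yq; rewrite exprMn xq yq.
- by move=> /eqP xq; rewrite (oppr_pchar2 c2) xq.
Qed.

End FiniteSubfields.

Section RandomPolynomials.
Import GRing.Theory.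
Local Open Scope ring_scope.
Variables (K : closedFieldType) (V : finType) (adj : rel V) (R : {set V}).
Variables (a b d s : nat) (A : seq K).
Hypotheses (uA : uniq A) (A0 : 0 \in A) (A1 : 1 \in A).
Hypotheses (AD : {in A &, forall x y, x + y \in A}) (AM : {in A &, forall x y, x * y \in A}).
Hypothesis AN : {in A, forall x, - x \in A}.

Notation Fq := (seq_sub A).
Notation q := (size A).
Notation Mon := {ffun bool * 'I_a -> 'I_d}.
Notation CI := ('I_b * Mon)%type.
Notation Pt := {ffun 'I_a -> Fq}.

Definition pt_val (x : Pt) : {ffun 'I_a -> K} := [ffun i => ssval (x i)].
Definition coef_val (c : {ffun CI -> Fq}) : {ffun CI -> K} := [ffun k => ssval (c k)].
Definition pts_val (u : {ffun V -> Pt}) : {ffun V -> {ffun 'I_a -> K}} := [ffun v => pt_val (u v)].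

Lemma pt_val_inj : injective pt_val.
Proof. by move=> x y /ffunP E; apply/ffunP=> i; apply: val_inj; have := E i; rewrite !ffunE. Qed.

Lemma coef_val_inj : injective coef_val.
Proof. by move=> x y /ffunP E; apply/ffunP=> i; apply: val_inj; have := E i; rewrite !ffunE. Qed.

Lemma card_Fq : #|{: Fq}| = q. Proof. exact: card_seq_sub. Qed.

Lemma card_preim_seq (L : seq K) : (#|[set x : Fq | ssval x \in L]| <= size L)%N.
Proof.
rewrite cardE -(size_map (@ssval _ A)); apply: uniq_leq_size.
  by rewrite map_inj_uniq ?enum_uniq //; apply: val_inj.
by move=> y /mapP[x]; rewrite mem_enum inE => xL ->.
Qed.

Lemma mono_in x y (m : Mon) : mono (pt_pair (pt_val x) (pt_val y)) m \in A.
Proof.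
rewrite /mono; elim/big_ind: _ => // -[be i] _; rewrite ffunE.
have xA : (if (be, i).1 then pt_val x i else pt_val y i) \in A.
  by case: be => /=; rewrite ffunE; exact: ssvalP.
elim: (nat_of_ord _) => [|n IH]; first by rewrite expr0.
by rewrite exprS; apply: AM.
Qed.

(** Given the other coefficients, exactly one constant term makes a polynomial vanish at [(x, y)].
    The map [f] corrects the constant terms and records the old ones. *)
Lemma card_alg_edge x y : (0 < d)%N ->
  (q ^ #|{: CI}| <= #|[set c | alg_edge (coef_val c) (pt_val x) (pt_val y)]| * q ^ b)%N.
Proof.
move=> d0; pose m0 : Mon := [ffun=> Ordinal d0].
pose z := pt_pair (pt_val x) (pt_val y).
have m0z : mono z m0 = 1 by rewrite /mono big1 // => t _; rewrite [m0 t]ffunE.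
pose rest (c : {ffun CI -> Fq}) i := \sum_(m | m != m0) ssval (c (i, m)) * mono z m.
have restA c i : - rest c i \in A.
  apply: AN; rewrite /rest; elim/big_ind: _ => // m _.
  by apply: AM; [apply: ssvalP | apply: mono_in].
pose fx (c : {ffun CI -> Fq}) : {ffun CI -> Fq} :=
  [ffun k => if k.2 == m0 then SeqSub (restA c k.1) else c k].
pose f (c : {ffun CI -> Fq}) : {ffun CI -> Fq} * {ffun 'I_b -> Fq} :=
  (fx c, [ffun i => c (i, m0)]).
have injf : injective f.
  move=> c c' [/ffunP E /ffunP E']; apply/ffunP=> -[i m].
  have [->|mm] := eqVneq m m0; first by have := E' i; rewrite !ffunE.
  by have := E (i, m); rewrite !ffunE /= (negPf mm).
have := card_imset (mem [set: {ffun CI -> Fq}]) injf.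
rewrite cardsT card_ffun card_Fq => <-.
have -> : (q ^ b)%N = #|[set: {ffun 'I_b -> Fq}]| by rewrite cardsT card_ffun card_Fq card_ord.
rewrite -cardsX; apply: subset_leq_card; apply/subsetP=> _ /imsetP[c _ ->].
rewrite !inE andbT; apply/forallP=> i; rewrite /alg_eval -/z (bigD1 m0) //= m0z mulr1.
rewrite !ffunE /= eqxx /= (eq_bigr (fun m => ssval (c (i, m)) * mono z m)); last first.
  by move=> m /negPf mm; rewrite !ffunE /= mm.
by rewrite addNr.
Qed.

Lemma card_ffun_all (n : nat) (G : {set Fq}) :
  #|[set al : {ffun 'I_n -> Fq} | [forall j, al j \in G]]| = (#|G| ^ n)%N.
Proof.
rewrite -[n in RHS]card_ord -card_ffun_on; apply: eq_card => al; rewrite inE.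
by apply/forallP/ffun_onP.
Qed.

Definition bad_coord D (c : {ffun CI -> Fq}) (u : {ffun V -> Pt}) v i : bool :=
  `[< exists2 L : seq K, (size L <= D)%N &
      forall x, x \notin L -> copy_coord adj R (coef_val c) (pts_val u) v i x >].

(** A bad [c] realises at least [q - D] coordinate values inside the field, hence at least
    [(q - D) ^ s] sample tuples, while the hypothesis bounds all pairs of a coefficient vector and a
    tuple. *)
Lemma card_bad_coord D C (u : {ffun V -> Pt}) v i :
  (forall S : seq ({ffun CI -> K} * {ffun 'I_s -> K}), uniq S ->
    (forall p, p \in S -> [/\ forall k, p.1 k \in A, forall j, p.2 j \in A
     & forall j, copy_coord adj R p.1 (pts_val u) v i (p.2 j)]) ->
    (size S <= C * q ^ #|{: CI}|)%N) ->
  (#|[set c | bad_coord D c u v i]| * (q - D) ^ s <= C * q ^ #|{: CI}|)%N.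
Proof.
move=> HC; pose G c := [set x : Fq |
  `[< copy_coord adj R (coef_val c) (pts_val u) v i (ssval x) >]].
have cG c : bad_coord D c u v i -> (q - D <= #|G c|)%N.
  move=> /asboolP[L sL HL].
  have sub : [set x : Fq | ssval x \notin L] \subset G c.
    by apply/subsetP=> x; rewrite !inE => xL; apply/asboolP/HL.
  apply: leq_trans (subset_leq_card sub).
  rewrite leq_subLR -card_Fq -(cardsC [set x : Fq | ssval x \in L]) leq_add //.
    exact: leq_trans (card_preim_seq L) sL.
  by apply: subset_leq_card; apply/subsetP=> x; rewrite !inE.
pose S := [set p : {ffun CI -> Fq} * {ffun 'I_s -> Fq} |
  bad_coord D p.1 u v i && [forall j, p.2 j \in G p.1]].
have cS : (#|[set c | bad_coord D c u v i]| * (q - D) ^ s <= #|S|)%N.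
  rewrite -[#|S|]sum1_card (eq_bigl (fun p : {ffun CI -> Fq} * {ffun 'I_s -> Fq} => bad_coord D p.1
    u v i && [forall j, p.2 j \in G p.1])); last first.
    by move=> p; rewrite inE.
  rewrite -(pair_big_dep (fun c => bad_coord D c u v i)
    (fun c (al : {ffun 'I_s -> Fq}) => [forall j, al j \in G c]) (fun _ _ => 1%N)) /=.
  rewrite -sum_nat_const; apply: (@leq_trans (\sum_(c | bad_coord D c u v i) (q - D) ^ s)).
    by rewrite leq_eqVlt; apply/orP; left; apply/eqP; apply: eq_bigl => c; rewrite inE.
  apply: leq_sum => c bc.
  have := card_ffun_all s (G c); rewrite -sum1_card => E.
  rewrite (eq_bigl (mem [set al : {ffun 'I_s -> Fq} | [forall j, al j \in G c]])) ?E.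
    have [->|s0] := posnP s; first by rewrite !expn0.
    by rewrite leq_exp2r // cG.
  by move=> al; rewrite !inE.
apply: leq_trans cS _.
pose g (p : {ffun CI -> Fq} * {ffun 'I_s -> Fq}) : {ffun CI -> K} * {ffun 'I_s -> K} :=
  (coef_val p.1, [ffun j => ssval (p.2 j)]).
have := HC [seq g p | p <- enum S]; rewrite size_map -cardE; apply.
  rewrite map_inj_uniq ?enum_uniq // => -[c al] [c' al'] [/coef_val_inj -> /ffunP E].
  by congr (_, _); apply/ffunP=> j; apply: val_inj; have := E j; rewrite !ffunE.
move=> y /mapP[p]; rewrite mem_enum inE => /andP[_ /forallP h] ->.
split=> [k|j|j]; rewrite ?ffunE; try exact: ssvalP.
by have := h j; rewrite inE => /asboolP.
Qed.

(** Every nonroot coordinate lies in an exceptional list of length at most [D]; the successor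
    accommodates root coordinates, whose single value is prescribed even when [D = 0]. *)
Lemma card_alg_copy D (c : {ffun CI -> Fq}) (u : {ffun V -> Pt}) :
  (forall v i, v \notin R -> exists2 L : seq K, (size L <= D)%N &
     forall x, x \notin L -> ~ copy_coord adj R (coef_val c) (pts_val u) v i x) ->
  (#|[set P : {ffun V -> Pt} | alg_copy adj (coef_val c) (pts_val P)
       && rooted_at R (pts_val u) (pts_val P)]| <= D.+1 ^ #|{: V * 'I_a}|)%N.
Proof.
move=> H.
have HL (p : V * 'I_a) : exists L : {set Fq}, (#|L| <= D.+1)%N /\ forall P : {ffun V -> Pt},
    alg_copy adj (coef_val c) (pts_val P) -> rooted_at R (pts_val u) (pts_val P) ->
    P p.1 p.2 \in L.
  case: p => v i /=; have [vR|vR] := boolP (v \in R).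
    exists [set u v i]; split=> [|P _ /forall_inP /(_ v vR)/eqP]; first by rewrite cards1.
    by rewrite !ffunE => /pt_val_inj->; rewrite inE.
  have [L sL HL] := H v i vR; exists [set x | ssval x \in L]; split.
    by apply: leq_trans (card_preim_seq L) (leqW sL).
  move=> P P1 P2; rewrite inE; apply: contraT => /HL[].
  by exists (pts_val P); split=> //; rewrite !ffunE.
have [L {}HL] := choice HL.
pose f (P : {ffun V -> Pt}) : {ffun V * 'I_a -> Fq} := [ffun p => P p.1 p.2].
have injf : injective f.
  move=> P P' /ffunP E; apply/ffunP=> v; apply/ffunP=> i.
  by have := E (v, i); rewrite !ffunE.
rewrite -(card_imset _ injf).
apply: (@leq_trans #|[set g : {ffun V * 'I_a -> Fq} | g \in family (fun p => mem (L p))]|).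
  apply: subset_leq_card; apply/subsetP=> g /imsetP[P].
  rewrite inE => /andP[P1 P2] ->; rewrite inE; apply/familyP=> p; rewrite ffunE.
  by have [_] := HL p; apply.
rewrite cardsE card_family -(size_image (fun p => #|mem (L p)|) {: V * 'I_a}).
have : all (fun x => x <= D.+1)%N [seq #|mem (L p)| | p : V * 'I_a].
  by apply/allP=> _ /mapP[p _ ->]; have [] := HL p.
elim: (image _ _) => [//|x l IH] /= /andP[xD /IH h].
by rewrite expnS leq_mul.
Qed.

End RandomPolynomials.

(** * Blow-ups and the lower bound *)

Section BlowupLift.
Variables (F : rootedGraph) (l : nat).

Definition bu_lift (k : 'I_l) (v : gV F) : bu_V F l :=
  match boolP (v \in rR F) with
  | AltTrue h => inl (exist _ v h)
  | AltFalse h => inr (exist _ v h, k)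
  end.

Lemma bu_lift_proj k v : bu_proj (bu_lift k v) = v.
Proof. by rewrite /bu_lift; case: {-}_ / boolP. Qed.

Lemma bu_lift_inj k : injective (bu_lift k).
Proof. by move=> v w E; rewrite -(bu_lift_proj k v) E bu_lift_proj. Qed.

Lemma bu_lift_root k k' v : v \in rR F -> bu_lift k v = bu_lift k' v.
Proof.
by move=> vR; rewrite /bu_lift; case: {-}_ / boolP => // h; case/negP: (h).
Qed.

Lemma bu_copy_lift k v : v \notin rR F -> bu_copy (bu_lift k v) = Some k.
Proof.
by move=> vR; rewrite /bu_lift; case: {-}_ / boolP => // h; case/negP: vR.
Qed.

Lemma bu_copy_lift_root k v : v \in rR F -> bu_copy (bu_lift k v) = None.
Proof.
by move=> vR; rewrite /bu_lift; case: {-}_ / boolP => // h; case/negP: (h).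
Qed.

Lemma bu_lift_surj (k0 : 'I_l) (x : bu_V F l) : exists k v, x = bu_lift k v.
Proof.
case: x => [[v vR]|[[v vR] k]].
  exists k0, v; rewrite /bu_lift; case: {-}_ / boolP => h; last by case/negP: (h).
  by congr inl; apply: val_inj.
exists k, v; rewrite /bu_lift; case: {-}_ / boolP => h; first by case/negP: (vR).
by congr inr; congr (_, _); apply: val_inj.
Qed.

Lemma gadj_sym (G : graph) : symmetric (@gadj G).
Proof. by move=> u v; rewrite /gadj eq_sym orbC. Qed.

Lemma gadj_bu_lift k v w : gadj v w -> @gadj (blowup F l) (bu_lift k v) (bu_lift k w).
Proof.
move=> vw; rewrite /gadj (inj_eq (@bu_lift_inj k)); case/andP: (vw) => -> _ /=.
rewrite /bu_E !bu_lift_proj vw /=; apply/orP; left.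
case: (boolP (v \in rR F)) => h; first by rewrite bu_copy_lift_root.
case: (boolP (w \in rR F)) => h'; first by rewrite (bu_copy_lift_root _ h'); case: bu_copy.
by rewrite !bu_copy_lift // eqxx.
Qed.

End BlowupLift.

Lemma leq_card_bigcup (T I : finType) (B : I -> {set T}) :
  #|\bigcup_i B i| <= \sum_i #|B i|.
Proof.
elim: (index_enum I) => [|i r IH]; first by rewrite !big_nil cards0.
by rewrite !big_cons; apply: leq_trans (leq_card_setU _ _) _; rewrite leq_add2l.
Qed.

Lemma card_lt_pairs n : 2 * #|[set p : 'I_n * 'I_n | p.1 < p.2]| + n = n * n.
Proof.
pose A := [set p : 'I_n * 'I_n | p.1 < p.2]; pose B := [set p : 'I_n * 'I_n | p.2 < p.1].
pose C := [set p : 'I_n * 'I_n | p.1 == p.2].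
have cB : #|B| = #|A|.
  have inj : injective (fun p : 'I_n * 'I_n => (p.2, p.1)) by move=> [? ?] [? ?] [-> ->].
  rewrite -(card_imset _ inj); apply: eq_card => -[x y]; rewrite inE /=.
  apply/imsetP/idP=> [[[x' y']]|xy]; first by rewrite inE /= => h [-> ->].
  by exists (y, x); rewrite ?inE.
have cC : #|C| = n.
  have inj : injective (fun x : 'I_n => (x, x)) by move=> x y [].
  rewrite -[RHS]card_ord -cardsT -(card_imset _ inj); apply: eq_card => -[x y]; rewrite inE /=.
  by apply/eqP/imsetP=> [->|[z _ [-> ->]]//]; exists y.
have : #|A :|: B :|: C| = n * n.
  rewrite -[in RHS](card_ord n) -card_prod -cardsT; congr #|pred_of_set _|.
  by apply/setP=> -[x y]; rewrite !inE /= -(inj_eq val_inj) /=; case: ltngtP.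
rewrite cardsU (_ : _ :&: C = set0); last first.
  by apply/setP=> -[x y]; rewrite !inE /= -(inj_eq val_inj) /=; case: ltngtP.
rewrite cardsU (_ : A :&: B = set0); last first.
  by apply/setP=> -[x y]; rewrite !inE /=; case: ltngtP.
by rewrite !cards0 !subn0 cB cC mul2n addnn.
Qed.

(** A first moment argument: bad choices are a fraction O(q^(-b-1)), so even if each gave a complete
    graph they would carry a negligible part of the expected edges, of which there are at least
    q^(-b) per pair. *)
Lemma good_polynomials (V : finType) (adj : rel V) (R : {set V}) (a b : nat) :
  symmetric adj -> balanced adj R a b -> 0 < a -> 0 < #|V| ->
  exists (N j0 : nat), forall j, j0 <= j ->
  exists (T : finType) (E : rel T), [/\ #|T| = (2 ^ j) ^ a,
    #|[set p : 'I_#|T| * 'I_#|T| | p.1 < p.2]| <=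
      2 * (2 ^ j) ^ b * #|[set p : 'I_#|T| * 'I_#|T| | (p.1 < p.2) && E (enum_val p.1) (enum_val
        p.2)]|
  & forall u : {ffun V -> T}, #|[set P : {ffun V -> T} | [&& injectiveb P,
        [forall v, forall w, adj v w ==> E (P v) (P w) || E (P w) (P v)]
      & [forall v in R, P v == u v]]]| <= N].
Proof.
move=> sym bal a0 V0; have [K c2] := closedField_char2.
(* The summands of [s] pay for the union over q^(a|V|) root placements, for the edge probability
   q^(-b), and for one spare factor q. The degree allows interpolation at all pairs from [s]
   copies. *)
pose s := (a * #|V| + b + 1)%N; pose d := (s * #|{: V * V}|)%N.
have s0 : 0 < s by rewrite /s addn1.
have d0 : 0 < d by rewrite /d muln_gt0 s0 card_prod muln_gt0 V0.
have [D HD] := copy_coord_dichotomy K adj R a b d s0.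
have [C HC] := count_copy_coords K (s := s) sym bal (leqnn d).
pose C3 := (#|{: V * 'I_a}| * 2 ^ s * C)%N.
exists (D.+1 ^ #|{: V * 'I_a}|)%N, (2 * C3 + 2 * D + 1)%N => j jj0.
have j_gt0 : 0 < j by apply: leq_trans jj0; rewrite addn1.
have [A [[uA sA A0 A1] [AD AM AN]]] := finite_subfield c2 j_gt0.
have jq : j < size A by rewrite sA ltn_expl.
pose Fq : finType := seq_sub A; pose Pt : finType := {ffun 'I_a -> Fq}.
pose CI : finType := ('I_b * {ffun bool * 'I_a -> 'I_d})%type.
pose Cf : finType := {ffun CI -> Fq}.
pose q := size A.
have cF : #|Fq| = q by apply: card_seq_sub.
have cPt : #|Pt| = q ^ a by rewrite card_ffun cF card_ord.
pose E (c : Cf) : rel Pt := fun x y => alg_edge (coef_val c) (pt_val x) (pt_val y).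
pose TB := \bigcup_(x : {ffun V -> Pt} * (V * 'I_a)) 
  (if x.2.1 \in R then set0 else [set c : Cf | bad_coord adj R D c x.1 x.2.1 x.2.2]).
(* Since [q > j >= 2 * D], subtracting [D] at most halves [q]. *)
have qD : q ^ s <= 2 ^ s * (q - D) ^ s.
  by rewrite -expnMn leq_exp2r // /q; lia.
have cTB : #|TB| * q ^ b.+1 <= C3 * q ^ #|CI|.
  have h1 : #|TB| * (q - D) ^ s <= q ^ (a * #|V|) * #|{: V * 'I_a}| * (C * q ^ #|CI|).
    apply: leq_trans (leq_mul (leq_card_bigcup _) (leqnn _)) _.
    rewrite big_distrl /=.
    have -> : q ^ (a * #|V|) * #|{: V * 'I_a}| = #|{: {ffun V -> Pt} * (V * 'I_a)}|.
      by rewrite [RHS]card_prod card_ffun cPt expnM.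
    rewrite -sum_nat_const; apply: leq_sum => -[u [v i]] _ /=.
    case: ifP => [_|/negbT vR]; first by rewrite cards0.
    by apply: card_bad_coord => // S uS HS; apply: HC HS; rewrite // -/q -cF; apply/card_gt0P;
      exists (SeqSub A0).
  have q0 : 0 < q by lia.
  have qV : 0 < q ^ (a * #|V|) by rewrite expn_gt0 q0.
  rewrite -(leq_pmul2r qV).
  rewrite -mulnA -expnD (_ : b.+1 + a * #|V| = s); last by rewrite /s; lia.
  apply: leq_trans (leq_mul (leqnn _) qD) _; rewrite mulnCA.
  apply: leq_trans (leq_mul (leqnn _) h1) _.
  by rewrite /C3 (mulnC (2 ^ s)) [X in _ <= X]mulnC -!mulnA leq_mul2l; apply/orP; right;
    rewrite leq_mul2l; apply/orP; right; rewrite !mulnA mulnC mulnA leqnn.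
pose Prs := [set p : 'I_#|Pt| * 'I_#|Pt| | p.1 < p.2].
pose ec (c : Cf) := #|[set p : 'I_#|Pt| * 'I_#|Pt| | (p.1 < p.2) && E c (enum_val p.1) (enum_val
  p.2)]|.
have sum_ec : #|Prs| * q ^ #|CI| <= q ^ b * \sum_c ec c.
  have -> : \sum_c ec c = \sum_(p in Prs) #|[set c : Cf | E c (enum_val p.1) (enum_val p.2)]|.
    rewrite (eq_bigr (fun c : Cf => \sum_(p in Prs | E c (enum_val p.1) (enum_val p.2)) 1));
      last first.
      by move=> c _; rewrite /ec -[LHS]sum1_card; apply: eq_bigl => p; rewrite !inE.
    rewrite (exchange_big_dep (mem Prs)) //=; last by move=> c p _ /andP[].
    apply: eq_bigr => p pP; rewrite -[RHS]sum1_card; apply: eq_bigl => c.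
    by rewrite inE pP.
  rewrite big_distrr /= -sum_nat_const; apply: leq_sum => p _.
  by rewrite mulnC; apply: card_alg_edge.
have P0 : 0 < #|Prs|.
  have n2 : 1 < #|Pt|.
    rewrite cPt; apply: (@leq_trans (q ^ 1)); last by rewrite leq_pexp2l //; lia.
    by rewrite expn1; lia.
  by apply/card_gt0P; exists (Ordinal (ltnW n2), Ordinal n2); rewrite inE.
have [c cT ce] : exists2 c, c \notin TB & #|Prs| <= 2 * q ^ b * ec c.
  apply: contrapT => H.
  have He c : c \notin TB -> 2 * q ^ b * ec c <= #|Prs|.
    by move=> cT; rewrite leqNgt; apply/negP => /ltnW h; apply: H; exists c.
  have h2 : 2 * (q ^ b * \sum_c ec c) <= 2 * (#|TB| * (q ^ b * #|Prs|)) + #|Prs| * q ^ #|CI|.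
    rewrite (bigID (mem TB)) /= mulnDr mulnDr leq_add //.
      rewrite leq_mul2l /= mulnCA leq_mul2l; apply/orP; right.
      rewrite -sum_nat_const; apply: leq_sum => c _; apply: subset_leq_card.
      by apply/subsetP=> p; rewrite !inE => /andP[].
    rewrite mulnA big_distrr /=.
    apply: (@leq_trans (\sum_(c | c \notin TB) #|Prs|)); first by apply: leq_sum.
    rewrite sum_nat_const mulnC leq_mul2l; apply/orP; right.
    by apply: leq_trans (max_card _) _; rewrite card_ffun cF.
  have h3 : #|Prs| * q ^ #|CI| <= 2 * (#|TB| * (q ^ b * #|Prs|)) by move: h2 sum_ec; lia.
  have h4 : q ^ #|CI| <= 2 * (#|TB| * q ^ b).
    by rewrite -(leq_pmul2l P0); apply: leq_trans h3 _; rewrite [X in _ <= X]mulnC -!mulnA.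
  have h5 : q * q ^ #|CI| <= 2 * C3 * q ^ #|CI|.
    apply: leq_trans (leq_mul (leqnn q) h4) _.
    rewrite -mulnA; apply: leq_trans (leq_mul (leqnn 2) cTB).
    by rewrite mulnCA leq_mul2l /= expnS mulnCA.
  move: h5; rewrite leq_pmul2r ?expn_gt0; last by apply/orP; left; lia.
  by rewrite /q; lia.
exists Pt, (E c); split=> //.
- by rewrite cPt /q sA.
- by rewrite -sA.
move=> u; apply: leq_trans (card_alg_copy (adj := adj) (R := R) (D := D) (c := c) (u := u) _);
  last first.
  move=> v i vR; have [L sL [h|h]] := HD (coef_val c) (pts_val u) v i; last by exists L.
  case/negP: cT; apply/bigcupP; exists (u, (v, i)) => //=; rewrite (negPf vR) inE.
  by apply/asboolP; exists L.
apply: subset_leq_card; apply/subsetP=> P; rewrite !inE => /and3P[Pi Pe Pr].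
apply/andP; split; last first.
  by apply/forall_inP=> v vR; rewrite !ffunE; move/forall_inP/(_ v vR)/eqP: Pr => ->.
apply/andP; split.
  by apply/injectiveP=> v w; rewrite !ffunE => /pt_val_inj; apply/injectiveP.
by apply/forallP=> v; apply/forallP=> w; rewrite !ffunE; move/forallP/(_ v)/forallP/(_ w): Pe.
Qed.

Lemma blowup_lower_bound (F : rootedGraph) (a b : nat) :
  balanced (@gadj F) (rR F) a b -> 0 < a -> (exists v, v \notin rR F) ->
  (forall v : gV F, exists w, gadj v w) ->
  exists l0 j0, forall l j n, l0 <= l -> j0 <= j -> (2 ^ j) ^ a <= n ->
    ((2 ^ j) ^ a) * ((2 ^ j) ^ a) <= 8 * (2 ^ j) ^ b * ex n (blowup F l).
Proof.
move=> bal a0 [v0 v0R] niso.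
have V0 : 0 < #|gV F| by apply/card_gt0P; exists v0.
have [N [j0 H]] := good_polynomials (@gadj_sym F) bal a0 V0.
exists N.+1, j0.+1 => l j n lN jj0 nq.
have [T [E [cT cE cN]]] := H j (ltnW jj0).
have Tn : #|T| <= n by rewrite cT.
pose w (i : 'I_#|T|) := widen_ord Tn i.
have winj : injective w by move=> i k [/val_inj].
pose Ec := [set (w p.1, w p.2) | p : 'I_#|T| * 'I_#|T| & E (enum_val p.1) (enum_val p.2)].
have EcP x y : (x, y) \in Ec -> exists i k, [/\ x = w i, y = w k & E (enum_val i) (enum_val k)].
  by case/imsetP=> -[i k]; rewrite inE /= => h [-> ->]; exists i, k.
have nc : ~~ contains Ec (blowup F l).
  apply/negP=> /existsP[f /andP[/injectiveP finj /forallP fE]].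
  have fP x y : @gadj (blowup F l) x y -> host_adj Ec (f x) (f y).
    by move=> xy; move/forallP/(_ y)/implyP: (fE x); apply.
  pose k0 : 'I_l := Ordinal (leq_ltn_trans (leq0n N) lN).
  (* All host edges lie among the first [#|T|] vertices, and no vertex of the blow-up is
     isolated. *)
  have fw x : exists i, f x = w i.
    have [k [v ->]] := bu_lift_surj k0 x; have [v' vv'] := niso v.
    have /andP[_ /orP[]] := fP _ _ (gadj_bu_lift k vv').
      by move/EcP=> [i [i' [-> _ _]]]; exists i.
    by move/EcP=> [i' [i [_ -> _]]]; exists i.
  have [g Hg] := choice fw.
  have ginj : injective g by move=> x y E'; apply: finj; rewrite !Hg E'.
  pose P (k : 'I_l) : {ffun gV F -> T} := [ffun v => enum_val (g (bu_lift k v))].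
  have Pinj : injective P.
    move=> k k' /ffunP/(_ v0); rewrite !ffunE => /enum_val_inj/ginj E'.
    have := bu_copy_lift k v0R; rewrite E' bu_copy_lift //.
    by case.
  have := cN (P k0); apply/negP; rewrite -ltnNge; apply: (leq_trans lN).
  rewrite -[l]card_ord -cardsT -(card_imset _ Pinj); apply: subset_leq_card.
  apply/subsetP=> _ /imsetP[k _ ->]; rewrite inE; apply/and3P; split.
  - by apply/injectiveP=> v v'; rewrite !ffunE => /enum_val_inj/ginj/bu_lift_inj.
  - apply/forallP=> v; apply/forallP=> v'; apply/implyP=> vv'.
    have /andP[_] := fP _ _ (gadj_bu_lift k vv').
    rewrite !Hg !ffunE => /orP[] /EcP[i [i' [/winj -> /winj -> ->]]] //.
    by rewrite orbT.
  - by apply/forall_inP=> v vR; rewrite !ffunE (bu_lift_root k k0 vR).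
have ne : #|[set p : 'I_#|T| * 'I_#|T| | (p.1 < p.2) && E (enum_val p.1) (enum_val p.2)]| <= ex n
  (blowup F l).
  apply: leq_trans (leq_bigmax_cond (F := @nedges n) _ nc).
  have inj : injective (fun p : 'I_#|T| * 'I_#|T| => (w p.1, w p.2)).
    by move=> [i k] [i' k'] [] /val_inj -> /val_inj ->.
  rewrite -(card_imset _ inj); apply: subset_leq_card; apply/subsetP=> x /imsetP[[i k]].
  rewrite inE /= => /andP[ik Eik] ->; rewrite inE /= ik /=; apply/andP; split.
    by apply/eqP=> /winj ikE; rewrite ikE ltnn in ik.
  by apply/orP; left; apply/imsetP; exists (i, k); rewrite ?inE.
have := card_lt_pairs #|T|; rewrite -cT => cp.
have T2 : 1 < #|T|.
  rewrite cT -expnM -(expn0 2) ltn_exp2l // muln_gt0 a0 andbT.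
  by apply: leq_trans jj0.
(* The 8 in the conclusion is this 4 times the 2 lost to bad choices of polynomials. *)
have h1 : #|T| * #|T| <= 4 * #|[set p : 'I_#|T| * 'I_#|T| | p.1 < p.2]| by nia.
apply: leq_trans h1 _; apply: leq_trans (leq_mul (leqnn 4) cE) _.
apply: leq_trans (leq_mul (leqnn 4) (leq_mul (leqnn _) ne)) _.
by apply: eq_leq; lia.
Qed.

(** * The Erdős–Simonovits reduction *)

(** Average over all colourings: flipping the colour of one end shows that each edge is bichromatic
    in exactly half of them. *)
Lemma bipartite_half (T : finType) (e : rel T) : irreflexive e ->
  exists c : {ffun T -> bool},
    #|[set p : T * T | e p.1 p.2]| <= 2 * #|[set p : T * T | e p.1 p.2 && (c p.1 != c p.2)]|.
Proof.
move=> irr; pose m := #|[set p : T * T | e p.1 p.2]|.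
pose cut (c : {ffun T -> bool}) := #|[set p : T * T | e p.1 p.2 && (c p.1 != c p.2)]|.
have half p : e p.1 p.2 -> 2 * #|[set c : {ffun T -> bool} | c p.1 != c p.2]| = #|{: {ffun T ->
  bool}}|.
  case: p => x y /= xy; have nxy : y != x by apply/eqP=> E; rewrite E irr in xy.
  pose fl (c : {ffun T -> bool}) : {ffun T -> bool} := [ffun z => if z == x then ~~ c z else c z].
  have flK : involutive fl.
    by move=> c; apply/ffunP=> z; rewrite !ffunE; case: eqP => // _; rewrite negbK.
  pose A := [set c : {ffun T -> bool} | c x != c y].
  rewrite -/A -(cardsC A) mul2n -addnn; congr (_ + _).
  have -> : ~: A = fl @: A; last by rewrite card_imset //; apply: inv_inj.
  apply/setP=> c; rewrite inE inE; apply/idP/imsetP => [h|[c']]; last first.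
    by rewrite inE => h ->; rewrite !ffunE eqxx (negPf nxy); case: (c' x) (c' y) h => [] [].
  exists (fl c); last by rewrite flK.
  by rewrite inE !ffunE eqxx (negPf nxy); case: (c x) (c y) h => [] [].
have sum : \sum_c 2 * cut c = m * #|{: {ffun T -> bool}}|.
  rewrite -big_distrr /= (eq_bigr (fun c : {ffun T -> bool} =>
     \sum_(p : T * T | e p.1 p.2 && (c p.1 != c p.2)) 1)); last first.
    by move=> c _; rewrite -[LHS]sum1_card; apply: eq_bigl => p; rewrite inE.
  rewrite (exchange_big_dep (fun p => e p.1 p.2)) /=; last by move=> c p _ /andP[].
  rewrite big_distrr /= -sum_nat_const; apply: eq_big => [p|p ep]; first by rewrite inE.
  rewrite -(half p ep) -[in RHS]sum1_card; congr (2 * _); apply: eq_bigl => c.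
  by rewrite inE ep.
case: (pickP (fun c => m <= 2 * cut c)) => [c h|h]; first by exists c.
have : \sum_c (2 * cut c + 1) <= \sum_(c : {ffun T -> bool}) m.
  by apply: leq_sum => c _; rewrite addn1 ltnNge h.
have N0 : 0 < #|{: {ffun T -> bool}}| by apply/card_gt0P; exists [ffun=> true].
by rewrite big_split /= sum !sum_nat_const muln1 mulnC -leq_subRL // subnn leqNgt N0.
Qed.

(** * Dense subgraphs of large minimum degree *)

Section Degrees.
Variables (T : finType) (e : rel T).
Hypotheses (e_sym : symmetric e).

Definition arcs (S : {set T}) := #|[set p : T * T | [&& p.1 \in S, p.2 \in S & e p.1 p.2]]|.
Definition deg (S : {set T}) v := #|[set w in S | e v w]|.

Lemma arcs_sum_deg S : arcs S = \sum_(v in S) deg S v.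
Proof.
rewrite /arcs -sum1_card (eq_bigl (fun p => (p.1 \in S) && ((p.2 \in S) && e p.1 p.2))).
  rewrite -(pair_big_dep (mem S) (fun v w => (w \in S) && e v w) (fun _ _ => 1)) /=.
  by apply: eq_bigr => v _; rewrite /deg -[RHS]sum1_card; apply: eq_bigl => w; rewrite inE.
by move=> p; rewrite inE.
Qed.

Lemma arcs_rem (S : {set T}) v : irreflexive e -> v \in S -> arcs S = arcs (S :\ v) + 2 * deg S v.
Proof.
move=> irr vS; rewrite !arcs_sum_deg (bigD1 v) //=.
have -> : \sum_(i in S | i != v) deg S i = \sum_(i in S :\ v) deg (S :\ v) i + \sum_(i in S :\ v) e
  i v.
  rewrite -big_split /=; apply: eq_big => [i|i]; first by rewrite !inE andbC.
  move=> /andP[iS iv]; rewrite /deg.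
  rewrite (cardsD1 v [set w in S | e i w]) inE vS addnC; congr (_ + _).
  by apply: eq_card => w; rewrite !inE andbA.
have -> : \sum_(i in S :\ v) (e i v : nat) = deg S v.
  rewrite /deg -sum1_card big_mkcond /= [RHS]big_mkcond /=; apply: eq_bigr => w _.
  rewrite !inE e_sym; have [->|_] := eqVneq w v; first by rewrite irr andbF.
  by rewrite /=; case: (w \in S); case: (e v w).
lia.
Qed.

(** Deleting a vertex of degree below half the average does not lower the average degree; a set
    where this is no longer possible is as required. *)
Lemma dense_subset : irreflexive e -> 0 < #|T| ->
  exists S : {set T}, [/\ S != set0, arcs setT * #|S| <= arcs S * #|T|
    & forall v, v \in S -> arcs S <= 2 * deg S v * #|S|].
Proof.
move=> irr T0.
suff H n (S : {set T}) : #|S| = n.+1 -> exists S' : {set T}, [/\ S' != set0,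
    arcs S * #|S'| <= arcs S' * #|S| & forall v, v \in S' -> arcs S' <= 2 * deg S' v * #|S'|].
  have := H #|T|.-1 setT; rewrite cardsT prednK // => /(_ erefl)[S' h]; exists S'.
  by move: h; rewrite -cardsT.
elim: n S => [|n IH] S cS.
  exists S; split=> //; first by rewrite -card_gt0 cS.
  move=> v vS; have := arcs_rem irr vS.
  have -> : S :\ v = set0.
    by apply/eqP; rewrite -cards_eq0; have := cardsD1 v S; rewrite cS vS; lia.
  by rewrite cS (arcs_sum_deg set0) big_set0; lia.
have [v /andP[vS hv]|h] := pickP [pred v | (v \in S) && (2 * deg S v * #|S| < arcs S)]; last first.
  exists S; split=> //; first by rewrite -card_gt0 cS.
  by move=> v vS; have := h v; rewrite /= vS /= ltnNge => /negbFE.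
have cSv : #|S :\ v| = n.+1 by have := cardsD1 v S; rewrite cS vS; lia.
have [S' [h1 h2 h3]] := IH _ cSv; exists S'; split=> //.
have := arcs_rem irr vS; move: hv h2; rewrite /= cS cSv.
move: (arcs S) (arcs S') (arcs (S :\ v)) (deg S v) #|S'| => x x' y d s' hv h2 E.
have h4 : x * n.+1 <= y * n.+2 by nia.
have : x * s' * n.+1 <= x' * n.+2 * n.+1 by nia.
by rewrite leq_pmul2r.
Qed.

End Degrees.

(** Discarding a lightest element never lowers the average weight. *)
Lemma heavy_subset (T : finType) (w : T -> nat) (A : {set T}) k : k <= #|A| ->
  exists B : {set T}, [/\ B \subset A, #|B| = k & k * \sum_(x in A) w x <= #|A| * \sum_(x in B) w
    x].
Proof.
move=> kA; move: {2}(#|A| - k) (erefl (#|A| - k)) => n.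
elim: n A kA => [|n IH] A kA En.
  by exists A; split=> //; [lia | rewrite leq_mul2r; apply/orP; right; lia].
have A0 : 0 < #|A| by lia.
have /card_gt0P[x0 x0A] := A0.
have [x xA0 xmin] := arg_minnP w x0A; have xA : x \in A by [].
have cA := cardsD1 x A; rewrite xA in cA.
have [|| B [BA cB hB]] := IH (A :\ x); [lia|lia|].
exists B; split=> //; first exact: subset_trans BA (subsetDl _ _).
have sA : \sum_(y in A) w y = w x + \sum_(y in A :\ x) w y.
  by rewrite (bigD1 x) //=; congr (_ + _); apply: eq_bigl => y; rewrite !inE andbC.
have hx : #|A :\ x| * w x <= \sum_(y in A :\ x) w y.
  by rewrite -sum_nat_const; apply: leq_sum => y; rewrite inE => /andP[_ /xmin].
have k0 : #|A :\ x| = 0 -> k = 0 by lia.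
move: hB hx k0; rewrite sA cA add1n.
move: #|A :\ x| (w x) (\sum_(y in A :\ x) w y) (\sum_(y in B) w y) => a wx s t hB hx k0.
have [a0|a0] := posnP a; last first.
  rewrite -(leq_pmul2l a0).
  have : k * (a * wx) <= k * s by rewrite leq_mul2l hx orbT.
  nia.
by rewrite (k0 a0).
Qed.

(** * An edge with many arcs between the neighbourhoods of its ends *)

Section RichEdge.
Import ring.
Import Order.TTheory GRing.Theory Num.Theory.
Local Open Scope ring_scope.
Variables (T : finType) (e : rel T) (dl : nat).
Hypotheses (e_sym : symmetric e) (dl0 : (0 < dl)%N).
Hypothesis dl_deg : forall v, (dl <= deg e setT v)%N.

Let d (v : T) : rat := (deg e setT v)%:R.
Let ee x y : rat := (e x y)%:R.
Let M : rat := (arcs e setT)%:R.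

Definition nbr_arcs x y : nat := #|[set p : T * T | [&& e x p.1, e y p.2 & e p.1 p.2]]|.

Lemma rich_d_gt0 v : 0 < d v.
Proof. by rewrite ltr0n; apply: leq_trans (dl_deg v). Qed.

Lemma rich_dE v : d v = \sum_w ee v w.
Proof.
rewrite /d /deg -sum1_card natr_sum big_mkcond; apply: eq_bigr => w _.
by rewrite !inE /= /ee; case: (e v w).
Qed.

Lemma rich_ME : M = \sum_v d v.
Proof.
rewrite /M arcs_sum_deg natr_sum; apply: eq_bigl => v; by rewrite inE.
Qed.

(** With adjacency matrix A and degree matrix D this is the entry of A D^-1 A. The sum of
    [w x z ^+ 2 / (d x * d z)] is then the trace of (D^-1 A)^4. *)
Let w x z : rat := \sum_y ee x y * ee y z / d y.

Lemma rich_sum_w : \sum_x \sum_z w x z = M.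
Proof.
rewrite rich_ME /w.
under eq_bigr => x _ do rewrite exchange_big /=.
rewrite exchange_big /=; apply: eq_bigr => y _.
transitivity ((\sum_x ee x y) * (\sum_z ee y z) / d y).
  by rewrite big_distrlr /= mulr_suml; apply: eq_bigr => x _; rewrite mulr_suml.
rewrite -rich_dE -mulrA divff ?mulr1 ?(lt0r_neq0 (rich_d_gt0 _)) //.
by rewrite rich_dE; apply: eq_bigr => x _; rewrite /ee e_sym.
Qed.

(** Cauchy-Schwarz in the form of a completed square: [w x z] is compared with its value
    [d x * d z / M] in the fully mixed case. *)
Lemma rich_trace : (0 < #|T|)%N -> 1 <= \sum_x \sum_z w x z ^+ 2 / (d x * d z).
Proof.
move=> T0; have M0 : 0 < M.
  rewrite rich_ME; have /card_gt0P[v _] := T0; rewrite (bigD1 v) //=.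
  apply: ltr_wpDr (rich_d_gt0 v); apply: sumr_ge0 => z _; exact/ltW/rich_d_gt0.
have h x z : 2 * w x z / M - d x * d z / M ^+ 2 <= w x z ^+ 2 / (d x * d z).
  have D0 : 0 < d x * d z by rewrite mulr_gt0 ?rich_d_gt0.
  rewrite -subr_ge0.
  have -> : w x z ^+ 2 / (d x * d z) - (2 * w x z / M - d x * d z / M ^+ 2) =
            (w x z - d x * d z / M) ^+ 2 / (d x * d z).
    by field; rewrite !lt0r_neq0 ?rich_d_gt0.
  by rewrite divr_ge0 ?sqr_ge0 // ltW.
apply: le_trans (ler_sum _ (fun x _ => ler_sum _ (fun z _ => h x z))).
have -> : \sum_x \sum_z (2 * w x z / M - d x * d z / M ^+ 2) =
  2 / M * (\sum_x \sum_z w x z) - M ^- 2 * ((\sum_x d x) * (\sum_z d z)).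
  rewrite big_distrlr /= !mulr_sumr -sumrB; apply: eq_bigr => x _.
  rewrite !mulr_sumr -sumrB; apply: eq_bigr => z _.
  by field; rewrite !lt0r_neq0.
rewrite rich_sum_w -rich_ME.
have -> : 2 / M * M - M ^- 2 * (M * M) = 1 by field; rewrite lt0r_neq0.
by [].
Qed.

(** Group the closed four-step walks by an arc [(x, y)]: the other two vertices form an arc between
    the neighbourhoods, of weight at most [dl ^ -2]. If all counts were below the threshold, each of
    the [M] arcs would contribute less than [1 / M] to a trace that is at least 1. *)
Lemma rich_edge : (0 < #|T|)%N -> exists x y, e x y /\
  (dl * dl * (deg e setT x * deg e setT y) <= arcs e setT * nbr_arcs x y)%N.
Proof.
move=> T0.
have [v _] := card_gt0P T0.
have M0 : 0 < M.
  rewrite rich_ME (bigD1 v) //=.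
  apply: ltr_wpDr (rich_d_gt0 v); apply: sumr_ge0 => z _; exact/ltW/rich_d_gt0.
apply: contrapT => H.
have Hq x y : e x y -> (nbr_arcs x y)%:R / (dl%:R ^+ 2 * (d x * d y)) < M^-1.
  move=> exy; have D0 : 0 < dl%:R ^+ 2 * (d x * d y).
    by rewrite !mulr_gt0 ?exprn_gt0 ?rich_d_gt0 ?ltr0n.
  rewrite ltr_pdivrMr //.
  rewrite mulrC -ltr_pdivrMr ?invr_gt0 // invrK.
  rewrite /M /d -natrX -!natrM ltr_nat mulnC ltnNge expnS expn1.
  by apply/negP=> h; apply: H; exists x, y.
have key : \sum_x \sum_z w x z ^+ 2 / (d x * d z) <=
    \sum_(p : T * T | e p.1 p.2) (nbr_arcs p.1 p.2)%:R / (dl%:R ^+ 2 * (d p.1 * d p.2)).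
  have -> : \sum_x \sum_z w x z ^+ 2 / (d x * d z) =
     \sum_(p : T * T | e p.1 p.2) \sum_(q : T * T | [&& e p.1 q.1, e p.2 q.2 & e q.1 q.2])
        ((d p.1 * d p.2) * (d q.1 * d q.2))^-1.
    rewrite (eq_bigr (fun x => \sum_z \sum_y \sum_a
      ee x y * (ee x a * ee y z * ee a z) / ((d x * d y) * (d a * d z)))); last first.
      move=> x _; apply: eq_bigr => z _; rewrite expr2 {1}/w mulr_suml mulr_suml.
      apply: eq_bigr => y _; rewrite /w mulr_sumr mulr_suml; apply: eq_bigr => a _.
      by field; rewrite !lt0r_neq0 ?rich_d_gt0.
    rewrite -(pair_big_dep xpredT (fun x y => e x y) (fun x y => \sum_(q : T * T | [&& e x q.1, e y
      q.2 & e q.1 q.2])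
        ((d x * d y) * (d q.1 * d q.2))^-1)) /=.
    apply: eq_bigr => x _; rewrite exchange_big [RHS]big_mkcond /=; apply: eq_bigr => y _.
    have [exy|/negPf nxy] := boolP (e x y); last first.
      by rewrite big1 // => z _; rewrite big1 // => a _; rewrite /ee nxy !mul0r.
    rewrite [RHS]big_mkcond /= exchange_big /= pair_bigA /=; apply: eq_bigr => -[a z] _ /=.
    rewrite /ee exy mul1r; case: (e x a); case: (e y z); case: (e a z);
      rewrite ?mul0r ?mulr0 ?mul0r ?mul1r //.
  apply: ler_sum => -[x y] /= exy.
  rewrite -[(nbr_arcs x y)%:R]mulr1 -mulrA mulr_natl.
  have -> X : X *+ nbr_arcs x y = \sum_(q : T * T | [&& e x q.1, e y q.2 & e q.1 q.2]) X :> rat.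
    by rewrite /nbr_arcs -sumr_const; apply: eq_bigl => q; rewrite inE.
  apply: ler_sum => -[a z] _ /=;
    rewrite mul1r lef_pV2 ?posrE ?mulr_gt0 ?exprn_gt0 ?rich_d_gt0 ?ltr0n //.
  rewrite mulrC ler_pM2l ?mulr_gt0 ?rich_d_gt0 // expr2.
  by apply: ler_pM; rewrite ?ler0n // ler_nat.
have : \sum_(p : T * T | e p.1 p.2) (nbr_arcs p.1 p.2)%:R / (dl%:R ^+ 2 * (d p.1 * d p.2)) <
  \sum_(p : T * T | e p.1 p.2) M^-1.
  apply: ltr_sum => [|[x y] /= exy]; last exact: Hq.
  have : (0 < deg e setT v)%N by apply: leq_trans (dl_deg v).
  case/card_gt0P => u; rewrite !inE /= => vu.
  by apply/hasP; exists (v, u); rewrite ?mem_index_enum.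
have -> : \sum_(p : T * T | e p.1 p.2) M^-1 = 1.
  rewrite sumr_const -mulr_natl.
  have -> : #|[pred p : T * T | e p.1 p.2]|%:R = M.
    by rewrite /M /arcs; congr _%:R; apply: eq_card => p; rewrite !inE.
  by rewrite divff // lt0r_neq0.
move=> h; have := le_lt_trans (le_trans (rich_trace T0) key) h.
by rewrite ltxx.
Qed.

End RichEdge.

(** Both neighbourhoods are trimmed to their heaviest parts in turn, which makes the degrees of [x]
    and [y] cancel from the estimate. *)
Lemma rich_pair (T : finType) (e : rel T) (dl : nat) : symmetric e -> 0 < dl ->
  (forall v, dl <= deg e setT v) -> 0 < #|T| ->
  exists x y (A B : {set T}), [/\ e x y, A \subset [set v | e x v], B \subset [set v | e y v],
    #|A| = dl & #|B| = dl] /\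
    dl * dl * (dl * dl) <= arcs e setT * #|[set p : T * T | [&& p.1 \in A, p.2 \in B & e p.1 p.2]]|.
Proof.
move=> sym dl0 Hd T0; have [x [y [exy Hxy]]] := rich_edge sym dl0 Hd T0.
have dE v : #|[set u | e v u]| = deg e setT v.
  by apply: eq_card => u; rewrite !inE.
have [|A [AN cA hA]] := @heavy_subset T (fun a => #|[set b | e y b && e a b]|) [set v | e x v] dl.
  by rewrite dE.
have [|B [BN cB hB]] := @heavy_subset T (fun b => #|[set a in A | e a b]|) [set v | e y v] dl.
  by rewrite dE.
exists x, y, A, B; split; first by [].
have E1 : nbr_arcs e x y = \sum_(a in [set v | e x v]) #|[set b | e y b && e a b]|.
  rewrite /nbr_arcs -sum1_card (eq_bigl (fun p => (p.1 \in [set v | e x v]) && (e y p.2 && e p.1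
    p.2))); last first.
    by move=> p; rewrite !inE.
  rewrite -(pair_big_dep (mem [set v | e x v]) (fun a b => e y b && e a b) (fun _ _ => 1)) /=.
  by apply: eq_bigr => a _; rewrite -[RHS]sum1_card; apply: eq_bigl => b; rewrite inE.
have E2 : \sum_(a in A) #|[set b | e y b && e a b]| = \sum_(b in [set v | e y v]) #|[set a in A | e
  a b]|.
  rewrite (eq_bigr (fun a => \sum_(b | e y b && e a b) 1)); last first.
    by move=> a _; rewrite -[LHS]sum1_card; apply: eq_bigl => b; rewrite inE.
  rewrite (exchange_big_dep (fun b => e y b)) /=; last by move=> a b _ /andP[].
  apply: eq_big => [b|b yb]; first by rewrite inE.
  by rewrite -[RHS]sum1_card; apply: eq_bigl => a; rewrite !inE yb.
have E3 : #|[set p : T * T | [&& p.1 \in A, p.2 \in B & e p.1 p.2]]| = \sum_(b in B) #|[set a in A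
  | e a b]|.
  rewrite -[LHS]sum1_card (eq_bigl (fun p => (p.1 \in A) && ((p.2 \in B) && e p.1 p.2)));
    last first.
    by move=> p; rewrite !inE.
  rewrite -(pair_big_dep (mem A) (fun a b => (b \in B) && e a b) (fun _ _ => 1)) /=.
  rewrite (exchange_big_dep (mem B)) /=; last by move=> a b _ /andP[].
  apply: eq_bigr => b bB; rewrite -[RHS]sum1_card; apply: eq_bigl => a.
  by rewrite !inE bB.
rewrite E3; move: hA hB Hxy; rewrite -E1 E2 !dE.
have dx : 0 < deg e setT x by apply: leq_trans (Hd x).
have dy : 0 < deg e setT y by apply: leq_trans (Hd y).
move: (deg e setT x) (deg e setT y) (arcs e setT) (nbr_arcs e x y) dx dy => dx dy M q dx0 dy0.
move: (\sum_(b in B) _) (\sum_(b in _) _) => s t h1 h2 h3.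
rewrite -(leq_pmul2r (_ : 0 < dx * dy)); last by rewrite muln_gt0 dx0.
have h4 : dl * (dl * q) <= dx * dy * s.
  apply: leq_trans (leq_mul (leqnn dl) h1) _.
  by rewrite mulnCA -mulnA leq_mul2l h2 orbT.
have h5 : dl * dl * (dl * dl * (dx * dy)) <= dl * dl * (M * q) by rewrite leq_mul2l h3 orbT.
have h6 : M * (dl * (dl * q)) <= M * (dx * dy * s) by rewrite leq_mul2l h4 orbT.
by move: h5 h6; nia.
Qed.

(** * Transferring extremal bounds to the smaller graph *)

Definition embeds (H G : graph) : Prop :=
  exists2 f : gV H -> gV G, injective f & forall u v, gadj u v -> gadj (f u) (f v).

Definition narcs (G : graph) : nat := #|[set p : gV G * gV G | gadj p.1 p.2]|.

Lemma embeds_trans H1 H2 H3 : embeds H1 H2 -> embeds H2 H3 -> embeds H1 H3.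
Proof.
move=> [f fi fe] [g gi ge]; exists (g \o f); first exact: inj_comp.
by move=> u v /fe/ge.
Qed.

Lemma gadj_irr (G : graph) : irreflexive (@gadj G).
Proof. by move=> v; rewrite /gadj eqxx. Qed.

Section Subtype.
Variables (T : finType) (e : rel T) (S : {set T}).
Let e' : rel {v | v \in S} := fun x y => e (val x) (val y).

Lemma deg_sub (v : {v | v \in S}) : deg e' setT v = deg e S (val v).
Proof.
rewrite /deg -(card_imset _ val_inj); apply: eq_card => w; rewrite [in RHS]inE.
apply/imsetP/andP=> [[u]|[wS vw]]; first by rewrite !inE => /= uv ->; split=> //; apply: valP.
by exists (exist _ w wS); rewrite ?inE.
Qed.

Lemma arcs_sub : arcs e' setT = arcs e S.
Proof.
have inj : injective (fun p : {v | v \in S} * {v | v \in S} => (val p.1, val p.2)).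
  by move=> [x y] [x' y'] [/val_inj -> /val_inj ->].
rewrite /arcs -(card_imset _ inj); apply: eq_card => -[x y]; rewrite [in RHS]inE /=.
apply/imsetP/and3P=> [[[u v]]|[xS yS xy]].
  by rewrite !inE => /= uv [-> ->]; split=> //; apply: valP.
by exists (exist _ x xS, exist _ y yS); rewrite ?inE.
Qed.
End Subtype.

(* In a bipartite graph the copy of [H] found between the neighbourhoods of the ends
   of an edge [xy] extends by [x] and [y] to a copy of [F1 c]. *)
Lemma embeds_F1_nbrs (H : rootedGraph) (c : gV H -> bool) (G : graph) (s : gV G -> bool)
    (x y : gV G) (phi : gV H -> gV G) :
  connected H -> bipartition c -> injective phi ->
  (forall u v, gadj u v -> gadj (phi u) (phi v) /\ s (phi u) != s (phi v)) ->
  gadj x y -> s x != s y ->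
  (forall v, phi v != x /\ phi v != y) ->
  (forall v, gadj (if s x == ~~ s (phi v) then x else y) (phi v)) ->
  embeds (F1 c) G.
Proof.
move=> conn bip phi_inj phi_e xy sxy phi_n phi_z.
pose z be := if s x == ~~ be then x else y.
(* By connectedness the sides of the host induce either [c] or its complement on the whole copy; [k]
   tells which, and thus which of [x], [y] plays which new root. *)
pose k := [exists v, s (phi v) != c v].
have kE v : (s (phi v) != c v) = k.
  have cl : closed (@gadj H) [pred v | s (phi v) != c v].
    move=> u w uw; rewrite !inE; have [_] := phi_e u w uw; have := bip u w uw.
    by case: (c u); case: (c w); case: (s (phi u)); case: (s (phi w)).
  apply/idP/existsP=> [h|[u hu]]; first by exists v.
  by have := closed_connect cl (conn u v); rewrite !inE hu => <-.
pose ka be := be (+) k.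
have sE v : s (phi v) = ka (c v).
  by rewrite /ka -(kE v); case: (s (phi v)); case: (c v).
have zP v : gadj (z (ka (c v))) (phi v) by rewrite -sE; apply: phi_z.
have zE : gadj (z (ka true)) (z (ka false)).
  by rewrite /z /ka; case: (k) => /=; case: (s x) sxy => /= _; rewrite ?xy // gadj_sym.
have zn v be : phi v != z be by rewrite /z; case: ifP => _; have [] := phi_n v.
pose g (w : gV (F1 c)) : gV G :=
  match w with inl v => phi v | inr true => z (ka false) | inr false => z (ka true) end.
have zne : z (ka true) != z (ka false) by case/andP: zE.
exists g.
  move=> [u|[]] [v|[]] //= E.
  - by rewrite (phi_inj _ _ E).
  - by have := zn u (ka false); rewrite E eqxx.
  - by have := zn u (ka true); rewrite E eqxx.
  - by have := zn v (ka false); rewrite -E eqxx.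
  - by rewrite E eqxx in zne.
  - by have := zn v (ka true); rewrite -E eqxx.
  - by rewrite E eqxx in zne.
have half u v : f1_E c u v -> gadj (g u) (g v).
  case: u v => [u|[]] [v|[]] //=.
  - by move=> /phi_e[].
  - by move=> cv; have := zP v; rewrite (negPf cv).
  - by move=> _; rewrite gadj_sym.
  - by move=> cv; have := zP v; rewrite cv.
by move=> u v /andP[_ /orP[/half //|/half]]; rewrite gadj_sym.
Qed.

(** [G'] spans the two trimmed neighbourhoods without [x] and [y], which are kept free for the new
    roots. The 4 is 2 for bipartiteness times 2 for the minimum degree; [2 * dl] covers the arcs
    lost at [x] and [y]. *)
Lemma rich_subgraph (H : rootedGraph) (c : gV H -> bool) (G : graph) :
  connected H -> bipartition c -> ~ embeds (F1 c) G -> 0 < narcs G ->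
  exists dl (G' : graph), [/\ 0 < dl, ~ embeds H G', #|gV G'| <= 2 * dl,
    narcs G <= 4 * dl * #|gV G| & dl * dl * dl <= 2 * #|gV G| * (narcs G' + 2 * dl)].
Proof.
move=> conn bip nemb nG.
have T0 : 0 < #|gV G| by case/card_gt0P: nG => -[x y] _; apply/card_gt0P; exists x.
have [s hs] := bipartite_half (@gadj_irr G).
pose e : rel (gV G) := fun x y => gadj x y && (s x != s y).
have e_sym : symmetric e by move=> x y; rewrite /e gadj_sym eq_sym.
have e_irr : irreflexive e by move=> x; rewrite /e eqxx andbF.
have [S [S0 hS dS]] := dense_subset e_sym e_irr T0.
have aT : arcs e setT = #|[set p : gV G * gV G | gadj p.1 p.2 && (s p.1 != s p.2)]|.
  by apply: eq_card => p; rewrite !inE.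
have nT : narcs G <= 2 * arcs e setT by rewrite aT.
have cS : 0 < #|S| by rewrite card_gt0.
have /card_gt0P[v1 v1S] := cS.
have [v0 v0S' vmin] := arg_minnP (deg e S) v1S; have v0S : v0 \in S by [].
pose dl := deg e S v0.
have dlS : arcs e S <= 2 * dl * #|S| by apply: dS.
have ndl : narcs G <= 4 * dl * #|gV G|.
  rewrite -(leq_pmul2r cS); apply: leq_trans (leq_mul nT (leqnn _)) _.
  rewrite -mulnA; apply: leq_trans (leq_mul (leqnn 2) hS) _.
  rewrite mulnA; apply: leq_trans (leq_mul (leq_mul (leqnn 2) dlS) (leqnn _)) _.
  by apply: eq_leq; lia.
have dl0 : 0 < dl by move: nG ndl; case: (dl) => //; rewrite muln0 mul0n; case: narcs.
pose T : finType := {v | v \in S}.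
pose e1 : rel T := fun x y => e (val x) (val y).
have e1_sym : symmetric e1 by move=> x y; apply: e_sym.
have Tc : 0 < #|T| by apply/card_gt0P; exists (exist _ v0 v0S).
have dT v : dl <= deg e1 setT v by rewrite /e1 deg_sub; apply: vmin; apply: valP.
have [x [y [A [B [[xy AN BN cA cB] hAB]]]]] := rich_pair e1_sym dl0 dT Tc.
pose W := (A :|: B) :\ x :\ y.
pose G' := @Graph {v | v \in W} (fun u v => e1 (val u) (val v)).
have adjG' (u v : gV G') : gadj u v = e1 (val u) (val v).
  rewrite /gadj /= (e1_sym (val v)) orbb; apply: andb_idl => h.
  by apply/eqP=> E; rewrite E /e1 e_irr in h.
exists dl, G'; split=> //.
- move=> [f finj fe]; apply: nemb.
  have fW v : [/\ val (f v) != y, val (f v) != x & (val (f v) \in A) || (val (f v) \in B)].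
    by have := valP (f v); rewrite !inE => /and3P[].
  case/andP: (xy) => gxy sxy.
  apply: (@embeds_F1_nbrs _ _ G s (val x) (val y) (fun v => val (val (f v)))) => //.
  + by move=> u v /val_inj/val_inj/finj.
  + by move=> u v /fe; rewrite adjG' => /andP[].
  + by move=> v; rewrite !(inj_eq val_inj); have [-> ->] := fW v.
  move=> v; have [_ _ /orP[vA|vB]] := fW v.
    move/(subsetP AN): vA; rewrite inE => /andP[g1 g2].
    by rewrite (_ : (s (val x) == _) = true) //; move: g2; case: (s (val x)); case: (s _).
  move/(subsetP BN): vB; rewrite inE => /andP[g1 g2].
  by rewrite (_ : (s (val x) == _) = false) //; move: g2 sxy; case: (s (val x)); case: (s (val y));
    case: (s _).
- rewrite card_sig; apply: (@leq_trans #|A :|: B|); last first.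
    by apply: leq_trans (leq_card_setU _ _) _; rewrite cA cB mul2n addnn.
  by apply: subset_leq_card; apply/subsetP=> v; rewrite !inE => /and3P[].
pose X := [set p : T * T | [&& p.1 \in A, p.2 \in B & e1 p.1 p.2]].
have hX : #|X| <= narcs G' + 2 * dl.
  pose h (p : gV G' * gV G') := (val p.1, val p.2).
  have hinj : injective h by move=> [u v] [u' v'] [/val_inj -> /val_inj ->].
  pose Z := [set p : gV G' * gV G' | gadj p.1 p.2].
  have sub : X \subset (h @: Z) :|: (setX [set y] B :|: setX A [set x]).
    apply/subsetP=> -[u v]; rewrite inE /= => /and3P[uA vB uv].
    rewrite !inE /=; have [uy|uy] := eqVneq u y; first by rewrite vB orbT.
    have [vx|vx] := eqVneq v x; first by rewrite uA orbT.
    rewrite andbF /= orbF; apply/imsetP.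
    have ux : u != x.
      apply/eqP=> E; move/(subsetP AN): uA; rewrite E inE /e1 e_irr //.
    have vy : v != y.
      apply/eqP=> E; move/(subsetP BN): vB; rewrite E inE /e1 e_irr //.
    have uW : u \in W by rewrite !inE uy ux uA.
    have vW : v \in W by rewrite !inE vy vx vB orbT.
    by exists (exist _ u uW, exist _ v vW); rewrite // inE adjG'.
  apply: leq_trans (subset_leq_card sub) _; apply: leq_trans (leq_card_setU _ _) _.
  rewrite (card_imset _ hinj) leq_add2l; apply: leq_trans (leq_card_setU _ _) _.
  by rewrite !cardsX !cards1 cA cB mul1n muln1 mul2n addnn.
have hM : arcs e1 setT <= 2 * dl * #|gV G|.
  rewrite /e1 arcs_sub; apply: leq_trans dlS _; rewrite leq_mul2l; apply/orP; right.
  exact: max_card.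
rewrite -(leq_pmul2l dl0); move: hAB; rewrite -/X => hAB.
apply: (@leq_trans (dl * dl * (dl * dl))); first by apply: eq_leq; lia.
apply: leq_trans hAB _; apply: leq_trans (leq_mul hM hX) _.
by apply: eq_leq; lia.
Qed.

Lemma card_sym_rel n (r : rel 'I_n) : symmetric r -> irreflexive r ->
  #|[set p : 'I_n * 'I_n | r p.1 p.2]| = 2 * #|[set p : 'I_n * 'I_n | (p.1 < p.2) && r p.1 p.2]|.
Proof.
move=> sym irr; pose A := [set p : 'I_n * 'I_n | (p.1 < p.2) && r p.1 p.2].
pose sw (p : 'I_n * 'I_n) := (p.2, p.1).
have inj : injective sw by move=> [? ?] [? ?] [-> ->].
have -> : [set p : 'I_n * 'I_n | r p.1 p.2] = A :|: sw @: A.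
  apply/setP=> -[x y]; rewrite !inE /=; apply/idP/orP=> [xy|[/andP[]//|/imsetP[[u v]]]].
    have [h|h|h] := ltngtP x y; first by left; rewrite xy.
      by right; apply/imsetP; exists (y, x) => //; rewrite inE /= h sym.
    by move: xy; rewrite (val_inj h) irr.
  by rewrite inE /= => /andP[_ uv] [-> ->]; rewrite sym.
rewrite cardsU (card_imset _ inj) (_ : _ :&: _ = set0) ?cards0 ?subn0 ?mul2n ?addnn //.
apply/setP=> -[x y]; rewrite !inE /=; apply/negP=> /andP[/andP[xy _] /imsetP[[u v]]].
by rewrite inE /= => /andP[uv _] [xE yE]; move: xy; rewrite xE yE; lia.
Qed.

Lemma narcs_le_ex (H G : graph) : ~ embeds H G -> narcs G <= 2 * ex #|gV G| H.
Proof.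
move=> nemb; pose n := #|gV G|; pose E : {set 'I_n * 'I_n} :=
  [set p | gadj (enum_val p.1) (enum_val p.2)].
have hE (i j : 'I_n) : host_adj E i j = gadj (enum_val i) (enum_val j).
  rewrite /host_adj !inE /= (gadj_sym (enum_val j)) orbb; apply: andb_idl.
  by case/andP=> + _; apply: contra => /eqP->.
have nc : ~~ contains E H.
  apply/negP=> /existsP[f /andP[/injectiveP finj /forallP fE]]; apply: nemb.
  exists (fun v => enum_val (f v)); first by move=> u v /enum_val_inj/finj.
  by move=> u v uv; rewrite -hE; move/forallP/(_ v)/implyP: (fE u); apply.
apply: leq_trans (leq_mul (leqnn 2) (leq_bigmax_cond (F := @nedges n) _ nc)).
rewrite /nedges -card_sym_rel; last 2 first.
- by move=> i j; rewrite !hE gadj_sym.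
- by move=> i; rewrite hE gadj_irr.
have inj : injective (fun p : gV G * gV G => (enum_rank p.1, enum_rank p.2)).
  by move=> [x y] [x' y'] [/enum_rank_inj -> /enum_rank_inj ->].
rewrite /narcs -(card_imset _ inj); apply: subset_leq_card.
apply/subsetP=> p /imsetP[[x y]]; rewrite inE /= => xy ->.
by rewrite inE /= hE !enum_rankK.
Qed.

Lemma narcs_max (G : graph) : narcs G <= #|gV G| * #|gV G|.
Proof. by apply: leq_trans (max_card _) _; rewrite card_prod. Qed.

(** * Real exponents *)

Section Bounds.
Local Open Scope R_scope.

(** Graphs of every order are covered by one constant, since the reduction applies the bound to a
    subgraph whose order is only bounded above. *)
Definition ubound (H : graph) (g : R) : Prop :=
  exists C : R, 0 <= C /\ forall G : graph, ~ embeds H G ->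
    INR (narcs G) <= C * Rpower (INR #|gV G|) g.

Lemma Rpower_ge1 x y : 1 <= x -> 0 <= y -> 1 <= Rpower x y.
Proof.
move=> x1 y0; rewrite -(Rpower_O x); last by lra.
have [->|x1'] : x = 1 \/ 1 < x by lra.
  by rewrite /Rpower ln_1 !Rmult_0_r; lra.
exact: Rle_Rpower.
Qed.

Lemma INR_ge1 n : (0 < n)%N -> 1 <= INR n.
Proof. by move=> n0; have := le_INR 1 n; rewrite INR_1; apply; lia. Qed.

Lemma bigO_ubound H g : 0 <= g ->
  bigO (fun n => INR (ex n H)) (fun n => Rpower (INR n) g) -> ubound H g.
Proof.
move=> g0 [C [n0 HC]]; exists (2 * Rabs C + INR (n0 * n0)%N).
have C0 := Rabs_pos C; have n00 := pos_INR (n0 * n0)%N.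
split; first by lra.
move=> G nemb; have P0 : 0 < Rpower (INR #|gV G|) g by apply: exp_pos.
have [h|h] := leqP n0 #|gV G|.
  have h1 : INR (ex #|gV G| H) <= C * Rpower (INR #|gV G|) g := HC _ h.
  have h2 : INR (narcs G) <= 2 * INR (ex #|gV G| H).
    rewrite -[2]/(INR 2) -mult_INR; apply: le_INR.
    by have := narcs_le_ex nemb; rewrite mulnE; lia.
  have h3 := Rmult_le_compat_r _ _ _ (Rlt_le _ _ P0) (Rle_abs C).
  have h4 := Rmult_le_pos _ _ n00 (Rlt_le _ _ P0); lra.
have [G0|G0] := posnP #|gV G|.
  have -> : narcs G = 0%N by have := narcs_max G; rewrite G0; lia.
  by apply: Rmult_le_pos; lra.
have h1 : INR (narcs G) <= INR (n0 * n0)%N.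
  apply: le_INR; have := narcs_max G; nia.
have h2 := Rpower_ge1 (INR_ge1 G0) g0.
have h3 := Rmult_le_pos _ _ C0 (Rlt_le _ _ P0).
have h4 := Rmult_le_compat_l _ _ _ n00 h2; lra.
Qed.

Lemma ubound_bigO H g : ubound H g ->
  bigO (fun n => INR (ex n H)) (fun n => Rpower (INR n) g).
Proof.
move=> [C [C0 HC]]; exists C, 0%N => n _.
have P0 : 0 <= C * Rpower (INR n) g by apply: Rmult_le_pos => //; apply: Rlt_le; apply: exp_pos.
have [E nc HE] : exists2 E : {set 'I_n * 'I_n}, (~~ contains E H \/ ex n H = 0%N) & ex n H = nedges
  E \/ ex n H = 0%N.
  case: (pickP (fun E : {set 'I_n * 'I_n} => ~~ contains E H)) => [E0 h0|h].
    by rewrite /ex (bigmax_eq_arg E0 h0); case: arg_maxnP => // E hE _; exists E; left.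
  by exists set0; right; rewrite /ex big_pred0.
have [-> //|/eqP e0] := eqVneq (ex n H) 0%N.
case: nc HE => // nc [->|//].
pose Gr := @Graph 'I_n (fun i j => (i, j) \in E).
have := HC Gr _; rewrite /= card_ord.
have -> : narcs Gr = (2 * nedges E)%N.
  by rewrite /nedges -card_sym_rel //; [exact: (@gadj_sym Gr) | exact: (@gadj_irr Gr)].
move=> h; have h1 : INR (nedges E) <= INR (2 * nedges E)%N by apply: le_INR; lia.
apply: Rle_trans h1 (h _) => -[f finj fe]; case/negP: nc; apply/existsP.
exists [ffun v => f v]; apply/andP; split; first by apply/injectiveP=> u v; rewrite !ffunE => /finj.
by apply/forallP=> u; apply/forallP=> v; apply/implyP=> uv; rewrite !ffunE; apply: fe.
Qed.

Lemma ubound_embeds H1 H2 g : embeds H1 H2 -> ubound H2 g -> ubound H1 g.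
Proof.
move=> h12 [C [C0 HC]]; exists C; split=> // G n1; apply: HC => n2.
exact: n1 (embeds_trans h12 n2).
Qed.

Lemma Rpower_le_pos x y g : 0 <= g -> 0 < x -> x <= y -> Rpower x g <= Rpower y g.
Proof. by move=> g0 x0 xy; apply: Rle_Rpower_l. Qed.

(** For minimum degree x and order m the reduction reads x^3 <= K m x^(2-g), so x = O(m^(1/(1+g))),
    and there are at most 4xm arcs. With g = 1/rho the new exponent has g/(1+g) = 1/(rho+1). *)
Lemma ubound_F1 (H : rootedGraph) (c : gV H -> bool) g : 0 < g <= 1 ->
  connected H -> bipartition c -> ubound H (2 - g) -> ubound (F1 c) (2 - g / (1 + g)).
Proof.
move=> [g0 g1] conn bip [C [C0 HC]].
(* The 4 bounds [2 ^ (2 - g)], as [G'] has up to [2 * x] vertices; the inner 2 absorbs the lost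
   arcs, using [x <= P]. *)
pose K := 2 * (4 * C + 2); pose K' := Rpower K (/ (1 + g)).
have K0 : 0 < K by rewrite /K; lra.
have K'0 : 0 < K' by apply: exp_pos.
exists (4 * K'); split; first by lra.
move=> G nemb; have [->|n0] := posnP (narcs G).
  by apply: Rmult_le_pos; [lra | apply/Rlt_le/exp_pos].
have [dl [G' [dl0 nH cG' nG hd]]] := rich_subgraph conn bip nemb n0.
have G0 : (0 < #|gV G|)%N by case: #|gV G| nG => //; rewrite muln0; lia.
have x1 := INR_ge1 dl0; have m1 := INR_ge1 G0.
move: x1 m1; set x := INR dl; set m := INR #|gV G| => x1 m1.
have h1 : INR (narcs G) <= 4 * x * m.
  have := le_INR _ _ (leP nG); rewrite !mult_INR /x /m /=; lra.
have h2 : x * x * x <= 2 * m * (INR (narcs G') + 2 * x).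
  have := le_INR _ _ (leP hd); rewrite !mult_INR plus_INR mult_INR /x /m /=; lra.
pose P := Rpower x (2 - g).
have hP : Rpower (INR #|gV G'|) (2 - g) <= 4 * P.
  have E4 : Rpower (2 * x) (2 - g) <= 4 * P.
    rewrite -Rpower_mult_distr; try lra; rewrite /P.
    apply: Rmult_le_compat_r; first exact/Rlt_le/exp_pos.
    have -> : 4 = Rpower 2 (INR 2) by rewrite Rpower_pow /=; lra.
    by apply: Rle_Rpower; rewrite /=; lra.
  apply: Rle_trans E4; have [->|v0] := posnP #|gV G'|.
    (* The logarithm is 0 at 0 by convention, so this power of 0 is 1. *)
    have -> : Rpower (INR 0) (2 - g) = 1.
      rewrite /Rpower /= /ln; case: Rlt_dec => [h|_]; first by case: (Rlt_irrefl 0 h).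
      by rewrite Rmult_0_r exp_0.
    by apply: Rpower_ge1; lra.
  apply: Rpower_le_pos; first by lra.
    by have := INR_ge1 v0; lra.
  by have := le_INR _ _ (leP cG'); rewrite mult_INR /x /=; lra.
have hx : x <= P.
  by rewrite -{1}(Rpower_1 x); [apply: Rle_Rpower; lra | lra].
have P0 : 0 < P by apply: exp_pos.
have h3 : x * x * x <= K * m * P.
  have h4 := HC G' nH; rewrite /K.
  have h5 : INR (narcs G') <= C * (4 * P) by apply: Rle_trans h4 _; apply: Rmult_le_compat_l.
  nra.
have E3 : x * x * x = P * Rpower x (1 + g).
  rewrite -Rpower_plus (_ : 2 - g + (1 + g) = INR 3); last by rewrite /=; lra.
  by rewrite Rpower_pow /=; lra.
have h6 : Rpower x (1 + g) <= K * m by rewrite E3 in h3; nra.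
have h7 : x <= K' * Rpower m (/ (1 + g)).
  rewrite /K' Rpower_mult_distr; try lra.
  have {1}-> : x = Rpower (Rpower x (1 + g)) (/ (1 + g)).
    by rewrite Rpower_mult Rinv_r ?Rpower_1; lra.
  apply: Rpower_le_pos => //; last exact: exp_pos.
  by apply/Rlt_le/Rinv_0_lt_compat; lra.
apply: Rle_trans h1 _.
have -> : 2 - g / (1 + g) = / (1 + g) + 1 by field; lra.
by rewrite Rpower_plus Rpower_1; nra.
Qed.

End Bounds.

(** * Rooted graphs of prescribed density *)

Definition roots_independent (F : rootedGraph) :=
  forall u v : gV F, u \in rR F -> v \in rR F -> ~~ gadj u v.

Section BlowupGraph.
Variables (F : rootedGraph) (l : nat).

Lemma embeds_blowup (G : graph) (phi : 'I_l -> gV F -> gV G) : 0 < l ->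
  (forall k k' v, v \in rR F -> phi k v = phi k' v) ->
  (forall k k' v v', phi k v = phi k' v' -> v = v' /\ (v \in rR F \/ k = k')) ->
  (forall k v w, gadj v w -> gadj (phi k v) (phi k w)) ->
  embeds (blowup F l) G.
Proof.
move=> l0 phiR phi_inj phi_e; pose k0 : 'I_l := Ordinal l0.
pose f (x : bu_V F l) := phi (odflt k0 (bu_copy x)) (bu_proj x).
have fE k v : f (bu_lift k v) = phi k v.
  rewrite /f bu_lift_proj; case: (boolP (v \in rR F)) => h; first exact: phiR.
  by rewrite bu_copy_lift.
exists f.
  move=> x y; have [k [v ->]] := bu_lift_surj k0 x; have [k' [v' ->]] := bu_lift_surj k0 y.
  by rewrite !fE => /phi_inj[<- [vR|->]] //; apply: bu_lift_root.
have half x y : bu_E x y -> gadj (f x) (f y).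
  have [k [v ->]] := bu_lift_surj k0 x; have [k' [v' ->]] := bu_lift_surj k0 y.
  rewrite /bu_E !bu_lift_proj !fE => /andP[vv'].
  have [vR _|vR] := boolP (v \in rR F); first by rewrite (phiR k k') //; apply: phi_e.
  have [v'R _|v'R] := boolP (v' \in rR F); first by rewrite (phiR k' k) //; apply: phi_e.
  by rewrite !bu_copy_lift // => /eqP->; apply: phi_e.
by move=> x y /andP[_ /orP[/half//|/half]]; rewrite gadj_sym.
Qed.

Lemma bipartition_blowup (c : gV F -> bool) : bipartition c ->
  @bipartition (blowup F l) (fun x => c (bu_proj x)).
Proof.
move=> bip x y /andP[_ /orP[]] /andP[h _]; first exact: bip.
by rewrite eq_sym; apply: bip.
Qed.

Lemma connected_blowup : 0 < l -> connected F -> (exists r, r \in rR F) -> connected (blowup F l).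
Proof.
move=> l0 conn [r rR'] x y; pose k0 : 'I_l := Ordinal l0.
have H z : connect (@gadj (blowup F l)) z (bu_lift k0 r).
  have [k [v ->]] := bu_lift_surj k0 z; rewrite (bu_lift_root k0 k rR').
  have /connectP[p pp ->] := conn v r.
  elim: p v pp => [|w p IH] v /=; first by move=> _; apply: connect0.
  move=> /andP[vw pp]; apply: connect_trans (IH w pp).
  exact/connect1/gadj_bu_lift.
apply: connect_trans (H x) _.
by rewrite (sym_connect_sym (@gadj_sym _)).
Qed.

End BlowupGraph.

Lemma bu_lift_eq (F : rootedGraph) l (k k' : 'I_l) (v v' : gV F) :
  bu_lift k v = bu_lift k' v' -> v = v' /\ (v \in rR F \/ k = k').
Proof.
move=> E; have vv : v = v' by rewrite -(bu_lift_proj k v) E bu_lift_proj.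
split=> //; case: (boolP (v \in rR F)) => h; [by left|right].
have := bu_copy_lift k h; rewrite E bu_copy_lift -?vv //; by case.
Qed.

Lemma is_edgeP (F : rootedGraph) (e : {set gV F}) :
  reflect (exists u v, e = [set u; v] /\ gadj u v) (is_edge e).
Proof.
apply: (iffP existsP) => [[u /existsP[v /andP[/eqP -> uv]]]|[u [v [-> uv]]]].
  by exists u, v.
by exists u; apply/existsP; exists v; rewrite eqxx.
Qed.

Lemma is_edge_lift (F : rootedGraph) l (k : 'I_l) (e : {set gV F}) :
  is_edge e -> @is_edge (blowup F l) (bu_lift k @: e).
Proof.
move=> /is_edgeP[u [v [-> uv]]]; apply/is_edgeP; exists (bu_lift k u), (bu_lift k v).
by rewrite imsetU1 imset_set1; split=> //; apply: gadj_bu_lift.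
Qed.

(** An edge between two roots is shared by all copies, so its [l] subdivision vertices would
    collide; independence of the roots excludes this. *)
Lemma embeds_blowup_rsub (F : rootedGraph) l : 0 < l -> roots_independent F ->
  embeds (blowup (rsub F) l) (rsub (blowup F l)).
Proof.
move=> l0 ind.
pose phi (k : 'I_l) (z : gV (rsub F)) : gV (rsub (blowup F l)) :=
  match z with
  | inl v => inl (bu_lift k v)
  | inr e => inr (exist _ (bu_lift k @: val e) (is_edge_lift k (valP e)))
  end.
apply: (embeds_blowup (phi := phi)) => //.
- by move=> k k' [v|e]; rewrite inE // => vR /=; rewrite (bu_lift_root k k' vR).
- move=> k k' [v|e] [v'|e'] //= [].
    by move=> /bu_lift_eq[-> h]; rewrite inE.
  move=> E; have ee : e = e'.
    have H (k1 k2 : 'I_l) (A B : {set gV F}) : bu_lift k1 @: A = bu_lift k2 @: B -> A \subset B.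
      move=> E1; apply/subsetP=> v vA.
      have : bu_lift k1 v \in bu_lift k1 @: A by rewrite imset_f.
      by rewrite E1 => /imsetP[w wB /bu_lift_eq[-> _]].
    by apply: val_inj; apply/eqP; rewrite eqEsubset (H _ _ _ _ E) (H _ _ _ _ (esym E)).
  split; first by rewrite ee.
  right; have /is_edgeP[u [v [ev uv]]] := valP e.
  have [w we wR] : exists2 w, w \in val e & w \notin rR F.
    have [uR|uR] := boolP (u \in rR F); last by exists u => //; rewrite ev !inE eqxx.
    have [vR|vR] := boolP (v \in rR F); last by exists v => //; rewrite ev !inE eqxx orbT.
    by have := ind u v uR vR; rewrite uv.
  have : bu_lift k w \in bu_lift k @: val e by rewrite imset_f.
  rewrite E => /imsetP[w' _ /bu_lift_eq[_ [h|//]]]; by rewrite h in wR.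
have half k u v : @sd_E F u v -> gadj (phi k u) (phi k v).
  by case: u v => [u|e] [v|e'] //= ue; rewrite /gadj /= imset_f.
by move=> k u v /andP[_ /orP[/half//|/half]]; rewrite gadj_sym.
Qed.

Lemma embeds_blowup_Fstar1 (F : rootedGraph) (c : gV F -> bool) l : 0 < l ->
  embeds (blowup (Fstar1 c) l) (@F1 (blowup F l) (fun x => c (bu_proj x))).
Proof.
move=> l0.
pose phi (k : 'I_l) (z : gV (Fstar1 c)) : gV (@F1 (blowup F l) (fun x => c (bu_proj x))) :=
  match z with inl v => inl (bu_lift k v) | inr be => inr be end.
apply: (embeds_blowup (phi := phi)) => //.
- by move=> k k' [v|e] //; rewrite inE => vR /=; rewrite (bu_lift_root k k' vR).
- move=> k k' [v|be] [v'|be'] //= [].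
    by move=> /bu_lift_eq[-> h]; rewrite inE.
  by move=> ->; split=> //; left; rewrite inE.
have half k u v : @f1_E F c u v -> @gadj (@F1 (blowup F l) (fun x => c (bu_proj x))) (phi k u) (phi
  k v).
  case: u v => [u|[]] [v|[]] //=; try by rewrite /gadj /= bu_lift_proj => ->.
  move=> uv; have h := gadj_bu_lift k uv; apply/andP; split; last by apply/orP; left.
  by case/andP: h => + _; apply: contra => /eqP[->].
have half2 k u v : @gadj (F1 c) u v -> @gadj (@F1 (blowup F l) (fun x => c (bu_proj x))) (phi k u)
  (phi k v).
  by move=> /andP[_ /orP[/half//|/half]]; rewrite gadj_sym.
by move=> k u v /andP[_ /orP[/andP[h _]|/andP[h _]]]; [|rewrite gadj_sym]; apply: half2.
Qed.

(** The new vertex joined to all centres serves as the additional leaf, so the Kővári-Sós-Turán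
    bound for stars comes from the same reduction. *)
Lemma embeds_blowup_star (k l : nat) : 0 < l ->
  embeds (blowup (star k.+1) l)
    (@F1 (blowup (star k) l) (fun x => (bu_proj x : gV (star k)) == None)).
Proof.
move=> l0.
pose phi (j : 'I_l) (z : gV (star k.+1)) :
    gV (@F1 (blowup (star k) l) (fun x => (bu_proj x : gV (star k)) == None)) :=
  match z with
  | None => inl (bu_lift j (None : gV (star k)))
  | Some i => if unlift ord_max i is Some i' then inl (bu_lift j (Some i' : gV (star k)))
              else inr false
  end.
apply: (embeds_blowup (phi := phi)) => //.
- move=> j j' [i|]; rewrite inE // => _ /=; case: unlift => // i'.
  by rewrite (bu_lift_root j j') // inE.
- move=> j j' [i|] [i'|] //=.
  + case: (unliftP ord_max i) => [i1 ->|->]; case: (unliftP ord_max i') => [i2 ->|->] //=.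
      by move=> [E]; have [[->] _] := bu_lift_eq (F := star k) E; rewrite inE; split=> //; left.
    by move=> _; rewrite inE; split=> //; left.
  + by case: unlift => //= i1 [E]; have [] := bu_lift_eq (F := star k) E.
  + by case: unlift => //= i1 [E]; have [] := bu_lift_eq (F := star k) E.
  + by move=> [E]; have [_ [|->]] := bu_lift_eq (F := star k) E; [rewrite inE | split=> //; right].
have half j u v : @gE (star_graph k.+1) u v -> gadj (phi j u) (phi j v).
  case: u v => [i|] [i'|] //= _; case: unlift => [i1|] /=.
    have h : @gadj (star k) None (Some i1) by [].
    have h' := gadj_bu_lift j h; apply/andP; split; last by apply/orP; left.
    by case/andP: h' => + _; apply: contra => /eqP[->].
  by rewrite /gadj /= bu_lift_proj.
by move=> j u v /andP[_ /orP[/half//|/half]]; rewrite gadj_sym.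
Qed.

Section StarBase.
Local Open Scope R_scope.

Lemma ubound_star1 l : (0 < l)%N -> ubound (blowup (star 1) l) (2 - 1).
Proof.
move=> l0; exists (INR l); split; first exact: pos_INR.
move=> G nemb; have dG (v : gV G) : (#|[set w | gadj v w]| < l)%N.
  rewrite ltnNge; apply/negP=> h; apply: nemb.
  pose phi (j : 'I_l) (z : gV (star 1)) : gV G :=
    if z is Some _ then v else enum_val (widen_ord h j).
  have vw j : gadj v (phi j None) by have := enum_valP (widen_ord h j); rewrite inE.
  have nv j : v != phi j None by case/andP: (vw j).
  apply: (embeds_blowup (phi := phi)) => //.
  - by move=> j j' [i|]; rewrite inE.
  - move=> j j' [i|] [i'|] //= E.
    + by rewrite !ord1 inE; split=> //; left.
    + by have := nv j'; rewrite /= -E eqxx.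
    + by have := nv j; rewrite /= E eqxx.
    + by split=> //; right; move/enum_val_inj: E => [/val_inj].
  move=> j [i|] [i'|] h'; [|exact: vw|by rewrite gadj_sym; apply: vw|].
    by move: h'; rewrite /gadj /= andbF.
  by move: h'; rewrite /gadj.
have h : (narcs G <= l * #|gV G|)%N.
  rewrite /narcs -sum1_card (eq_bigl (fun p => gadj p.1 p.2)); last by move=> p; rewrite inE.
  rewrite -(pair_big_dep xpredT (fun u v => gadj u v) (fun _ _ => 1%N)) /=.
  rewrite mulnC -sum_nat_const; apply: leq_sum => v _.
  rewrite sum1_card; apply: leq_trans (ltnW (dG v)).
  by apply: eq_leq; apply: eq_card => w; rewrite !inE.
have [G0|G0] := posnP #|gV G|.
  have -> : narcs G = 0%N by move: h; rewrite G0 muln0; case: narcs.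
  by apply: Rmult_le_pos; [exact: pos_INR | exact/Rlt_le/exp_pos].
rewrite (_ : 2 - 1 = 1); last by lra.
rewrite Rpower_1; last by have := INR_ge1 G0; lra.
by rewrite -mult_INR; apply: le_INR; apply/leP.
Qed.

End StarBase.

(** * Balancedness under the two operations *)

Section Balance.

Lemma balanced_star k q : balanced (@gadj (star k)) (rR (star k)) (k * q) q.
Proof.
move=> S sS; have [->|[x xS]] := set_0Vmem S; first by rewrite cards0 muln0.
have xN y : y \in S -> y = None.
  by move/(subsetP sS); rewrite !inE negbK => /eqP.
have -> : #|S| = 1.
  apply/eqP; rewrite (cardsD1 x) xS; apply/eqP; congr (_ + _); apply/eqP; rewrite cards_eq0.
  apply/eqP/setP=> y; rewrite !inE; apply/negP=> /andP[yx /xN yE].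
  by rewrite yE (xN _ xS) eqxx in yx.
have NS : None \in S by rewrite -(xN _ xS).
pose f (p : bool * 'I_k) : option 'I_k * option 'I_k :=
  if p.1 then (None, Some p.2) else (Some p.2, None).
have injf : injective f by move=> [[] i] [[] i'] //= [->].
have : #|f @: [set: bool * 'I_k]| <= #|touching (@gadj (star k)) S|.
  apply: subset_leq_card; apply/subsetP=> p /imsetP[[[] i] _ ->]; rewrite inE /= NS ?orbT //.
rewrite (card_imset _ injf) cardsT card_prod card_bool card_ord => h.
by rewrite muln1 mulnA mulnC leq_mul2l h orbT.
Qed.

Variable F : rootedGraph.

Lemma edge_sig_proof (u v : gV F) : gadj u v -> is_edge [set u; v].
Proof. by move=> uv; apply/is_edgeP; exists u, v. Qed.

Lemma card_edge (e : {set gV F}) : is_edge e -> #|e| = 2.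
Proof. by move=> /is_edgeP[u [v [-> /andP[uv _]]]]; rewrite cards2 uv. Qed.

Notation edge := {e : {set gV F} | is_edge e}.

Lemma touching_edges (S : {set gV F}) :
  #|touching (@gadj F) S| <= 2 * #|[set e : edge | [exists v, (v \in val e) && (v \in S)]]|.
Proof.
pose ES := [set e : edge | [exists v, (v \in val e) && (v \in S)]].
pose h (p : gV F * gV F) : {set gV F} := [set p.1; p.2].
rewrite -sum1_card.
rewrite (partition_big (fun p => h p) (fun e => e \in val @: ES)) /=; last first.
  move=> [u v]; rewrite inE /= => /andP[uv uvS]; apply/imsetP.
  exists (exist _ [set u; v] (edge_sig_proof uv)) => //; rewrite inE /=; apply/existsP.
  by case/orP: uvS => ?; [exists u|exists v]; rewrite !inE eqxx ?orbT.
rewrite mulnC -(card_imset ES val_inj) -sum_nat_const.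
apply: leq_sum => e /imsetP[e' _ ->]; have /is_edgeP[u [v [-> /andP[uv _]]]] := valP e'.
rewrite sum1_card; apply: (@leq_trans #|[set (u, v); (v, u)]|); last by rewrite cards2; case: eqP.
apply: subset_leq_card; apply/subsetP=> -[x y]; rewrite unfold_in /= => /andP[].
rewrite inE /= => /andP[/andP[xy _] _] /eqP E.
have xe : x \in [set u; v] by rewrite -E !inE eqxx.
have ye : y \in [set u; v] by rewrite -E !inE eqxx orbT.
move: xe ye xy; rewrite [(x, y) \in _]inE !inE !xpair_eqE.
by case/orP=> /eqP-> ; case/orP=> /eqP->; rewrite ?eqxx ?orbT.
Qed.

(** A set splits into old vertices [S] and subdivision vertices [T]. Each member of [T] has two
    incidences, and each further edge meeting [S] has at least one. *)
Lemma balanced_rsub a b q : a + b = 2 * q -> b <= a ->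
  balanced (@gadj F) (rR F) a b -> balanced (@gadj (rsub F)) (rR (rsub F)) a q.
Proof.
move=> abq ba bal S' sS'.
pose S := [set v : gV F | (inl v : gV (rsub F)) \in S'].
pose T := [set e : edge | (inr e : gV (rsub F)) \in S'].
have cS' : #|S'| = #|S| + #|T|.
  have i1 : injective (@inl (gV F) edge) by move=> x y [].
  have i2 : injective (@inr (gV F) edge) by move=> x y [].
  have -> : S' = (inl @: S) :|: (inr @: T).
    apply/setP=> -[v|e]; rewrite inE.
      rewrite (mem_imset _ _ i1) inE orbC (_ : (inl v \in inr @: T) = false) //.
      by apply/imsetP=> -[].
    rewrite (mem_imset _ _ i2) inE (_ : (inr e \in inl @: S) = false) //.
    by apply/imsetP=> -[].
  rewrite cardsU !card_imset // (_ : _ :&: _ = set0) ?cards0 ?subn0 //.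
  by apply/setP=> x; rewrite !inE; apply/negP=> /andP[/imsetP[? _ ->] /imsetP[]].
have sS : S \subset ~: rR F.
  by apply/subsetP=> v; rewrite inE => /(subsetP sS'); rewrite !inE.
pose ES := [set e : edge | [exists v, (v \in val e) && (v \in S)]].
have hES : a * #|S| <= b * #|ES|.
  have : 2 * a * #|S| <= b * (2 * #|ES|).
    exact: leq_trans (bal S sS) (leq_mul (leqnn b) (touching_edges S)).
  by rewrite mulnCA -mulnA leq_pmul2l.
pose Inc := [set p : gV F * edge | (p.1 \in val p.2) && ((p.1 \in S) || (p.2 \in T))].
have hInc : \sum_(e : edge) (2 * (e \in T) + (e \in ES :\: T)) <= #|Inc|.
  rewrite -[#|Inc|]sum1_card (eq_bigl (fun p : gV F * edge => (p.1 \in val p.2) && ((p.1 \in S) ||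
    (p.2 \in T)))); last first.
    by move=> p; rewrite inE.
  rewrite -(pair_big_dep xpredT (fun v (e : edge) => (v \in val e) && ((v \in S) || (e \in T)))
    (fun _ _ => 1)) /=.
  rewrite (exchange_big_dep xpredT) //=; apply: leq_sum => e _.
  rewrite in_setD; have [eT|eT] /= := boolP (e \in T).
    rewrite (eq_bigl (fun v => v \in val e)) ?sum1_card ?card_edge ?(valP e) //.
    by move=> v; rewrite orbT andbT.
  rewrite add0n; case eES : (e \in ES) => //; move: eES; rewrite inE => /existsP[v /andP[ve vS]].
  by rewrite (bigD1 v) /= ?ve ?vS.
have h1 : #|ES| + #|T| <= #|Inc| /\ 2 * #|T| <= #|Inc|.
  have E : \sum_(e : edge) (2 * (e \in T) + (e \in ES :\: T)) = 2 * #|T| + #|ES :\: T|.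
    have EA (A : {set edge}) : \sum_(e : edge) (e \in A : nat) = #|A|.
      by rewrite -sum1_card [RHS]big_mkcond; apply: eq_bigr => e _; case: (e \in A).
    by rewrite big_split /= -big_distrr /= !EA.
  have := cardsID T ES; have := subset_leq_card (subsetIr ES T); move: hInc; rewrite E; lia.
have h2 : 2 * #|Inc| <= #|touching (@gadj (rsub F)) S'|.
  pose f (p : bool * (gV F * edge)) : gV (rsub F) * gV (rsub F) :=
    if p.1 then (inl p.2.1, inr p.2.2) else (inr p.2.2, inl p.2.1).
  have injf : injective f by move=> [[] [v e]] [[] [v' e']] //= [-> ->].
  have -> : 2 * #|Inc| = #|f @: (setX [set: bool] Inc)|.
    by rewrite (card_imset _ injf) cardsX cardsT card_bool.
  apply: subset_leq_card; apply/subsetP=> x /imsetP[[be [v e]]]; rewrite !inE /= => /andP[ve h] ->.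
  by case: be; rewrite /gadj /= ve //= orbC.
rewrite cS'; case: h1 => h1 h1'.
apply: (@leq_trans (q * (2 * #|Inc|))); last by rewrite leq_mul2l h2 orbT.
move: #|S| #|T| #|ES| #|Inc| hES h1 h1' => s t ee inc hES h1 h1'.
rewrite mulnA (mulnC q) -abq.
(* Since [a * s <= b * ee], it suffices to bound [2 * b * ee + 2 * a * t]. If [ee <= t] compare with
   [2 * t] incidences, otherwise with [ee + t]; the latter uses [b <= a]. *)
have [te|te] := leqP ee t.
  apply: (@leq_trans ((a + b) * (2 * t))); last by rewrite leq_mul2l h1' orbT.
  nia.
apply: (@leq_trans ((a + b) * (ee + t))); last by rewrite leq_mul2l h1 orbT.
have [z az] : exists z, a = b + z by exists (a - b); lia.
subst a; nia.
Qed.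

Lemma gadj_Fstar1_root (c : gV F -> bool) v : v \notin rR F ->
  @gadj (Fstar1 c) (inl v) (inr (~~ c v)).
Proof.
move=> vR; apply/andP; split=> //; apply/orP; left; apply/andP; split.
  by rewrite /gadj /=; case cv : (c v) => /=; rewrite ?cv.
by rewrite !inE (negPf vR).
Qed.

(** Every nonroot gains one edge to a new root, so a set [S] of nonroots meets [#|S|] additional
    edges. *)
Lemma balanced_Fstar1 (c : gV F -> bool) a b :
  balanced (@gadj F) (rR F) a b -> balanced (@gadj (Fstar1 c)) (rR (Fstar1 c)) (a + b) b.
Proof.
move=> bal S' sS'.
pose S := [set v : gV F | (inl v : gV (Fstar1 c)) \in S'].
have i1 : injective (@inl (gV F) bool) by move=> x y [].
have sS : S \subset ~: rR F.
  by apply/subsetP=> v; rewrite inE => /(subsetP sS'); rewrite !inE.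
have cS' : #|S'| = #|S|.
  rewrite -(card_imset _ i1); apply: eq_card => -[v|be].
    by rewrite (mem_imset _ _ i1) inE.
  rewrite (_ : (inr be \in inl @: S) = false); last by apply/imsetP=> -[].
  by apply/negP=> /(subsetP sS'); rewrite !inE.
pose f (p : gV F * gV F + bool * gV F) : gV (Fstar1 c) * gV (Fstar1 c) :=
  match p with
  | inl (u, v) => (inl u, inl v)
  | inr (true, v) => (inl v, inr (~~ c v))
  | inr (false, v) => (inr (~~ c v), inl v) end.
have injf : injective f.
  by move=> [[u v]|[[] v]] [[u' v']|[[] v']] //= []; [move=> -> ->|move=> ->|move=> _ ->].
have h : #|touching (@gadj F) S| + 2 * #|S| <= #|touching (@gadj (Fstar1 c)) S'|.
  pose A := (inl @: touching (@gadj F) S) :|: (inr @: setX [set: bool] S)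
    : {set gV F * gV F + bool * gV F}.
  have cA : #|A| = #|touching (@gadj F) S| + 2 * #|S|.
    have j1 : injective (@inl (gV F * gV F) (bool * gV F)) by move=> x y [].
    have j2 : injective (@inr (gV F * gV F) (bool * gV F)) by move=> x y [].
    rewrite /A cardsU !card_imset // cardsX cardsT card_bool (_ : _ :&: _ = set0) ?cards0 ?subn0 //.
    by apply/setP=> x; rewrite !inE; apply/negP=> /andP[/imsetP[? _ ->] /imsetP[]].
  rewrite -cA -(card_imset _ injf); apply: subset_leq_card; apply/subsetP=> x /imsetP[y yA ->].
  have nR v : v \in S -> v \notin rR F by move/(subsetP sS); rewrite inE.
  move: yA; rewrite inE => /orP[] /imsetP[].
    move=> [u v]; rewrite inE /= => /andP[uv uvS] -> /=; rewrite inE /=; apply/andP; split.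
      rewrite /gadj /= !inE; case/andP: (uv) => nuv _.
      rewrite (inj_eq i1) nuv /= uv /=.
      by case/orP: uvS => /nR /negPf->; rewrite ?andbF.
    by move: uvS; rewrite !inE.
  move=> [be v]; rewrite !inE /= => vS ->; have vR : v \notin rR F by apply: nR; rewrite inE.
  have e1 := gadj_Fstar1_root c vR.
  by case: be => /=; rewrite vS ?orbT andbT // gadj_sym.
rewrite cS'; apply: leq_trans (leq_mul (leqnn b) h).
have := bal S sS; rewrite mulnDr; nia.
Qed.

End Balance.

(** It leaves each new root of F_*(1) a neighbour once the edges between roots are deleted. *)
Definition two_sided (F : rootedGraph) (c : gV F -> bool) :=
  forall be, exists2 v, v \notin rR F & c v = be.

Lemma connected_neighbour (G : graph) (x y v : gV G) : connected G -> x != y ->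
  exists w, gadj v w.
Proof.
move=> conn xy.
have [w vw] : exists w, v != w.
  by have [E|] := eqVneq v x; [exists y; rewrite E | exists x].
have /connectP[[|u p] /=] := conn v w; first by move=> _ E; rewrite E eqxx in vw.
by move=> /andP[vu _] _; exists u.
Qed.

Lemma connected_via (G : graph) (r : gV G) :
  (forall v, connect (@gadj G) v r) -> connected G.
Proof.
move=> H u v; apply: connect_trans (H u) _.
by rewrite (sym_connect_sym (@gadj_sym _)).
Qed.

Lemma connected_star k : connected (star k).
Proof.
apply: (@connected_via (star k) None) => -[i|]; last exact: connect0.
by apply: connect1.
Qed.

Lemma bipartition_star k : @bipartition (star k) (fun x => x == None).
Proof. by move=> [i|] [j|] //; rewrite /gadj /= ?andbF. Qed.

Lemma connected_rsub (F : rootedGraph) (v0 : gV F) : connected F ->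
  (forall v : gV F, exists w, gadj v w) -> connected (rsub F).
Proof.
move=> conn niso.
have step (u v : gV F) : gadj u v -> connect (@gadj (rsub F)) (inl u) (inl v).
  move=> uv; pose e : {e | is_edge e} := exist _ [set u; v] (edge_sig_proof uv).
  apply: (@connect_trans _ _ (inr e)); apply: connect1; rewrite /gadj /= !inE eqxx ?orbT //.
have inl_conn (u v : gV F) : connect (@gadj (rsub F)) (inl u) (inl v).
  have /connectP[p pp ->] := conn u v.
  elim: p u pp => [|w p IH] u /=; first by move=> _; apply: connect0.
  by move=> /andP[uw pp]; apply: connect_trans (step _ _ uw) (IH w pp).
apply: (@connected_via (rsub F) (inl v0)) => -[v|e]; first exact: inl_conn.
have /is_edgeP[u [w [eE _]]] := valP e.
apply: connect_trans (inl_conn u v0); apply: connect1; rewrite /gadj /= eE !inE eqxx //.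
Qed.

Lemma bipartition_rsub (F : rootedGraph) :
  @bipartition (rsub F) (fun x => if x is inl _ then true else false).
Proof. by move=> [u|e] [v|e'] //; rewrite /gadj /= andbF. Qed.

Lemma gadj_Fstar1_inl (F : rootedGraph) (c : gV F -> bool) (u v : gV F) :
  roots_independent F -> gadj u v -> @gadj (Fstar1 c) (inl u) (inl v).
Proof.
move=> ind uv; case/andP: (uv) => nuv _; apply/andP; split.
  by apply: contra nuv => /eqP[->].
apply/orP; left; apply/andP; split.
  apply/andP; split; first by apply: contra nuv => /eqP[->].
  by rewrite /= uv.
by rewrite !inE; apply/negP=> /andP[uR vR]; have := ind u v uR vR; rewrite uv.
Qed.

Lemma connected_Fstar1 (F : rootedGraph) (c : gV F -> bool) (v0 : gV F) : connected F ->
  roots_independent F -> two_sided c -> connected (Fstar1 c).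
Proof.
move=> conn ind ts.
have inl_conn (u v : gV F) : connect (@gadj (Fstar1 c)) (inl u) (inl v).
  have /connectP[p pp ->] := conn u v.
  elim: p u pp => [|w p IH] u /=; first by move=> _; apply: connect0.
  by move=> /andP[uw pp]; apply: connect_trans (connect1 (gadj_Fstar1_inl c ind uw)) (IH w pp).
apply: (@connected_via (Fstar1 c) (inl v0)) => -[v|be]; first exact: inl_conn.
have [v vR cv] := ts (~~ be); apply: connect_trans (inl_conn v v0); apply: connect1.
by have := gadj_Fstar1_root c vR; rewrite cv negbK gadj_sym.
Qed.

Lemma bipartition_Fstar1 (F : rootedGraph) (c : gV F -> bool) : bipartition c ->
  @bipartition (Fstar1 c) (fun x => match x with inl v => c v | inr be => be end).
Proof.
move=> bip.
have half x y : @f1_E F c x y ->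
   match x with inl v => c v | inr be => be end != match y with inl v => c v | inr be => be end.
  by case: x y => [u|[]] [v|[]] //=; [apply: bip | case: (c v)].
have half2 x y : @gadj (F1 c) x y ->
   match x with inl v => c v | inr be => be end != match y with inl v => c v | inr be => be end.
  by move=> /andP[_ /orP[/half//|/half]]; rewrite eq_sym.
by move=> x y /andP[_ /orP[] /andP[h _]]; [apply: half2 | rewrite eq_sym; apply: half2].
Qed.

(** * The recursion on densities and the final exponents *)

Section Nice.
Local Open Scope R_scope.

Definition blowup_ubound (F : rootedGraph) (a b : nat) :=
  exists l1, forall l, (l1 <= l)%N -> ubound (blowup F l) (2 - INR b / INR a).

Definition nice (F : rootedGraph) (a b : nat) :=
  [/\ inF0 F, connected F, balanced (@gadj F) (rR F) a b,
      exists v, v \notin rR F & exists r, r \in rR F] /\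
  [/\ roots_independent F, exists c : gV F -> bool, bipartition c & blowup_ubound F a b].

Lemma ubound_star k l : (0 < k)%N -> (0 < l)%N -> ubound (blowup (star k) l) (2 - / INR k).
Proof.
move=> k0 l0; elim: k k0 => // -[|k] IH _.
  by rewrite INR_1 Rinv_1; apply: ubound_star1.
have k1 : 1 <= INR k.+1 by apply: INR_ge1.
have g1 : 0 < / INR k.+1 <= 1.
  split; first by apply: Rinv_0_lt_compat; lra.
  by rewrite -Rinv_1; apply: Rinv_le_contravar; lra.
apply: ubound_embeds (embeds_blowup_star _ l0) _.
have -> : 2 - / INR k.+2 = 2 - / INR k.+1 / (1 + / INR k.+1).
  by rewrite (S_INR k.+1); field; lra.
apply: ubound_F1 => //.
- apply: connected_blowup => //; first exact: connected_star.
  by exists (Some ord0); rewrite inE.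
- exact: bipartition_blowup (@bipartition_star _).
- exact: IH.
Qed.

Lemma nice_star k q : (0 < k)%N -> (0 < q)%N -> nice (star k) (k * q) q.
Proof.
move=> k0 q0; split; split.
- exact: F0_star.
- exact: connected_star.
- exact: balanced_star.
- by exists None; rewrite inE.
- by exists (Some (Ordinal k0)); rewrite inE.
- by move=> [i|] [j|]; rewrite !inE // /gadj /= andbF.
- by exists (fun x => x == None); apply: bipartition_star.
exists 1%N => l l0; have -> : INR q / INR (k * q) = / INR k.
  by rewrite mult_INR; have := INR_ge1 k0; have := INR_ge1 q0 => ? ?; field; lra.
exact: ubound_star.
Qed.

Lemma nice_Fstar1 (F : rootedGraph) (c : gV F -> bool) a b : (0 < b <= a)%N -> bipartition c ->
  two_sided c ->
  nice F a b -> nice (Fstar1 c) (a + b) b /\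
    exists2 c' : gV (Fstar1 c) -> bool, bipartition c' & two_sided c'.
Proof.
move=> /andP[b0 ba] bip ts [[F0 conn bal [v vR] rr] [ind _ [l1 ub]]].
split; last first.
  exists (fun x => match x with inl v => c v | inr be => be end); first exact: bipartition_Fstar1.
  by move=> be; have [w wR cw] := ts be; exists (inl w); rewrite ?inE.
split; split.
- exact: F0_star1.
- exact: connected_Fstar1.
- exact: balanced_Fstar1.
- by exists (inl v); rewrite inE.
- by exists (inr true); rewrite inE.
- by move=> x y xR yR; apply/negP=> /andP[_]; rewrite /= xR yR !andbF.
- by eexists; apply: bipartition_Fstar1 bip.
exists l1.+1 => l ll1; have l0 : (0 < l)%N by lia.
apply: ubound_embeds (embeds_blowup_Fstar1 c l0) _.
have a1 : 1 <= INR a by apply: INR_ge1; lia.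
have b1 := INR_ge1 b0; have bla : INR b <= INR a by apply: le_INR; apply/leP.
have -> : 2 - INR b / INR (a + b) = 2 - (INR b / INR a) / (1 + INR b / INR a).
  by rewrite plus_INR; field; lra.
apply: ubound_F1.
- split; first by apply: Rdiv_lt_0_compat; lra.
  by apply: (Rmult_le_reg_r (INR a)); [lra | field_simplify; lra].
- exact: connected_blowup.
- exact: bipartition_blowup.
- by apply: ub; lia.
Qed.

Definition subdivision_hypothesis := forall F : rootedGraph, inF0 F ->
  exists l0 : nat, forall l : nat, (l0 <= l)%N -> forall alpha : R, 0 < alpha ->
    bigO (fun n => INR (ex n (blowup F l))) (fun n => Rpower (INR n) (1 + alpha)) ->
    bigO (fun n => INR (ex n (rsub (blowup F l)))) (fun n => Rpower (INR n) (1 + alpha / 2)).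

Lemma nice_rsub (F : rootedGraph) a b q : subdivision_hypothesis -> (0 < b < a)%N -> (a + b = 2 *
  q)%N ->
  nice F a b -> nice (rsub F) a q /\
    exists2 c' : gV (rsub F) -> bool, bipartition c' & two_sided c'.
Proof.
move=> hyp /andP[b0 ba] abq [[F0 conn bal [v vR] [r rR']] [ind _ [l1 ub]]].
have vr : v != r by apply/eqP=> E; rewrite E rR' in vR.
have niso w := connected_neighbour w conn vr.
have [w vw] := niso v; pose e : {e | is_edge e} := exist _ [set v; w] (edge_sig_proof vw).
split; last first.
  exists (fun x => if x is inl _ then true else false); first exact: bipartition_rsub.
  by case; [exists (inl v) | exists (inr e)]; rewrite ?inE.
split; split.
- exact: F0_sub.
- exact: connected_rsub.
- by apply: balanced_rsub bal; lia.
- by exists (inl v); rewrite inE.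
- by exists (inl r); rewrite inE.
- by move=> [x|x] [y|y]; rewrite ?inE // /gadj /= andbF.
- by eexists; apply: bipartition_rsub.
have [l0 H] := hyp F F0; exists (l0 + l1).+1 => l ll.
apply: ubound_embeds (embeds_blowup_rsub _ ind) _; first by lia.
have a1 : 1 <= INR a by apply: INR_ge1; lia.
have bla : INR b < INR a by apply: lt_INR; apply/ltP.
have qE : INR q = (INR a + INR b) / 2.
  by have := congr1 INR abq; rewrite plus_INR mult_INR /=; lra.
(* This is the [alpha] of the hypothesis; it is positive because [b < a]. *)
have al0 : 0 < 1 - INR b / INR a.
  have : INR b / INR a < 1 by apply: (Rmult_lt_reg_r (INR a)); [lra | field_simplify; lra].
  lra.
have ba1 : INR b / INR a >= 0 by apply: Rle_ge; apply: Rmult_le_pos;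
  [apply: pos_INR | apply/Rlt_le/Rinv_0_lt_compat; lra].
apply: bigO_ubound.
  rewrite qE (_ : (INR a + INR b) / 2 / INR a = / 2 * (1 + INR b / INR a)); last by field; lra.
  lra.
have -> : 2 - INR q / INR a = 1 + (1 - INR b / INR a) / 2 by rewrite qE; field; lra.
apply: H => //; first by lia.
rewrite (_ : 1 + (1 - INR b / INR a) = 2 - INR b / INR a); last by lra.
by apply: ubound_bigO; apply: ub; lia.
Qed.

(** Two-sidedness is carried along for nonintegral densities: a subdivision always has it, F_*(1)
    inherits it, and subtracting 1 from a nonintegral density leaves it nonintegral, so F_*(1) is
    never applied to a bare star. *)
Lemma nice_exists a b : subdivision_hypothesis -> (0 < b <= a)%N -> exists F : rootedGraph, nice F
  a b /\
  (~~ (b %| a)%N -> exists2 c : gV F -> bool, bipartition c & two_sided c).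
Proof.
move=> hyp; move: {2}(a + b)%N (leqnn (a + b)) => n; elim: n a b => [|n IH] a b; first by lia.
move=> abn /andP[b0 ba]; have [dvd|ndvd] := boolP (b %| a)%N.
  exists (star (a %/ b)); split=> //; rewrite -{2}(divnK dvd); apply: nice_star => //.
  by rewrite divn_gt0.
have [b2|b2] := leqP (2 * b) a.
  have [||F [nF tF]] := IH (a - b)%N b; [lia|lia|].
  have [|c bip ts] := tF; first by rewrite dvdn_subl.
  have [|h1 h2] := nice_Fstar1 _ bip ts nF; first lia.
  by exists (Fstar1 c); rewrite subnK in h1.
have lt : (b < a)%N by rewrite ltn_neqAle ba andbT; apply: contra ndvd => /eqP->.
have [||F [nF _]] := IH a (2 * b - a)%N; [lia|lia|].
have [|| h1 h2] := nice_rsub (q := b) hyp _ _ nF; [lia|lia|].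
by exists (rsub F).
Qed.

Lemma nice_bigTheta (F : rootedGraph) a b : (0 < b <= a)%N -> nice F a b ->
  exists l, bigTheta (fun n => INR (ex n (blowup F l))) (fun n => Rpower (INR n) (2 - INR b / INR
    a)).
Proof.
move=> /andP[b0 ba] [[F0 conn bal [v vR] [r rR']] [ind _ [l1 ub]]].
have a0 : (0 < a)%N by lia.
have vr : v != r by apply/eqP=> E; rewrite E rR' in vR.
have [l0 [j0 LB]] := blowup_lower_bound bal a0 (ex_intro _ v vR)
  (fun w => connected_neighbour w conn vr).
exists (l0 + l1)%N; split; first by apply: ubound_bigO; apply: ub; lia.
(* Here [n] lies between [y], the order of a field host, and [2 ^ a * y], which costs [4 ^ a] in the
   square; the 8 is that of [blowup_lower_bound]. *)
exists (8 * 4 ^ a), ((2 ^ j0) ^ a)%N => n nn0.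
set E := INR (ex n _).
have p1 : (1 < 2 ^ a)%N by rewrite -(expn0 2) ltn_exp2l.
have n0 : (0 < n)%N by apply: leq_trans nn0; rewrite !expn_gt0.
pose j := trunc_log (2 ^ a) n.
have /andP[jn nj] := trunc_log_bounds p1 n0; rewrite -/j in jn nj.
have powC i : ((2 ^ a) ^ i = (2 ^ i) ^ a)%N by rewrite -!expnM mulnC.
have jj0 : (j0 <= j)%N by apply: trunc_log_max => //; rewrite powC.
have h := LB (l0 + l1)%N j n (leq_addr _ _) jj0; rewrite -powC in h; have {}h := h jn.
have powR (u i : nat) : INR (u ^ i)%N = INR u ^ i.
  by elim: i => [//|i IHi]; rewrite expnS mult_INR IHi.
pose x := INR (2 ^ j)%N; pose y := x ^ a.
have x1 : 1 <= x by apply: INR_ge1; rewrite expn_gt0.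
have y1 : 1 <= y by apply: pow_R1_Rle.
have yE : INR ((2 ^ a) ^ j)%N = y by rewrite powC powR.
have hR : y * y <= 8 * x ^ b * E.
  have E8 : INR 8 = 8 by rewrite /=; lra.
  by have := le_INR _ _ (leP h); rewrite !mult_INR yE powR -/x E8.
have nR : INR n <= 2 ^ a * y.
  have := le_INR _ _ (leP (ltnW nj)); rewrite expnS mult_INR yE powR.
  by rewrite (_ : INR 2 = 2).
have ynR : y <= INR n by rewrite -yE; apply: le_INR; apply/leP.
have aR : 1 <= INR a by apply: INR_ge1.
have xb0 : 0 < x ^ b by apply: pow_lt; lra.
have Pb : Rpower y (INR b / INR a) = x ^ b.
  rewrite /y -(Rpower_pow a); last by lra.
  rewrite Rpower_mult (_ : INR a * (INR b / INR a) = INR b); last by field; lra.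
  by rewrite Rpower_pow; lra.
have hb : x ^ b <= Rpower (INR n) (INR b / INR a).
  rewrite -Pb; apply: Rpower_le_pos => //; last by lra.
  by apply: Rmult_le_pos; [apply: pos_INR | apply/Rlt_le/Rinv_0_lt_compat; lra].
have -> : Rpower (INR n) (2 - INR b / INR a) = INR n ^ 2 / Rpower (INR n) (INR b / INR a).
  rewrite /Rminus Rpower_plus Rpower_Ropp -(Rpower_pow 2) //; lra.
set Z := Rpower _ _ in hb *.
have Z0 : 0 < Z by apply: exp_pos.
have n2 : INR n ^ 2 <= 4 ^ a * (y * y).
  have -> : 4 ^ a = 2 ^ a * 2 ^ a by rewrite -Rpow_mult_distr; congr (_ ^ _); lra.
  have A0 : 0 < 2 ^ a by apply: pow_lt; lra.
  rewrite /= Rmult_1_r; have := Rmult_le_compat _ _ _ _ (pos_INR n) (pos_INR n) nR nR; lra.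
apply: (Rmult_le_reg_r Z) => //.
rewrite /Rdiv Rmult_assoc Rinv_l ?Rmult_1_r; last by lra.
apply: Rle_trans n2 _.
have A0 : 0 < 4 ^ a by apply: pow_lt; lra.
have E0 : 0 <= E by apply: pos_INR.
have h1 : y * y <= 8 * Z * E.
  apply: Rle_trans hR _; apply: Rmult_le_compat_r => //; lra.
have := Rmult_le_compat_l _ _ _ (Rlt_le _ _ A0) h1; lra.
Qed.

Definition triangle : graph := @Graph 'I_3 (fun _ _ => true).

Lemma triangle_bigTheta :
  bigTheta (fun n => INR (ex n triangle)) (fun n => Rpower (INR n) 2).
Proof.
split.
  apply: ubound_bigO; exists 1; split; first by lra.
  move=> G _; rewrite Rmult_1_l; have [->|G0] := posnP (narcs G).
    exact/Rlt_le/exp_pos.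
  have V0 : (0 < #|gV G|)%N by rewrite lt0n; apply/eqP=> E; have := leq_trans G0 (narcs_max G);
    rewrite E.
  have V1 := INR_ge1 V0; have E2 : 2 = INR 2 by rewrite /=; lra.
  rewrite E2 Rpower_pow; last by lra.
  by rewrite /= Rmult_1_r -mult_INR; apply: le_INR; apply/leP; apply: narcs_max.
(* A bipartite half of the complete graph gives [n * n <= n + 4 * ex n triangle], and [n] is at most
   half of its square from 2 on. *)
exists 8, 2%N => n n2.
have n1 : 2 <= INR n by have := le_INR _ _ (leP n2); rewrite /=; lra.
pose e : rel 'I_n := fun x y => x != y.
have irr : irreflexive e by move=> x; rewrite /e eqxx.
have [c hc] := bipartite_half irr.
pose G := @Graph 'I_n (fun x y => c x != c y).
have gE (x y : 'I_n) : @gadj G x y = (x != y) && (c x != c y).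
  by rewrite /gadj /= [c y == _]eq_sym orbb.
have nt : ~ embeds triangle G.
  move=> [f finj fe].
  have h (i j : 'I_3) : i != j -> c (f i) != c (f j).
    move=> ij; have : @gadj triangle i j by rewrite /gadj ij.
    by move=> /fe; rewrite gE => /andP[].
  have := h (inord 0) (inord 1); have := h (inord 1) (inord 2); have := h (inord 0) (inord 2).
  rewrite -!(inj_eq val_inj) /= !inordK //.
  by move=> /(_ isT) + /(_ isT) + /(_ isT); case: (c _); case: (c _); case: (c _).
have h1 : (n * n <= n + 4 * ex n triangle)%N.
  have := narcs_le_ex nt; rewrite /= card_ord => h1.
  have h2 : narcs G = #|[set p : 'I_n * 'I_n | e p.1 p.2 && (c p.1 != c p.2)]|.
    by apply: eq_card => p; rewrite !inE gE.
  have sym : symmetric e by move=> x y; rewrite /e eq_sym.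
  have h3 := card_sym_rel sym irr.
  have h4 : #|[set p : 'I_n * 'I_n | (p.1 < p.2)%N && e p.1 p.2]| = #|[set p : 'I_n * 'I_n | (p.1 <
    p.2)%N]|.
    apply: eq_card => p; rewrite !inE /e; apply: andb_idr => lt.
    by apply/eqP=> E; rewrite E ltnn in lt.
  have := card_lt_pairs n; move: hc; rewrite -h2 h3 h4; lia.
have E4 : INR 4 = 4 by rewrite /=; lra.
have := le_INR _ _ (leP h1); rewrite plus_INR !mult_INR E4 => h2.
have E2 : 2 = INR 2 by rewrite /=; lra.
rewrite E2 Rpower_pow; last by lra.
rewrite /= Rmult_1_r; nra.
Qed.

Lemma double_ratio q : (0 < q)%N -> INR (2 * q) / INR q = 2.
Proof. by move=> /INR_ge1 q1; rewrite mult_INR /=; field; lra. Qed.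

Lemma ratio_complement p q : (0 < q)%N -> (p <= 2 * q)%N ->
  INR p / INR q = 2 - INR (2 * q - p) / INR q.
Proof.
move=> /INR_ge1 q1 p2q; rewrite minus_INR; last exact/leP.
by rewrite mult_INR /=; field; lra.
Qed.

End Nice.

Theorem theorem4p6 :
  (forall F : rootedGraph, inF0 F ->
     exists l0 : nat, forall l : nat, (l0 <= l)%N ->
       forall alpha : R, Rlt 0 alpha ->
         bigO (fun n => INR (ex n (blowup F l))) (fun n => Rpower (INR n) (Rplus 1 alpha)) ->
         bigO (fun n => INR (ex n (rsub (blowup F l))))
              (fun n => Rpower (INR n) (Rplus 1 (Rdiv alpha 2)))) ->
  forall p q : nat, (0 < q)%N -> (q <= p <= 2 * q)%N ->
    exists F : graph,
      bigTheta (fun n => INR (ex n F)) (fun n => Rpower (INR n) (Rdiv (INR p) (INR q))).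
Proof.
move=> hyp p q q0 /andP[qp p2q].
have [p2|p2] := leqP (2 * q) p.
  exists triangle; have -> : p = (2 * q)%N by lia.
  by rewrite double_ratio //; apply: triangle_bigTheta.
have bq : (0 < 2 * q - p <= q)%N by lia.
have [F [nF _]] := nice_exists hyp bq.
have [l h] := nice_bigTheta bq nF; exists (blowup F l).
by rewrite (ratio_complement q0 p2q).
Qed.
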